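(* Assume $\mathbb{A}$ is associative and let $X$ be a Banach $\mathbb{A}$-bimodule. Let $D(A)$ be a dense right $\mathbb{A}$-submodule of $X$ and let $A:D(A)\to X$ be a spherical $\delta$-sectorial operator, $\delta\in(0,\pi/2)$, for which there exists $M\in(0,\infty)$ such that $$\|\mathsf{C}_\alpha(A)\|\le\frac{M}{|\alpha|}\qquad\forall\alpha\in\Sigma_\delta.$$ Fix $\mathbf{j}\in\mathbb{S}_{\mathbb{A}}$ and define the map $T:[0,\infty)\to\mathscr{L}^{r}(X)$ by $T(0):=\mathrm{Id}$ and $$T(t):=\frac1{2\pi}\int_{\Gamma(\mathbf{j};r;\eta)}\mathsf{C}_\alpha(A)\,\mathbf{j}^{-1}e^{t\alpha}\,d\alpha\qquad\forall t>0,$$ for some $r\in(0,\infty)$ and $\eta\in(\pi/2,\pi/2+\delta)$. Then $T$ is the (strongly continuous) semigroup generated by $A$ and $$\mathsf{C}_\lambda(A)=\mathsf{R}_\lambda(A)=\int_0^\infty e^{-t\lambda}T(t)\,dt\qquad\forall\lambda>0.$$ As a consequence, the integral defining $T(t)$ is independent of $\mathbf{j}\in\mathbb{S}_{\mathbb{A}}$ and $T$ is analytic in time.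
   Context: Algebra. $\mathbb{A}$ is a finite dimensional real alternative algebra with unity $1\ne 0$ (here assumed associative); $\mathbb{R}$ is identified with $\mathbb{R}\cdot 1\subseteq\mathbb{A}$. It is equipped with an anti-involution $\alpha\mapsto\alpha^c$: $\mathbb{R}$-linear, $(\alpha^c)^c=\alpha$, $(\alpha\beta)^c=\beta^c\alpha^c$, $r^c=r$ for $r\in\mathbb{R}$. Put $t(\alpha)=\alpha+\alpha^c$, $n(\alpha)=\alpha\alpha^c$, $\mathrm{Re}(\alpha)=(\alpha+\alpha^c)/2$; quadratic cone $Q_{\mathbb{A}}:=\mathbb{R}\cup\{\alpha\in\mathbb{A}: t(\alpha),n(\alpha)\in\mathbb{R},\ t(\alpha)^2-4n(\alpha)<0\}$; $\mathbb{S}_{\mathbb{A}}:=\{\mathbf{j}\in Q_{\mathbb{A}}:\mathbf{j}^2=-1\}$; $\mathbb{C}_{\mathbf{j}}$ is the subalgebra generated by $1,\mathbf{j}$ (a copy of $\mathbb{C}$). It is assumed that $\mathbb{S}_{\mathbb{A}}\neq\emptyset$ and that $\mathbb{A}$ is endowed with a norm $|\cdot|$ (as a real vector space) with $|\alpha|=\sqrt{n(\alpha)}$ for every $\alpha\in Q_{\mathbb{A}}$. One has $Q_{\mathbb{A}}=\bigcup_{\mathbf{j}\in\mathbb{S}_{\mathbb{A}}}\mathbb{C}_{\mathbf{j}}$, with $\mathbb{C}_{\mathbf{j}}\cap\mathbb{C}_{\mathbf{k}}=\mathbb{R}$ if $\mathbf{j}\ne\pm\mathbf{k}$. Bimodules.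 An $\mathbb{A}$-bimodule (for associative $\mathbb{A}$) is an abelian group $V$ with left and right scalar multiplications by $\mathbb{A}$, additive in each argument, with $1u=u=u1$, $\alpha(\beta u)=(\alpha\beta)u$, $(u\alpha)\beta=u(\alpha\beta)$, $\alpha(u\beta)=(\alpha u)\beta$ for $\alpha,\beta\in\mathbb{A}$, and $ru=ur$ for $r\in\mathbb{R}$. A norm on $V$ is a function $\|\cdot\|:V\to[0,\infty)$ with $\|u\|=0\iff u=0$, $\|u+v\|\le\|u\|+\|v\|$, $\|\alpha u\|\le|\alpha|\|u\|$ and $\|u\alpha\|\le|\alpha|\|u\|$ for $\alpha\in\mathbb{A}$, and $\|\alpha u\|=\|u\alpha\|=|\alpha|\|u\|$ for $\alpha\in Q_{\mathbb{A}}$. A Banach $\mathbb{A}$-bimodule is one with a complete norm. Operators. A right $\mathbb{A}$-submodule is an abelian subgroup closed under right scalar multiplication. A right linear operator is an additive map $A:D(A)\to X$, $D(A)$ a right $\mathbb{A}$-submodule, with $A(u\alpha)=A(u)\alpha$; it is closed if its graph is closed in $X\times X$. $\mathscr{L}^{r}(X)$ is the set of right linear operators with domain $X$ and finite operator norm $\|B\|=\sup_{u\ne0}\|Bu\|/\|u\|$; it is a Banach $\mathbb{A}$-bimodule with $(\alpha B)(u)=\alpha B(u)$, $(B\alpha)(u)=B(\alpha u)$. $D(A^2)=\{x\in D(A):Ax\in D(A)\}$. For $\alpha\in Q_{\mathbb{A}}$, $\Delta_\alpha(A):=A^2-2\mathrm{Re}(\alpha)A+|\alpha|^2\mathrm{Id}:D(A^2)\to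 X$. Spherical resolvent set: $\rho_{s}(A):=\{\alpha\in Q_{\mathbb{A}}:\Delta_\alpha(A)\text{ bijective},\ \Delta_\alpha(A)^{-1}\in\mathscr{L}^{r}(X)\}$. For $\alpha\in\rho_{s}(A)$: $\mathsf{Q}_\alpha(A):=\Delta_\alpha(A)^{-1}$ and $\mathsf{C}_\alpha(A):=\mathsf{Q}_\alpha(A)\alpha^c-A\,\mathsf{Q}_\alpha(A)$ (spherical resolvent operator). For real $\lambda$ such that $\lambda\mathrm{Id}-A:D(A)\to X$ is bijective, $\mathsf{R}_\lambda(A):=(\lambda\mathrm{Id}-A)^{-1}$. Sectorial operators. For $\alpha\in Q_{\mathbb{A}}\setminus\mathbb{R}$ there are unique $\mathbf{j}\in\mathbb{S}_{\mathbb{A}}$, $\rho>0$, $\theta\in(0,\pi)$ with $\alpha=\rho e^{\theta\mathbf{j}}$; $\arg(\alpha):=\theta$; also $\arg(\alpha)=0$ for $\alpha\in(0,\infty)$, $\arg(\alpha)=\pi$ for $\alpha\in(-\infty,0)$. For $\delta\in(0,\pi/2)$ let $\Sigma_\delta:=\{\alpha\in Q_{\mathbb{A}}\setminus\{0\}:\arg(\alpha)<\pi/2+\delta\}$. A closed right linear operator $A$ with dense domain is spherical $\delta$-sectorial if $\Sigma_\delta\subseteq\rho_{s}(A)$. Contour integrals. For a $C^1$ path $\gamma:[a,b]\to\mathbb{C}_{\mathbf{j}}$ and a continuous $\mathscr{L}^{r}(X)$-valued $\Psi$ on its image, $\int_\gamma\Psi(\alpha)\,d\alpha:=\int_a^b\Psi(\gamma(s))\gamma'(s)\,ds$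 (Bochner integral in $\mathscr{L}^{r}(X)$, with right multiplication by the scalar $\gamma'(s)$). $\Gamma(\mathbf{j};r;\eta)$ is the contour in $\mathbb{C}_{\mathbf{j}}$ formed by the ray $\{\rho e^{-\eta\mathbf{j}}:\rho\ge r\}$ traversed from infinity to $re^{-\eta\mathbf{j}}$, then the arc $\theta\mapsto re^{\theta\mathbf{j}}$, $\theta\in[-\eta,\eta]$, then the ray $\rho\mapsto\rho e^{\eta\mathbf{j}}$, $\rho\ge r$, traversed to infinity. The integral over $\Gamma(\mathbf{j};r;\eta)$ converges if the integrals over the two truncated rays ($r\le\rho\le h$) each have a limit in $\mathscr{L}^{r}(X)$ as $h\to\infty$, and is then the sum of these limits and the integral over the arc. Semigroups. A semigroup is a map $T:[0,\infty)\to\mathscr{L}^{r}(X)$ with $T(t+s)=T(t)T(s)$ for $t,s>0$ and $T(0)=\mathrm{Id}$; it is strongly continuous if $t\mapsto T(t)x$ is continuous on $[0,\infty)$ for every $x\in X$. Its generator is the operator $A$ with $D(A)=\{x:\lim_{h\to0^+}\frac1h(T(h)x-x)\text{ exists}\}$, $Ax$ being that limit. ''Analytic in time'' means that $t\mapsto T(t)$ is a real analytic map from $(0,\infty)$ to $\mathscr{L}^{r}(X)$. *)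

(* Defs.v *)
(* MathComp-Analysis, over an arbitrary R : realType. *)
From HB Require Import structures.
From mathcomp Require Import all_boot all_order all_algebra all_field.
From mathcomp Require Import complex.
From mathcomp Require Import all_classical all_reals all_analysis.

Set Implicit Arguments.
Unset Strict Implicit.
Unset Printing Implicit Defensive.

Import Order.TTheory GRing.Theory Num.Theory.
Import numFieldNormedType.Exports.

Local Open Scope classical_set_scope.
Local Open Scope ring_scope.

(** * Algebras *)

(* [r%:A] is the element r.1 of the algebra, so that "t(a) is real" reads
   [a + c a = t%:A] for some t. *)
Definition quadratic_cone (R : realType) (K : falgType R) (c : K -> K)
    : set K :=
  [set a | (exists r : R, a = r%:A) \/
           (exists t n : R, [/\ a + c a = t%:A, a * c a = n%:A &
                                t ^+ 2 - 4 * n < 0])].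

Definition imaginary_units (R : realType) (K : falgType R) (c : K -> K)
    : set K :=
  [set j | quadratic_cone c j /\ j * j = -1].

(* A finite dimensional real associative algebra with 1 <> 0, together with an
   anti-involution and a norm, such that there are imaginary units. *)
Record starAlgebra (R : realType) := StarAlgebra {
  sa_algebra :> falgType R ;
  sa_conj : sa_algebra -> sa_algebra ;
  sa_norm : sa_algebra -> R ;
  sa_conj_linear : forall (r : R) a b,
    sa_conj (r *: a + b) = r *: sa_conj a + sa_conj b ;
  sa_conjK : forall a, sa_conj (sa_conj a) = a ;
  sa_conjM : forall a b, sa_conj (a * b) = sa_conj b * sa_conj a ;
  sa_conj_real : forall r : R, sa_conj r%:A = r%:A ;
  sa_norm_ge0 : forall a, 0 <= sa_norm a ;
  sa_norm_eq0 : forall a, sa_norm a = 0 -> a = 0 ;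
  sa_normD : forall a b, sa_norm (a + b) <= sa_norm a + sa_norm b ;
  sa_normZ : forall (r : R) a, sa_norm (r *: a) = `|r| * sa_norm a ;
  sa_norm_cone : forall a (n : R), quadratic_cone sa_conj a ->
    a * sa_conj a = n%:A -> sa_norm a = Num.sqrt n ;
  sa_units_neq0 : imaginary_units sa_conj !=set0
}.

Section Cone.
Context {R : realType} {K : starAlgebra R}.
Implicit Types (a j : K) (z : R[i]).

Definition QA : set K := quadratic_cone (@sa_conj R K).
Definition SA : set K := imaginary_units (@sa_conj R K).

Definition ReA a : K := (2^-1 : R) *: (a + sa_conj a).

(* The isomorphism from the complex numbers onto the slice generated by 1
   and j. *)
Definition slice j z : K := (complex.Re z)%:A + complex.Im z *: j.

Definition polar (rho theta : R) : R[i] :=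
  Complex (rho * cos theta) (rho * sin theta).

Definition cexp z : R[i] := polar (expR (complex.Re z)) (complex.Im z).

Definition is_arg a (theta : R) : Prop :=
  [\/ theta = 0 /\ (exists2 x : R, 0 < x & a = x%:A),
      theta = pi /\ (exists2 x : R, x < 0 & a = x%:A) |
      [/\ 0 < theta, theta < pi &
          exists j (rho : R), [/\ SA j, 0 < rho & a = slice j (polar rho theta)]]].

Definition argA a : R := xget 0 [set theta | is_arg a theta].

Definition Sigma (delta : R) : set K :=
  [set a | [/\ QA a, a != 0 & argA a < pi / 2 + delta]].

End Cone.

(** * Bimodules *)

(* The real scalar action of the underlying real Banach space is the one of
   R.1, on both sides; since R.1 is contained in the quadratic cone,
   the norm axioms below are compatible with homogeneity over R. *)
Record banachBimodule (R : realType) (K : starAlgebra R) := BanachBimodule {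
  bb_space :> completeNormedModType R ;
  lact : K -> bb_space -> bb_space ;
  ract : bb_space -> K -> bb_space ;
  lactDl : forall a b u, lact (a + b) u = lact a u + lact b u ;
  lactDr : forall a u v, lact a (u + v) = lact a u + lact a v ;
  ractDl : forall u v a, ract (u + v) a = ract u a + ract v a ;
  ractDr : forall u a b, ract u (a + b) = ract u a + ract u b ;
  lactA : forall a b u, lact a (lact b u) = lact (a * b) u ;
  ractA : forall u a b, ract (ract u a) b = ract u (a * b) ;
  lractA : forall a u b, lact a (ract u b) = ract (lact a u) b ;
  lact_real : forall (r : R) u, lact r%:A u = r *: u ;
  ract_real : forall (r : R) u, ract u r%:A = r *: u ;
  lact_norm_le : forall a u, `|lact a u| <= sa_norm a * `|u| ;
  ract_norm_le : forall u a, `|ract u a| <= sa_norm a * `|u| ;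
  lact_norm : forall a u, QA a -> `|lact a u| = sa_norm a * `|u| ;
  ract_norm : forall u a, QA a -> `|ract u a| = sa_norm a * `|u|
}.

(** * Bounded right linear operators *)

Section BoundedOperators.
Context {R : realType} {K : starAlgebra R} {X : banachBimodule K}.
Implicit Types (f : X -> X).

(* Equal to +oo on unbounded maps, and to -oo (the supremum of the empty set)
   when X is trivial. *)
Definition opnorm f : \bar R :=
  ereal_sup [set ((`|f u| / `|u|)%:E : \bar R) | u in [set u : X | u != 0]].

Definition bounded_right_linear f : Prop :=
  [/\ forall u v, f (u + v) = f u + f v,
      forall u (a : K), f (ract u a) = ract (f u) a &
      (opnorm f < +oo)%E].

Definition brl_pred : {pred X -> X} := fun f => `[< bounded_right_linear f >].

Lemma opnorm_leP f (M : R) : 0 <= M ->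
  f 0 = 0 -> ((opnorm f <= M%:E)%E <-> forall u, `|f u| <= M * `|u|).
Proof.
move=> M0 f0; split=> [fM u|fM].
  have [->|u0] := eqVneq u 0; first by rewrite f0 !normr0 mulr0.
  rewrite -ler_pdivrMr ?normr_gt0// -lee_fin; apply: le_trans fM.
  by apply: ereal_sup_ubound; exists u.
apply: ge_ereal_sup => _ [u /= u0 <-].
by rewrite lee_fin ler_pdivrMr ?normr_gt0.
Qed.

Lemma brl0 f : bounded_right_linear f -> f 0 = 0.
Proof. by case=> fD _ _; apply: (addIr (f 0)); rewrite -fD !add0r. Qed.

Lemma opnorm_fine f : bounded_right_linear f ->
  0 <= fine (opnorm f) /\ (opnorm f <= (fine (opnorm f))%:E)%E.
Proof.
case=> _ _ fb.
have [/eqP E0|/set0P[u /= u0]] := boolP ([set u : X | u != 0] == set0).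
  by rewrite /opnorm E0 image_set0 ereal_sup0; split=> //=; rewrite leNye.
have le0 : (0 <= opnorm f)%E.
  apply: (@le_trans _ _ (`|f u| / `|u|)%:E); first by rewrite lee_fin.
  by apply: ereal_sup_ubound; exists u.
by rewrite fineK ?fine_ge0// ge0_fin_numE.
Qed.

Lemma brl_bound f : bounded_right_linear f ->
  forall u, `|f u| <= fine (opnorm f) * `|u|.
Proof.
by move=> fb; have [f0 ff] := opnorm_fine fb; apply/opnorm_leP => //; exact: brl0.
Qed.

Lemma brlP f : (forall u v, f (u + v) = f u + f v) ->
  (forall u (a : K), f (ract u a) = ract (f u) a) ->
  forall M, 0 <= M -> (forall u, `|f u| <= M * `|u|) ->
  bounded_right_linear f /\ fine (opnorm f) <= M.
Proof.
move=> fD fr M M0 fM.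
have f0 : f 0 = 0 by apply: (addIr (f 0)); rewrite -fD !add0r.
have /(opnorm_leP M0 f0) fle := fM.
have fb : bounded_right_linear f by split=> //; exact: le_lt_trans fle (ltry _).
split=> //; have [_] := opnorm_fine fb.
move: fle; case: (opnorm f) => //= r; by rewrite lee_fin.
Qed.

Fact brl_submod_closed : submod_closed brl_pred.
Proof.
have ract0 (a : K) : ract (0 : X) a = 0.
  by apply: (addIr (ract 0 a)); rewrite -ractDl !add0r.
split=> [|r f g /asboolP fb /asboolP gb]; apply/asboolP.
  apply: (proj1 (@brlP (0 : X -> X) _ _ 0 (lexx 0) _)) => [u v|u a|u].
  - by rewrite addr0.
  - by rewrite ract0.
  - by rewrite mul0r normr0.
have [fD fr _] := fb; have [gD gr _] := gb.
have [f0 _] := opnorm_fine fb; have [g0 _] := opnorm_fine gb.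
have M0 : 0 <= `|r| * fine (opnorm f) + fine (opnorm g).
  by rewrite addr_ge0// mulr_ge0.
apply: (proj1 (@brlP (r *: f + g) _ _ _ M0 _)) => [u v|u a|u].
- by rewrite !fctE fD gD scalerDr addrACA.
- rewrite !fctE fr gr ractDl; congr (_ + _).
  by rewrite -!ract_real !ractA -scalerAl mul1r -scalerAr mulr1.
- rewrite !fctE (le_trans (ler_normD _ _))// mulrDl lerD//.
    by rewrite normrZ -mulrA ler_wpM2l// brl_bound.
  exact: brl_bound.
Qed.

HB.instance Definition _ :=
  GRing.isSubmodClosed.Build R (X -> X) brl_pred brl_submod_closed.

End BoundedOperators.

Section Lr.
Context {R : realType} {K : starAlgebra R}.

Record Lr (X : banachBimodule K) := MkLr {
  Lr_fun :> X -> X ;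
  Lr_funP : Lr_fun \in brl_pred }.

Context {X : banachBimodule K}.

HB.instance Definition _ := [isSub for @Lr_fun X].
HB.instance Definition _ := [Choice of Lr X by <:].
HB.instance Definition _ := [SubChoice_isSubLmodule of Lr X by <:].

Lemma Lr_brl (B : Lr X) : bounded_right_linear B.
Proof. exact/asboolP/Lr_funP. Qed.

Definition Lr_norm (B : Lr X) : R := fine (opnorm B).

Fact Lr_normD (B C : Lr X) : Lr_norm (B + C) <= Lr_norm B + Lr_norm C.
Proof.
have [D r _] := Lr_brl (B + C).
have [B0 _] := opnorm_fine (Lr_brl B); have [C0 _] := opnorm_fine (Lr_brl C).
have [//||_ //] := brlP D r (M := Lr_norm B + Lr_norm C); first exact: addr_ge0.
move=> u; rewrite (le_trans (ler_normD _ _))// mulrDl lerD//;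
  exact/brl_bound/Lr_brl.
Qed.

Lemma Lr_normZ_le (r : R) (B : Lr X) : Lr_norm (r *: B) <= `|r| * Lr_norm B.
Proof.
have [D rr _] := Lr_brl (r *: B).
have [B0 _] := opnorm_fine (Lr_brl B).
have [//||_ //] := brlP D rr (M := `|r| * Lr_norm B); first exact: mulr_ge0.
move=> u; rewrite [leLHS]normrZ -mulrA ler_wpM2l//; exact/brl_bound/Lr_brl.
Qed.

Fact Lr_normZ (r : R) (B : Lr X) : Lr_norm (r *: B) = `|r| * Lr_norm B.
Proof.
apply/eqP; rewrite eq_le Lr_normZ_le/=.
have [->|r0] := eqVneq r 0.
  by rewrite normr0 mul0r; have [] := opnorm_fine (Lr_brl (0 *: B)).
rewrite -ler_pdivlMl ?normr_gt0// -normfV.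
by rewrite -[X in Lr_norm X <= _](scalerK r0) Lr_normZ_le.
Qed.

Fact Lr_norm0 (B : Lr X) : Lr_norm B = 0 -> B = 0.
Proof.
move=> B0; apply/val_inj/funext => u; apply/eqP.
by rewrite -normr_le0 -(mul0r `|u|) -B0; exact/brl_bound/Lr_brl.
Qed.

HB.instance Definition _ :=
  @Lmodule_isNormed.Build R (Lr X) Lr_norm Lr_normD Lr_normZ Lr_norm0.

Fact Lr_id_subproof : (idfun : X -> X) \in brl_pred.
Proof.
apply/asboolP.
by apply: (proj1 (@brlP R K X idfun _ _ 1 ler01 _)) => // u; rewrite mul1r.
Qed.

Definition Lr_id : Lr X := MkLr Lr_id_subproof.

Fact Lr_ract_subproof (B : Lr X) (a : K) : (fun u => B (lact a u)) \in brl_pred.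
Proof.
have [D r _] := Lr_brl B; have [B0 _] := opnorm_fine (Lr_brl B).
have M0 : 0 <= Lr_norm B * sa_norm a by rewrite mulr_ge0// sa_norm_ge0.
apply/asboolP.
apply: (proj1 (@brlP R K X (fun u => B (lact a u)) _ _ _ M0 _)) => [u v|u b|u].
- by rewrite lactDr D.
- by rewrite lractA r.
- rewrite (le_trans (brl_bound (Lr_brl B) _))// -mulrA ler_wpM2l//.
  exact: lact_norm_le.
Qed.

(* (B a)(u) = B(a u) *)
Definition Lr_ract (B : Lr X) (a : K) : Lr X := MkLr (Lr_ract_subproof B a).

(* f as an element of the space of bounded right linear operators; the zero
   operator if it is not one *)
Definition to_Lr (f : X -> X) : Lr X := insubd (0 : Lr X) f.

End Lr.

(** * Closed operators and their spherical resolvents *)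

(* The values of [ro_fun] outside [ro_dom] are irrelevant. *)
Record rightOperator (R : realType) (K : starAlgebra R)
    (X : banachBimodule K) := RightOperator {
  ro_dom : set X ;
  ro_fun :> X -> X ;
  ro_dom0 : ro_dom 0 ;
  ro_domB : forall u v, ro_dom u -> ro_dom v -> ro_dom (u - v) ;
  ro_dom_ract : forall u a, ro_dom u -> ro_dom (ract u a) ;
  ro_additive : forall u v, ro_dom u -> ro_dom v ->
    ro_fun (u + v) = ro_fun u + ro_fun v ;
  ro_ract : forall u a, ro_dom u -> ro_fun (ract u a) = ract (ro_fun u) a
}.

Section SphericalResolvent.
Context {R : realType} {K : starAlgebra R} {X : banachBimodule K}.
Implicit Types (A : rightOperator X) (a : K).

Definition ro_graph A : set (X * X) :=
  [set p | ro_dom A p.1 /\ p.2 = A p.1].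

Definition ro_dom2 A : set X := [set x | ro_dom A x /\ ro_dom A (A x)].

Definition Delta A a (x : X) : X :=
  A (A x) - lact (2 *: ReA a) (A x) + (sa_norm a ^+ 2) *: x.

(* [Qres A a] (resp. [Rres A l]) is the inverse of [Delta A a] (resp. of
   l Id - A) when it is bijective from its domain onto X. *)
Definition Qres A a : X -> X := 'pinv_(fun=> 0) (ro_dom2 A) (Delta A a).

Definition spherical_resolvent_set A : set K :=
  [set a | [/\ QA a, set_bij (ro_dom2 A) [set: X] (Delta A a) &
               bounded_right_linear (Qres A a)]].

Definition Cres A a (x : X) : X := Qres A a (lact (sa_conj a) x) - A (Qres A a x).

Definition Rres A (l : R) : X -> X :=
  'pinv_(fun=> 0) (ro_dom A) (fun x => l *: x - A x).

Definition spherical_sectorial (delta : R) A : Prop :=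
  [/\ closed (ro_graph A), dense (ro_dom A) &
      Sigma delta `<=` spherical_resolvent_set A].

End SphericalResolvent.

(** * Bochner integral *)

Section Bochner.
Context {R : realType} {d : measure_display} {T : measurableType d}
  {E : normedModType R}.
Variables (mu : {measure set T -> \bar R}) (D : set T).

Record simpleFun := SimpleFun {
  sf_size : nat ;
  sf_set : 'I_sf_size -> set T ;
  sf_vec : 'I_sf_size -> E ;
  sf_measurable : forall i, measurable (sf_set i) ;
  sf_sub : forall i, sf_set i `<=` D ;
  sf_finite : forall i, (mu (sf_set i) < +oo)%E
}.

Definition sf_eval (s : simpleFun) (x : T) : E :=
  \sum_(i < sf_size s) (\1_(sf_set i) x : R) *: sf_vec i.

Definition sf_integral (s : simpleFun) : E :=
  \sum_(i < sf_size s) fine (mu (sf_set i)) *: sf_vec i.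

Definition is_bochner (f : T -> E) (I : E) : Prop :=
  exists s : nat -> simpleFun,
    [/\ forall n, measurable_fun D (fun x => `|f x - sf_eval (s n) x|),
        (\int[mu]_(x in D) `|f x - sf_eval (s n) x|%:E)%E @[n --> \oo] --> 0%E &
        sf_integral (s n) @[n --> \oo] --> I].

Definition bochner_integrable (f : T -> E) : Prop := exists I, is_bochner f I.

Definition bochner (f : T -> E) : E := xget 0 [set I | is_bochner f I].

End Bochner.

(** * Contour integrals *)

Section Contour.
Context {R : realType} {K : starAlgebra R} {X : banachBimodule K}.
Implicit Types (j : K) (g : R -> R[i]) (Psi : R[i] -> Lr X).

(* Paths and integrands in the slice of j are given in the complex coordinate
   z of the point [slice j z]. *)
Definition path_deriv g (s : R) : R[i] :=
  Complex (derive1 (fun s => complex.Re (g s)) s)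
          (derive1 (fun s => complex.Im (g s)) s).

Definition contour_integrand j g Psi (s : R) : Lr X :=
  Lr_ract (Psi (g s)) (slice j (path_deriv g s)).

Definition contour_integrable j g (a b : R) Psi : Prop :=
  bochner_integrable lebesgue_measure `[a, b] (contour_integrand j g Psi).

Definition contour_integral j g (a b : R) Psi : Lr X :=
  bochner lebesgue_measure `[a, b] (contour_integrand j g Psi).

(* The incoming ray, from h e^(-eta j) to r e^(-eta j), is parametrized by
   s in [-h, -r]. *)
Definition ray_in (eta s : R) : R[i] := polar (- s) (- eta).
Definition arc (r theta : R) : R[i] := polar r theta.
Definition ray_out (eta rho : R) : R[i] := polar rho eta.

Definition Gamma_converges j (r eta : R) Psi : Prop :=
  [/\ forall h, r <= h -> contour_integrable j (ray_in eta) (- h) (- r) Psi,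
      cvg (contour_integral j (ray_in eta) (- h) (- r) Psi @[h --> +oo]),
      contour_integrable j (arc r) (- eta) eta Psi,
      forall h, r <= h -> contour_integrable j (ray_out eta) r h Psi &
      cvg (contour_integral j (ray_out eta) r h Psi @[h --> +oo])].

Definition Gamma_integral j (r eta : R) Psi : Lr X :=
  lim (contour_integral j (ray_in eta) (- h) (- r) Psi @[h --> +oo])
  + contour_integral j (arc r) (- eta) eta Psi
  + lim (contour_integral j (ray_out eta) r h Psi @[h --> +oo]).

(* C_alpha(A) j^-1 e^(t alpha), for alpha = slice j z *)
Definition semigroup_integrand (A : rightOperator X) j (t : R) (z : R[i]) :=
  Lr_ract (Lr_ract (to_Lr (Cres A (slice j z))) j^-1)
          (slice j (cexp (real_complex R t * z))).

End Contour.

(** * Semigroups *)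

Section Semigroup.
Context {R : realType} {K : starAlgebra R} {X : banachBimodule K}.
Implicit Types (T : R -> Lr X) (A : rightOperator X).

Definition is_semigroup T : Prop :=
  T 0 = Lr_id /\
  (forall t s, 0 < t -> 0 < s -> (T (t + s) : X -> X) = T t \o T s).

Definition strongly_continuous T : Prop :=
  forall x : X, {within `[0, +oo[, continuous (fun t => T t x)}.

Definition generator_graph T : set (X * X) :=
  [set p | h^-1 *: (T h p.1 - p.1) @[h --> 0^'+] --> p.2].

Definition is_generator A T : Prop := ro_graph A = generator_graph T.

End Semigroup.

Definition real_analytic_on (R : realType) (E : normedModType R) (D : set R)
    (f : R -> E) : Prop :=
  forall t0, D t0 -> exists a : nat -> E, exists2 e : R, 0 < e &
    forall t, D t -> `|t - t0| < e ->
      (\sum_(0 <= k < n) (t - t0) ^+ k *: a k) @[n --> \oo] --> f t.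

(* Main.v *)
Require Import Defs.
From HB Require Import structures.
From mathcomp Require Import all_boot all_order all_algebra all_field.
From mathcomp Require Import complex.
From mathcomp Require Import all_classical all_reals all_analysis.
From mathcomp Require Import measurable_realfun ring lra.

(** The semigroup is the inverse Laplace transform of the resolvent.  There is
    no resolvent (z - A)^-1 for a non-real point z of a slice, only a spherical
    one, but two operators replace it.  For z = x + i y and Q = Q_z(A) put
      P = x Q - A Q,   Y = y Q,   so that   C_z(A) = P - Y j,
    and, for a complex number w, put K(z, w) = Im w P - Re w Y.  Formally
    K(z, w) is the imaginary part of (z - A)^-1 w.  It is real linear in w, it
    does not involve the imaginary unit j, and
      A K(z, w) = K(z, z w) - Im w                                    (lemma AKz).
    Grouping conjugate points of the contour gives
      T(t) = 1/pi (integral of K(z, e^(tz) dz) over the upper half contour)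
    (Gamma_contour), so T does not depend on j (contour_indep).

    Integrals of this kind, for an arbitrary kernel K and with an additional
    factor z^k for an integer k, are studied first.  A time derivative raises k
    by one (contour_deriv), and so does A, up to the same integral of the scalar
    kernel Im (w / z), by the identity above (contour_A).  The scalar integrals
    are pi for the density e^(tz) dz / z and 0 for e^(tz) dz (cauchy_contour,
    cauchy_contour1).  Hence
      T'(t) = A T(t)   and   T(t) - 1 = A J(t),
    where J(t) has the additional factor 1/z.  The value of T(t) does not depend
    on the radius r of the arc (contour_radius): the derivative in r of the
    integral over an arc is a boundary term, which the rays compensate.  With
    r = 1/t one gets |T(t)| <= C and |J(t)| <= C t.

    These facts, together with the commutation of T(t) and J(t) with the
    resolvents of A at positive reals, are all that is needed afterwards
    (record solution_family).  The product T(t - tau) T(s + tau) has derivative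
    zero in tau, hence the semigroup law; |T(t) x - x| <= C t |A x| on the dense
    domain gives strong continuity at 0; the mean value inequality for
    T(t) x - t A x identifies the generator on the domain of A, and the
    resolvent shows that the generator is not larger; and
    - e^(-lt) (l - A)^-1 T(t) is a primitive of e^(-lt) T(t), whence the Laplace
    transform.  Finally the n-th derivative of T on a neighbourhood of t is
    bounded by c n! / b^n, so Taylor series converge
    (cauchy_estimates_analytic).

    Holomorphy enters only through explicit quadratic estimates of remainders,
    which are derived from the resolvent equation (Cz_quad) and make it
    possible to differentiate under the integral sign without dominated
    convergence.  Continuous integrands with values in a Banach space are
    Bochner integrable over compact intervals and satisfy the fundamental
    theorem of calculus; both are obtained from Cousin's covering principle
    (cousin). *)

Set Implicit Arguments.
Unset Strict Implicit.
Unset Printing Implicit Defensive.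

Import Order.TTheory GRing.Theory Num.Theory.
Import numFieldNormedType.Exports.

Local Open Scope classical_set_scope.
Local Open Scope ring_scope.

(** * Linear identities in modules *)

Section ModuleIdentities.
Context {R : comNzRingType} {V : lmodType R}.

Inductive lin_expr :=
  | LinAtom of nat | LinZero | LinAdd of lin_expr & lin_expr
  | LinOpp of lin_expr | LinScale of R & lin_expr.

Fixpoint lin_eval (env : seq V) (e : lin_expr) : V :=
  match e with
  | LinAtom i => nth 0 env i
  | LinZero => 0
  | LinAdd e1 e2 => lin_eval env e1 + lin_eval env e2
  | LinOpp e1 => - lin_eval env e1
  | LinScale k e1 => k *: lin_eval env e1
  end.

Fixpoint lin_coef (e : lin_expr) (i : nat) : R :=
  match e with
  | LinAtom j => if eqn i j then 1 else 0
  | LinZero => 0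
  | LinAdd e1 e2 => lin_coef e1 i + lin_coef e2 i
  | LinOpp e1 => - lin_coef e1 i
  | LinScale k e1 => k * lin_coef e1 i
  end.

Lemma lin_evalE env e :
  lin_eval env e = \sum_(i < size env) lin_coef e i *: env`_i.
Proof.
elim: e => [j||e1 I1 e2 I2|e1 I1|k e1 I1] /=; rewrite ?I1 ?I2.
- have [jlt|jge] := ltnP j (size env); last first.
    rewrite nth_default// big1// => i _.
    by case: eqnP => [ij|]; rewrite ?scale0r//; move: (ltn_ord i); rewrite ij ltnNge jge.
  rewrite (bigD1 (Ordinal jlt))//= big1 ?addr0 => [|i ij].
    by case: eqnP => //; rewrite scale1r.
  by case: eqnP => [E|]; rewrite ?scale0r//; case/eqP: ij; apply: val_inj.
- by rewrite big1// => i _; rewrite scale0r.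
- by rewrite -big_split; apply: eq_bigr => i _; rewrite scalerDl.
- by rewrite -sumrN; apply: eq_bigr => i _; rewrite scaleNr.
- by rewrite scaler_sumr; apply: eq_bigr => i _; rewrite scalerA.
Qed.

Fixpoint coefs_agree (n : nat) (e1 e2 : lin_expr) : Prop :=
  if n is m.+1 then lin_coef e1 m = lin_coef e2 m /\ coefs_agree m e1 e2
  else True.

(** A decision procedure by reflection: vectors are compared through their
    coefficients on the atoms, which are scalars, hence within reach of [ring]
    and [field]. *)
Lemma lin_eval_eq env e1 e2 :
  coefs_agree (size env) e1 e2 -> lin_eval env e1 = lin_eval env e2.
Proof.
move=> H; rewrite !lin_evalE; apply: eq_bigr => i _; congr (_ *: _).
move: (size env) i H => n; elim: n => [[]//|n IH] i /= [H1 /IH H2].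
have := ltn_ord i; rewrite ltnS leq_eqVlt => /orP[/eqP ->//|lt_in].
exact: (H2 (Ordinal lt_in)).
Qed.

End ModuleIdentities.

Ltac lin_mem x l :=
  lazymatch l with
  | nil => constr:(false)
  | x :: _ => constr:(true)
  | _ :: ?l' => lin_mem x l'
  end.

Ltac lin_atoms t l :=
  lazymatch t with
  | (?a + ?b)%R => let l1 := lin_atoms a l in lin_atoms b l1
  | (- ?a)%R => lin_atoms a l
  | (?k *: ?a)%R => lin_atoms a l
  | 0%R => l
  | ?x => let m := lin_mem x l in
          lazymatch m with true => l | false => constr:(x :: l) end
  end.

Ltac lin_index x l :=
  lazymatch l with
  | x :: _ => constr:(O)
  | _ :: ?l' => let n := lin_index x l' in constr:(S n)
  end.

Ltac lin_reify R t l :=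
  lazymatch t with
  | (?a + ?b)%R => let a' := lin_reify R a l in let b' := lin_reify R b l in
                   constr:(@LinAdd R a' b')
  | (- ?a)%R => let a' := lin_reify R a l in constr:(@LinOpp R a')
  | (?k *: ?a)%R => let a' := lin_reify R a l in constr:(@LinScale R k a')
  | 0%R => constr:(@LinZero R)
  | ?x => let n := lin_index x l in constr:(@LinAtom R n)
  end.

Ltac module R :=
  lazymatch goal with
  | |- @eq ?V ?x ?y =>
    let l := lin_atoms x (@nil V) in
    let l := lin_atoms y l in
    let ex := lin_reify R x l in
    let ey := lin_reify R y l in
    apply: (@lin_eval_eq R _ l ex ey);
    cbv [coefs_agree size lin_coef eqn];
    repeat (split; [first [ring | solve [field; done]] | ]); exact I
  end.

(** The same procedure with atoms identified up to conversion, for goals in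
    which one vector occurs under several convertible forms. *)
Ltac lin_memu x l :=
  match l with
  | nil => constr:(false)
  | ?y :: _ => let _ := match goal with _ => unify x y end in constr:(true)
  | _ :: ?l' => lin_memu x l'
  end.

Ltac lin_atomsu t l :=
  lazymatch t with
  | (?a + ?b)%R => let l1 := lin_atomsu a l in lin_atomsu b l1
  | (- ?a)%R => lin_atomsu a l
  | (?k *: ?a)%R => lin_atomsu a l
  | 0%R => l
  | ?x => let m := lin_memu x l in
          lazymatch m with true => l | false => constr:(x :: l) end
  end.

Ltac lin_indexu x l :=
  match l with
  | ?y :: _ => let _ := match goal with _ => unify x y end in constr:(O)
  | _ :: ?l' => let n := lin_indexu x l' in constr:(S n)
  end.

Ltac lin_reifyu R t l :=
  lazymatch t with
  | (?a + ?b)%R => let a' := lin_reifyu R a l in let b' := lin_reifyu R b l in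
                   constr:(@LinAdd R a' b')
  | (- ?a)%R => let a' := lin_reifyu R a l in constr:(@LinOpp R a')
  | (?k *: ?a)%R => let a' := lin_reifyu R a l in constr:(@LinScale R k a')
  | 0%R => constr:(@LinZero R)
  | ?x => let n := lin_indexu x l in constr:(@LinAtom R n)
  end.

Ltac moduleu R :=
  lazymatch goal with
  | |- @eq ?V ?x ?y =>
    let l := lin_atomsu x (@nil V) in
    let l := lin_atomsu y l in
    let ex := lin_reifyu R x l in
    let ey := lin_reifyu R y l in
    apply: (@lin_eval_eq R _ l ex ey);
    cbv [coefs_agree size lin_coef eqn];
    repeat (split; [first [ring | solve [field; done]] | ]); exact I
  end.

(** * Cousin's covering principle *)

Section Cousin.
Context {R : realType}.

(** A property of intervals that is additive and holds for all small
    intervals around each point holds for [a, b]: the supremum of the x for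
    which it holds on [a, x] cannot be smaller than b. *)
Lemma cousin (a b : R) (P : R -> R -> Prop) : a <= b ->
  (forall x y z, a <= x -> x <= y -> y <= z -> z <= b ->
     P x y -> P y z -> P x z) ->
  (forall c, a <= c -> c <= b -> exists2 e : R, 0 < e &
     forall x y, a <= x -> x <= c -> c <= y -> y <= b -> c - e < x -> y < c + e ->
       P x y) ->
  P a b.
Proof.
move=> ab Ptr Ploc.
pose S := [set x : R | a <= x /\ x <= b /\ P a x].
have Sa : S a.
  split=> //; split=> //; have [e e0 H] := Ploc a (lexx _) ab.
  by apply: H; rewrite ?lexx// ?ltrBlDr ?ltrDl.
have Sub : ubound S b by move=> x [_ [? _]].
have supS : has_sup S by split; [exists a | exists b].
pose c := sup S.
have ac : a <= c by apply: ub_le_sup => //; exists b.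
have cb : c <= b by apply: ge_sup => //; exists a.
have [e e0 H] := Ploc c ac cb.
have [x [ax [xb Pax]] xc] : exists2 x, S x & c - e < x by apply: sup_adherent.
have xlec : x <= c by apply: ub_le_sup => //; exists b.
have Pac : P a c.
  by apply: (Ptr a x c) => //; apply: H => //; rewrite ltrDl.
have [cltb|bc] := ltP c b; last by have -> : b = c by apply/eqP; rewrite eq_le bc cb.
pose y := Num.min (c + e / 2) b.
have cy : c < y by rewrite /y lt_min cltb ltrDl divr_gt0.
have yb : y <= b by rewrite /y ge_min lexx orbT.
have yce : y < c + e.
  by rewrite /y gt_min ltrD2l ltr_pdivrMr// mulr_natr mulr2n ltrDl e0.
have : S y.
  split; first exact: le_trans (ltW cy).
  split=> //; apply: (Ptr a c y) => //; first exact: ltW.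
  by apply: H => //; [exact: ltW|rewrite ltrBlDr ltrDl].
by move=> /(ub_le_sup (ex_intro _ b Sub)); rewrite leNgt cy.
Qed.

End Cousin.

(** * Derivatives of vector valued functions *)

Section Derivative.
Context {R : realType} {E : normedModType R}.
Implicit Types (f : R -> E) (x : R) (d : E).

(** The epsilon-delta form is convenient for estimates; [has_derivP] relates
    it to the library's derivative. *)
Definition has_deriv f x d := forall e : R, 0 < e -> exists2 h : R, 0 < h &
  forall y, `|y - x| < h -> `|f y - f x - (y - x) *: d| <= e * `|y - x|.

Lemma continuousP f x : {for x, continuous f} <->
  (forall e : R, 0 < e -> exists2 h : R, 0 < h &
     forall y, `|y - x| < h -> `|f y - f x| <= e).
Proof.
split=> [/cvgrPdist_le H e e0|H].
  have /nbhs_ballP [h /= h0 Hh] := H e e0.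
  exists h => // y yx; rewrite distrC; apply: Hh.
  by rewrite /ball/= distrC.
apply/cvgrPdist_le => e e0; have [h h0 Hh] := H e e0.
apply/nbhs_ballP; exists h => //= y; rewrite /ball/= => xy.
by rewrite distrC Hh// distrC.
Qed.

Lemma has_deriv_continuous f x d : has_deriv f x d -> {for x, continuous f}.
Proof.
move=> H; apply/continuousP => e e0; have [h h0 Hh] := H 1 ltr01.
have k0 : 0 < 1 + `|d| by rewrite ltr_wpDr.
exists (Num.min h (e / (1 + `|d|))); first by rewrite lt_min h0 divr_gt0.
move=> y; rewrite lt_min => /andP[yh ye].
rewrite -[f y - f x](subrK ((y - x) *: d)) (le_trans (ler_normD _ _))//.
rewrite normrZ (le_trans (lerD (Hh y yh) (lexx _)))//.
by rewrite [X in _ + X]mulrC -mulrDl mulrC -ler_pdivlMr// ltW.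
Qed.

Lemma has_derivP f x d : has_deriv f x d <-> is_derive x (1 : R) f d.
Proof.
split=> [H|].
  have C : h^-1 *: (f (h + x) - f x) @[h --> 0^'] --> d.
    apply/cvgrPdist_le => e e0; have [h h0 Hh] := H e e0.
    rewrite /dnbhs; apply/nbhs_ballP; exists h => //= k.
    rewrite /ball/= sub0r normrN => kh /= k0.
    have := Hh (k + x); rewrite addrK => /(_ kh).
    rewrite -[X in `|X - k *: d|](scalerKV k0) -scalerBr normrZ mulrC.
    by rewrite ler_pM2r ?normr_gt0// distrC.
  split.
    apply/cvg_ex; exists d.
    by under eq_fun do rewrite scaler1 /=; exact: C.
  apply/cvg_lim => //.
  by under eq_fun do rewrite scaler1 /=; exact: C.
case=> [D <-] e e0.
have : h^-1 *: (f (h + x) - f x) @[h --> 0^'] --> 'D_1 f x.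
  move: D => /cvg_ex[l Hl].
  have -> : 'D_1 f x = l by exact/cvg_lim.
  move: Hl; by under eq_fun do rewrite scaler1 /=.
move/cvgrPdist_le => /(_ e e0) /nbhs_ballP [h /= h0 Hh].
exists h => // y yx.
have [->|yneq] := eqVneq y x; first by rewrite !subrr scale0r subr0 !normr0 mulr0.
have yx0 : y - x != 0 by rewrite subr_eq0.
have := Hh (y - x); rewrite /ball/= sub0r normrN => /(_ yx yx0).
rewrite subrK -[X in _ -> `|X - _| <= _](scalerKV yx0) -scalerBr normrZ mulrC.
by rewrite ler_pM2r ?normr_gt0// distrC.
Qed.

Lemma has_deriv_cst (c : E) x : has_deriv (fun=> c) x 0.
Proof.
by move=> e e0; exists 1 => // y _; rewrite scaler0 !subrr normr0 mulr_ge0 ?(ltW e0).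
Qed.

Lemma has_derivD f g x d d' : has_deriv f x d -> has_deriv g x d' ->
  has_deriv (fun y => f y + g y) x (d + d').
Proof. by move=> /has_derivP ? /has_derivP ?; apply/has_derivP; exact: is_deriveD. Qed.

Lemma has_derivB f g x d d' : has_deriv f x d -> has_deriv g x d' ->
  has_deriv (fun y => f y - g y) x (d - d').
Proof. by move=> /has_derivP ? /has_derivP ?; apply/has_derivP; exact: is_deriveB. Qed.

Lemma has_deriv_eq f g x d : (exists2 h : R, 0 < h & forall y, `|y - x| < h -> f y = g y) ->
  has_deriv f x d -> has_deriv g x d.
Proof.
move=> [k k0 fg] H e e0; have [h h0 Hh] := H e e0.
exists (Num.min h k); first by rewrite lt_min h0.
move=> y; rewrite lt_min => /andP[yh yk].
by rewrite -!fg ?Hh// subrr normr0.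
Qed.

Lemma has_deriv_unique f x d d' : has_deriv f x d -> has_deriv f x d' -> d = d'.
Proof. by move=> /has_derivP [_ <-] /has_derivP [_ <-]. Qed.

(** Estimating the increment between two points on either side of x is what
    additive properties of intervals need. *)
Lemma straddle f x d : has_deriv f x d -> forall e : R, 0 < e ->
  exists2 h : R, 0 < h & forall y z, x - h < y -> y <= x -> x <= z -> z < x + h ->
    `|f z - f y - (z - y) *: d| <= e * (z - y).
Proof.
move=> H e e0; have [h h0 Hh] := H e e0; exists h => // y z xhy yx xz zxh.
have -> : f z - f y - (z - y) *: d =
   (f z - f x - (z - x) *: d) - (f y - f x - (y - x) *: d) by module R.
apply: le_trans (ler_normB _ _) _; have -> : z - y = (z - x) + (x - y) by ring.
have zx0 : 0 <= z - x by rewrite subr_ge0.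
have xy0 : 0 <= x - y by rewrite subr_ge0.
rewrite mulrDr; apply: lerD.
  by have := Hh z; rewrite !(ger0_norm zx0); apply; rewrite ltrBlDl.
have := Hh y; rewrite !(distrC y x) !(ger0_norm xy0); apply.
by rewrite ltrBlDr -ltrBlDl.
Qed.

End Derivative.

(** * Mean value inequality and rules of derivation *)

Section MeanValue.
Context {R : realType} {E : normedModType R}.

(** The inequality up to e (b - a) is an additive property of intervals which
    holds near each point by [straddle], so [cousin] applies.  Neither
    continuity of the derivative nor the Hahn-Banach theorem is involved. *)
Lemma mean_value (f f' : R -> E) (g g' : R -> R) a b : a <= b ->
  (forall x, a <= x -> x <= b -> has_deriv f x (f' x)) ->
  (forall x, a <= x -> x <= b -> has_deriv g x (g' x)) ->
  (forall x, a <= x -> x <= b -> `|f' x| <= g' x) ->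
  `|f b - f a| <= g b - g a.
Proof.
move=> ab df dg fg; apply/ler_addgt0Pr => e e0.
suff H : forall e, 0 < e -> `|f b - f a| <= g b - g a + e * (b - a).
  have k0 : 0 < 1 + (b - a) by rewrite ltr_wpDr// subr_ge0.
  apply: le_trans (H (e / (1 + (b - a))) _) _; first by rewrite divr_gt0.
  by rewrite lerD2l mulrAC ler_pdivrMr// ler_pM2l// lerDr.
move=> {e e0} e e0.
apply: (@cousin R a b (fun x y => `|f y - f x| <= g y - g x + e * (y - x))) => //.
- move=> x y z _ _ _ _ H1 H2.
  have -> : f z - f x = (f z - f y) + (f y - f x) by rewrite addrA subrK.
  apply: le_trans (ler_normD _ _) _; apply: le_trans (lerD H2 H1) _.
  by rewrite le_eqVlt; apply/orP; left; apply/eqP; ring.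
- move=> c ac cb; have e20 : 0 < e / 2 by rewrite divr_gt0.
  have [h1 h10 H1] := straddle (df c ac cb) e20.
  have [h2 h20 H2] := straddle (dg c ac cb) e20.
  exists (Num.min h1 h2); first by rewrite lt_min h10.
  move=> x y ax xc cy yb chx ych.
  have cx1 : c - h1 < x by apply: le_lt_trans chx; rewrite lerD2l lerN2 ge_min lexx.
  have cx2 : c - h2 < x by apply: le_lt_trans chx; rewrite lerD2l lerN2 ge_min lexx orbT.
  have cy1 : y < c + h1 by apply: lt_le_trans ych _; rewrite lerD2l ge_min lexx.
  have cy2 : y < c + h2 by apply: lt_le_trans ych _; rewrite lerD2l ge_min lexx orbT.
  have := H2 _ _ cx2 xc cy cy2; rewrite ler_norml => /andP[+ _].
  rewrite -[(y - x) *: g' c]/((y - x) * g' c) => gg.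
  rewrite -[f y - f x](subrK ((y - x) *: f' c)); apply: le_trans (ler_normD _ _) _.
  rewrite normrZ ger0_norm ?subr_ge0 ?(le_trans xc)//.
  have := H1 _ _ cx1 xc cy cy1 => ff.
  have yx : 0 <= y - x by rewrite subr_ge0 (le_trans xc).
  have := ler_wpM2l yx (fg c ac cb).
  move: ff gg; set u := `|_|; set v := `|_|; nra.
Qed.

Lemma deriv0_const (f : R -> E) a b : a <= b ->
  (forall x, a <= x -> x <= b -> has_deriv f x 0) -> f b = f a.
Proof.
move=> ab df; apply/eqP; rewrite -subr_eq0 -normr_le0.
rewrite (le_trans (@mean_value f (fun=> 0) (fun=> 0) (fun=> 0) a b ab df _ _))//.
- by move=> x _ _; exact: has_deriv_cst.
- by move=> x _ _; rewrite normr0.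
Qed.

Lemma mean_value_cst (f f' : R -> E) c a b : a <= b ->
  (forall x, a <= x -> x <= b -> has_deriv f x (f' x)) ->
  (forall x, a <= x -> x <= b -> `|f' x| <= c) ->
  `|f b - f a| <= c * (b - a).
Proof.
move=> ab df fc; rewrite mulrBr.
apply: (@mean_value f f' ( *%R c) (fun=> c) _ _ ab df) => // x _ _.
apply/has_derivP.
have := @is_deriveZ R R^o _ id c x 1 1 (is_derive_id _ _).
by rewrite -[c *: 1]/(c * 1) mulr1.
Qed.

End MeanValue.

Section Bilinear.
Context {R : realType} {E F G : normedModType R}.

Lemma has_deriv_lin (L : E -> F) (c : R) :
  (forall u v, L (u + v) = L u + L v) -> (forall (k : R) u, L (k *: u) = k *: L u) ->
  (forall u, `|L u| <= c * `|u|) ->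
  forall f x d, has_deriv f x d -> has_deriv (fun y => L (f y)) x (L d).
Proof.
move=> LD LZ Lc f x d df e e0.
have c0 : 0 < `|c| + 1 by rewrite ltr_wpDl.
have [h h0 H] := df (e / (`|c| + 1)) (divr_gt0 e0 c0).
exists h => // y yx; have LB u v : L (u - v) = L u - L v.
  by rewrite LD -[- v]scaleN1r LZ scaleN1r.
rewrite -LZ -!LB (le_trans (Lc _))//.
apply: (@le_trans _ _ ((`|c| + 1) * (e / (`|c| + 1) * `|y - x|))).
  apply: (@le_trans _ _ ((`|c| + 1) * `|f y - f x - (y - x) *: d|)).
    by rewrite ler_wpM2r// (le_trans (ler_norm c))// lerDl.
  by rewrite ler_wpM2l ?(ltW c0)// H.
by rewrite mulrA [_ * (e / _)]mulrC divfK// gt_eqF.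
Qed.

Lemma has_deriv_bil (b : E -> F -> G) (c : R) :
  (forall u u' v, b (u + u') v = b u v + b u' v) ->
  (forall u v v', b u (v + v') = b u v + b u v') ->
  (forall (k : R) u v, b (k *: u) v = k *: b u v) ->
  (forall (k : R) u v, b u (k *: v) = k *: b u v) ->
  (forall u v, `|b u v| <= c * `|u| * `|v|) ->
  forall f g x d d', has_deriv f x d -> has_deriv g x d' ->
  has_deriv (fun y => b (f y) (g y)) x (b (f x) d' + b d (g x)).
Proof.
move=> bDl bDr bZl bZr bc f g x d d' df dg e e0.
have bBl u u' v : b (u - u') v = b u v - b u' v.
  by rewrite bDl -[- u']scaleN1r bZl scaleN1r.
have bBr u v v' : b u (v - v') = b u v - b u v'.
  by rewrite bDr -[- v']scaleN1r bZr scaleN1r.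
pose k := (`|c| + 1) * (`|f x| + `|d| + `|g x| + `|d'| + 3).
have k0 : 0 < k by rewrite mulr_gt0 ?ltr_wpDl ?addr_ge0.
pose e1 := Num.min 1 (e / (2 * k)).
have e10 : 0 < e1 by rewrite lt_min ltr01 divr_gt0// mulr_gt0.
have e11 : e1 <= 1 by rewrite ge_min lexx.
have e1e : e1 * (2 * k) <= e by rewrite -ler_pdivlMr ?mulr_gt0// ge_min lexx orbT.
have [h1 h10 H1] := df e1 e10; have [h2 h20 H2] := dg e1 e10.
have /continuousP /(_ e1 e10) [h3 h30 H3] := has_deriv_continuous dg.
exists (Num.min (Num.min h1 h2) h3); first by rewrite !lt_min h10 h20.
move=> y; rewrite !lt_min -andbA => /and3P[yh1 yh2 yh3].
have -> : b (f y) (g y) - b (f x) (g x) - (y - x) *: (b (f x) d' + b d (g x)) =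
   b (f y - f x - (y - x) *: d) (g y) + (y - x) *: b d (g y - g x)
   + b (f x) (g y - g x - (y - x) *: d').
  by rewrite !bBl !bBr !bZl bZr; module R.
have cc : `|c| <= `|c| + 1 by rewrite lerDl.
have gy : `|g y| <= `|g x| + 1.
  rewrite -[g y](subrK (g x)) addrC (le_trans (ler_normD _ _))// lerD2l.
  exact: le_trans (H3 _ yh3) e11.
have bc' u v : `|b u v| <= (`|c| + 1) * (`|u| * `|v|).
  rewrite (le_trans (bc _ _))// -mulrA ler_wpM2r ?mulr_ge0//.
  by rewrite (le_trans (ler_norm _)).
apply: (@le_trans _ _ ((`|c| + 1) * ((e1 * `|y - x|) * (`|g x| + 1)) +
   `|y - x| * ((`|c| + 1) * (`|d| * e1)) + (`|c| + 1) * (`|f x| * (e1 * `|y - x|)))).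
  apply: le_trans (ler_normD _ _) _; apply: lerD.
    apply: le_trans (ler_normD _ _) _; apply: lerD.
      apply: le_trans (bc' _ _) _; rewrite ler_wpM2l ?addr_ge0//.
      by apply: ler_pM => //; exact: H1.
    rewrite normrZ ler_wpM2l// (le_trans (bc' _ _))// ler_wpM2l ?addr_ge0//.
    by rewrite ler_wpM2l// H3.
  apply: le_trans (bc' _ _) _; rewrite ler_wpM2l ?addr_ge0//.
  by rewrite ler_wpM2l// H2.
have -> : (`|c| + 1) * ((e1 * `|y - x|) * (`|g x| + 1)) +
   `|y - x| * ((`|c| + 1) * (`|d| * e1)) + (`|c| + 1) * (`|f x| * (e1 * `|y - x|))
   = e1 * ((`|c| + 1) * (`|g x| + 1 + `|d| + `|f x|)) * `|y - x| by ring.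
apply: ler_wpM2r => //; apply: le_trans e1e; rewrite ler_wpM2l ?(ltW e10)//.
rewrite /k [leRHS]mulrCA ler_wpM2l ?addr_ge0//.
move: (normr_ge0 (f x)) (normr_ge0 d) (normr_ge0 (g x)) (normr_ge0 d').
by lra.
Qed.

End Bilinear.

Section Rules.
Context {R : realType} {E : normedModType R}.

Lemma has_derivZ (w : R -> R) (f : R -> E) x (w' : R) d : has_deriv w x w' -> has_deriv f x d ->
  has_deriv (fun y => w y *: f y) x (w x *: d + w' *: f x).
Proof.
apply: (@has_deriv_bil R R^o E E (fun k u => k *: u) 1).
- by move=> *; rewrite scalerDl.
- by move=> *; rewrite scalerDr.
- by move=> *; rewrite scalerA.
- by move=> *; rewrite !scalerA mulrC.
- by move=> u v; rewrite mul1r normrZ.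
Qed.

Lemma has_derivZc (k : R) (f : R -> E) x d : has_deriv f x d ->
  has_deriv (fun y => k *: f y) x (k *: d).
Proof.
move=> fd; have := has_derivZ (@has_deriv_cst _ R^o k x) fd.
by rewrite scale0r addr0.
Qed.

Lemma has_deriv_comp (w : R -> R) (f : R -> E) x (w' : R) d :
  has_deriv w x w' -> has_deriv f (w x) d -> has_deriv (f \o w) x (w' *: d).
Proof.
move=> dw df e e0.
pose k := `|w'| + `|d| + 2; have k0 : 0 < k by rewrite ltr_wpDl ?addr_ge0.
have e1k : 0 < Num.min 1 (e / k) by rewrite lt_min ltr01 divr_gt0.
pose e1 := Num.min 1 (e / k).
have e11 : e1 <= 1 by rewrite ge_min lexx.
have e1e : e1 * k <= e by rewrite -ler_pdivlMr// ge_min lexx orbT.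
have [h1 h10 H1] := dw e1 e1k; have [h2 h20 H2] := df e1 e1k.
have /continuousP /(_ (h2 / 2) (divr_gt0 h20 (ltr0Sn _ 1))) [h3 h30 H3] := has_deriv_continuous dw.
exists (Num.min h1 h3); first by rewrite lt_min h10.
move=> y; rewrite lt_min => /andP[yh1 yh3] /=.
have w2 : `|w y - w x| < h2.
  by apply: le_lt_trans (H3 _ yh3) _; rewrite ltr_pdivrMr// mulr_natr mulr2n ltrDl.
have := H1 _ yh1; have := H2 _ w2; rewrite -[_ *: w']/((y - x) * w').
move: (w y - w x) w2 => t _ Ht Hw.
have -> : f (w y) - f (w x) - (y - x) *: (w' *: d) =
  (f (w y) - f (w x) - t *: d) + (t - (y - x) * w') *: d by module R.
have tb : `|t| <= (`|w'| + 1) * `|y - x|.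
  rewrite -[t](subrK ((y - x) * w')) (le_trans (ler_normD _ _))//.
  have H0 : e1 * `|y - x| <= `|y - x| by rewrite ler_piMl.
  apply: le_trans (lerD (le_trans Hw H0) (lexx _)) _.
  by rewrite normrM; lra.
apply: le_trans (ler_normD _ _) _; rewrite normrZ.
apply: (@le_trans _ _ (e1 * ((`|w'| + 1) * `|y - x|) + (e1 * `|y - x|) * `|d|)).
  apply: lerD; last by rewrite ler_wpM2r.
  by apply: le_trans Ht _; rewrite ler_wpM2l ?(ltW e1k).
have -> : e1 * ((`|w'| + 1) * `|y - x|) + (e1 * `|y - x|) * `|d| =
  e1 * (`|w'| + `|d| + 1) * `|y - x| by ring.
apply: ler_wpM2r => //; apply: le_trans e1e; rewrite ler_wpM2l ?(ltW e1k)// /k.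
by lra.
Qed.

End Rules.

(** * Uniqueness and approximation of Bochner integrals *)

Section ExtendedLimits.
Context {R : realType}.

Lemma cvge0_le (u : nat -> \bar R) (e : R) : 0 < e -> u @ \oo --> 0%E ->
  \forall n \near \oo, (u n <= e%:E)%E.
Proof.
move=> e0 u0; have : nbhs (0%E : \bar R) (fun y => y < e%:E)%E.
  by apply: (@open_ereal_lt' _ 0%:E e%:E); rewrite lte_fin.
move=> /u0 H; have H' : \forall n \near \oo, (u n < e%:E)%E by exact: H.
by apply: filterS H' => n /ltW.
Qed.

Lemma cvge0P (u : nat -> \bar R) : (forall n, 0 <= u n)%E ->
  (forall e : R, 0 < e -> \forall n \near \oo, (u n <= e%:E)%E) ->
  u @ \oo --> 0%E.
Proof.
move=> u0 H.
have fu : \forall n \near \oo, u n \is a fin_num.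
  by apply: filterS (H 1 ltr01) => n un; rewrite ge0_fin_numE// (le_lt_trans un)// ltry.
apply/fine_cvgP; split=> //; apply/cvgrPdist_le => e e0.
apply: filterS2 fu (H e e0) => n fn un.
rewrite sub0r normrN ger0_norm ?fine_ge0//.
by rewrite -lee_fin fineK.
Qed.

End ExtendedLimits.

Section SimpleFunctions.
Context {R : realType} {d : measure_display} {T : measurableType d}
  {E : normedModType R} (mu : {measure set T -> \bar R}).

(** Bochner approximation asks only for the measurability of norms
    |f - s|, so one argues by splitting the domain along each set of s instead
    of composing measurable vector valued functions. *)
Lemma measurable_norm_simple n (A : 'I_n -> set T) (v : 'I_n -> E)
    (B : set T) (g : T -> E) :
  (forall i, measurable (A i)) -> measurable B ->
  (forall w, measurable_fun B (fun x => `|g x + w|)) ->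
  measurable_fun B (fun x => `|g x + \sum_(i < n) (\1_(A i) x : R) *: v i|).
Proof.
elim: n A v B g => [|n IH] A v B g mA mB mg.
  under eq_fun do rewrite big_ord0; exact: mg.
have mBA : measurable (B `&` A ord_max) by exact: measurableI.
have mBD : measurable (B `\` A ord_max) by exact: measurableD.
rewrite -(setUIDK B (A ord_max)); apply/measurable_funU => //; split.
- apply: (@eq_measurable_fun _ _ _ _ _ (fun x => `|(g x + v ord_max) +
      \sum_(i < n) (\1_(A (widen_ord (leqnSn n) i)) x : R) *: v (widen_ord (leqnSn n) i)|)).
    move=> x; rewrite inE => -[_ Ax]; rewrite big_ord_recr/= indicE mem_set// scale1r.
    by rewrite addrA addrAC.
  apply: IH => // w; apply: (@eq_measurable_fun _ _ _ _ _ (fun x => `|g x + (v ord_max + w)|)).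
    by move=> x _; rewrite addrA.
  by apply: measurable_funS (mg _) => //; exact: subIsetl.
- apply: (@eq_measurable_fun _ _ _ _ _ (fun x => `|g x +
      \sum_(i < n) (\1_(A (widen_ord (leqnSn n) i)) x : R) *: v (widen_ord (leqnSn n) i)|)).
    move=> x; rewrite inE => -[_ Ax]; rewrite big_ord_recr/= indicE memNset// scale0r.
    by rewrite addr0.
  apply: IH => // w.
  by apply: measurable_funS (mg _) => //; exact: subDsetl.
Qed.

(** The triangle inequality for simple functions, by induction on the number
    of sets.  These may overlap; splitting B along the last one reduces to the
    remaining sets, with a modified constant w. *)
Lemma norm_simple_integral_le n (A : 'I_n -> set T) (v : 'I_n -> E)
    (B : set T) (w : E) :
  (forall i, measurable (A i)) -> measurable B -> (mu B < +oo)%E ->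
  ((`|fine (mu B) *: w + \sum_(i < n) fine (mu (B `&` A i)) *: v i|)%:E <=
   \int[mu]_(x in B) (`|w + \sum_(i < n) (\1_(A i) x : R) *: v i|)%:E)%E.
Proof.
elim: n A v B w => [|n IH] A v B w mA mB fB.
  rewrite big_ord0 addr0.
  rewrite (eq_integral (cst (`|w|%:E))) => [|x _]; last by rewrite big_ord0 addr0.
  rewrite integral_cst// normrZ ger0_norm ?fine_ge0//.
  by rewrite EFinM fineK ?ge0_fin_numE// muleC lexx.
pose C := A ord_max; pose A' (i : 'I_n) := A (widen_ord (leqnSn n) i).
pose v' (i : 'I_n) := v (widen_ord (leqnSn n) i).
have mC : measurable C := mA _.
have mBA : measurable (B `&` C) by exact: measurableI.
have mBD : measurable (B `\` C) by exact: measurableD.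
have fBA : (mu (B `&` C) < +oo)%E.
  by apply: le_lt_trans fB; apply: le_measure; rewrite ?inE//; exact: subIsetl.
have fBD : (mu (B `\` C) < +oo)%E.
  by apply: le_lt_trans fB; apply: le_measure; rewrite ?inE//; exact: subDsetl.
have split_mu Z : measurable Z -> fine (mu (B `&` Z)) =
    fine (mu ((B `&` C) `&` Z)) + fine (mu ((B `\` C) `&` Z)).
  move=> mZ.
  have m1 : measurable ((B `&` C) `&` Z) by exact: measurableI.
  have m2 : measurable ((B `\` C) `&` Z) by exact: measurableI.
  have f1 : mu ((B `&` C) `&` Z) \is a fin_num.
    rewrite ge0_fin_numE//; apply: le_lt_trans fBA.
    by apply: le_measure; rewrite ?inE//; exact: subIsetl.
  have f2 : mu ((B `\` C) `&` Z) \is a fin_num.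
    rewrite ge0_fin_numE//; apply: le_lt_trans fBD.
    by apply: le_measure; rewrite ?inE//; exact: subIsetl.
  rewrite -fineD// -measureU//; first by rewrite -setIUl setUIDK.
  by apply/seteqP; split=> x //= -[[[_ Cx] _] [[_ /(_ Cx)]]].
have -> : fine (mu B) *: w + \sum_(i < n.+1) fine (mu (B `&` A i)) *: v i =
   (fine (mu (B `&` C)) *: (w + v ord_max) + \sum_(i < n) fine (mu ((B `&` C) `&` A' i)) *: v' i)
  + (fine (mu (B `\` C)) *: w + \sum_(i < n) fine (mu ((B `\` C) `&` A' i)) *: v' i).
  rewrite big_ord_recr/= -/C.
  have := split_mu setT measurableT; rewrite !setIT => ->.
  under eq_bigr do rewrite split_mu// scalerDl.
  rewrite big_split/= scalerDl scalerDr; set s1 := \sum_(i < n) _; set s2 := \sum_(i < n) _.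
  by module R.
apply: (@le_trans _ _ (`|fine (mu (B `&` C)) *: (w + v ord_max) + \sum_(i < n) fine (mu ((B `&` C) `&` A' i)) *: v' i|%:E +
   `|fine (mu (B `\` C)) *: w + \sum_(i < n) fine (mu ((B `\` C) `&` A' i)) *: v' i|%:E)%E).
  by rewrite -EFinD lee_fin ler_normD.
have mint := @measurable_norm_simple _ A v B (fun=> w) mA mB (fun=> measurable_cst _).
rewrite -[in leRHS](setUIDK B C) ge0_integral_setU//.
- apply: leeD.
    apply: le_trans (IH A' v' _ (w + v ord_max) (fun=> mA _) mBA fBA) _.
    rewrite le_eqVlt; apply/orP; left; apply/eqP; apply: eq_integral => x.
    rewrite inE => -[_ Cx]; rewrite big_ord_recr/= indicE mem_set// scale1r.
    by rewrite addrA addrAC.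
  apply: le_trans (IH A' v' _ w (fun=> mA _) mBD fBD) _.
  rewrite le_eqVlt; apply/orP; left; apply/eqP; apply: eq_integral => x.
  rewrite inE => -[_ Cx]; rewrite big_ord_recr/= indicE memNset// scale0r.
  by rewrite addr0.
- by rewrite setUIDK; apply/measurable_EFinP.
- by rewrite disj_set2E; apply/eqP/seteqP; split=> x //= -[[? ?] []].
Qed.

Variable D : set T.
Hypothesis mD : measurable D.
Implicit Types (s : @simpleFun R d T E mu D).
Local Notation sfset s := (@sf_set _ _ _ _ _ _ s).
Local Notation sfvec s := (@sf_vec _ _ _ _ _ _ s).

Lemma measurable_norm_sf (f : T -> E) s :
  (forall w, measurable_fun D (fun x => `|f x - w|)) ->
  measurable_fun D (fun x => `|f x - sf_eval s x|).
Proof.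
move=> mf; have := @measurable_norm_simple _ _ (fun i => - sfvec s i) D f (fun i => @sf_measurable _ _ _ _ _ _ s i) mD.
move=> H; apply: (eq_measurable_fun _ _ (H _)).
- by move=> x _; congr `|_ + _|; rewrite /sf_eval -sumrN; apply: eq_bigr => i _; rewrite scalerN.
- by move=> w; have := mf (- w); under eq_fun do rewrite opprK.
Qed.

Lemma measurable_norm_sf1 s : measurable_fun D (fun x => `|sf_eval s x|).
Proof.
have := @measurable_norm_sf (fun=> 0) s (fun w => _).
move=> H; apply: (eq_measurable_fun _ _ (H _)) => [x _|w]; first by rewrite sub0r normrN.
exact: measurable_cst.
Qed.

Lemma norm_sf_integral_le s :
  ((`|sf_integral s|)%:E <= \int[mu]_(x in D) (`|sf_eval s x|)%:E)%E.
Proof.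
(* D may have infinite measure; the sets of s cover a part of finite measure *)
pose B := \big[setU/set0]_(i < sf_size s) sfset s i.
have mB : measurable B by apply: bigsetU_measurable => i _; exact: sf_measurable.
have BD : B `<=` D.
  by rewrite /B; elim/big_ind: _ => // [X Y XD YD x [/XD|/YD]//|i _]; exact: sf_sub.
have sB i : sfset s i `<=` B by move=> x sx; rewrite /B (bigD1 i)//=; left.
have fB : (mu B < +oo)%E.
  suff [] : measurable B /\ (mu B < +oo)%E by [].
  rewrite /B; elim/big_ind: _ => [|X Y [mX fX] [mY fY]|i _]; first by rewrite measure0.
    split; first exact: measurableU.
    by apply: le_lt_trans (measureU2 mu mX mY) _; exact: lte_add_pinfty.
  by split; [exact: sf_measurable|exact: sf_finite].
have /= := @norm_simple_integral_le _ _ (sfvec s) B 0 (fun i => @sf_measurable _ _ _ _ _ _ s i) mB fB.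
rewrite scaler0 add0r; under eq_bigr do rewrite (setIidr (sB _)); move=> H.
apply: le_trans H _; under eq_integral do rewrite add0r.
apply: ge0_subset_integral => //; exact/measurable_EFinP/measurable_norm_sf1.
Qed.

Lemma measurable_norm_sfB s s' : measurable_fun D (fun x => `|sf_eval s x - sf_eval s' x|).
Proof.
apply: measurable_norm_sf => w.
have := @measurable_norm_sf (fun=> w) s (fun w' => _).
move=> H; apply: (eq_measurable_fun _ _ (H _)) => [x _|w']; first by rewrite distrC.
exact: measurable_cst.
Qed.

Let cat_set s s' (i : 'I_(sf_size s + sf_size s')) :=
  match fintype.split i with inl i => sfset s i | inr i => sfset s' i end.

Fact sf_cat_measurable s s' i : measurable (@cat_set s s' i).
Proof. by rewrite /cat_set; case: fintype.split => k; exact: sf_measurable. Qed.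

Fact sf_cat_sub s s' i : @cat_set s s' i `<=` D.
Proof. by rewrite /cat_set; case: fintype.split => k; exact: sf_sub. Qed.

Fact sf_cat_finite s s' i : (mu (@cat_set s s' i) < +oo)%E.
Proof. by rewrite /cat_set; case: fintype.split => k; exact: sf_finite. Qed.

(** The sets of a simple function need not be disjoint, hence concatenation
    represents a sum. *)
Definition sf_cat s s' : @simpleFun R d T E mu D :=
  @SimpleFun R d T E mu D (sf_size s + sf_size s') (@cat_set s s')
    (fun i => match fintype.split i with inl i => sfvec s i | inr i => sfvec s' i end)
    (@sf_cat_measurable s s') (@sf_cat_sub s s') (@sf_cat_finite s s').

Lemma sf_cat_eval s s' x : sf_eval (sf_cat s s') x = sf_eval s x + sf_eval s' x.
Proof.
rewrite /sf_eval/= big_split_ord/= /cat_set; congr (_ + _); apply: eq_bigr => i _.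
  by rewrite (unsplitK (inl i)).
by rewrite (unsplitK (inr i)).
Qed.

Lemma sf_cat_integral s s' : sf_integral (sf_cat s s') = sf_integral s + sf_integral s'.
Proof.
rewrite /sf_integral/= big_split_ord/= /cat_set; congr (_ + _); apply: eq_bigr => i _.
  by rewrite (unsplitK (inl i)).
by rewrite (unsplitK (inr i)).
Qed.

Definition sf_opp s : @simpleFun R d T E mu D :=
  @SimpleFun R d T E mu D (sf_size s) (sfset s) (fun i => - sfvec s i)
    (fun i => @sf_measurable _ _ _ _ _ _ s i) (fun i => @sf_sub _ _ _ _ _ _ s i) (fun i => @sf_finite _ _ _ _ _ _ s i).

Lemma sf_opp_eval s x : sf_eval (sf_opp s) x = - sf_eval s x.
Proof. by rewrite /sf_eval/= -sumrN; apply: eq_bigr => i _; rewrite scalerN. Qed.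

Lemma sf_opp_integral s : sf_integral (sf_opp s) = - sf_integral s.
Proof. by rewrite /sf_integral/= -sumrN; apply: eq_bigr => i _; rewrite scalerN. Qed.

Lemma sf_integralB_le s s' : ((`|sf_integral s - sf_integral s'|)%:E <=
  \int[mu]_(x in D) (`|sf_eval s x - sf_eval s' x|)%:E)%E.
Proof.
have := norm_sf_integral_le (sf_cat s (sf_opp s')).
rewrite sf_cat_integral sf_opp_integral => H; apply: le_trans H _.
by under eq_integral do rewrite sf_cat_eval sf_opp_eval.
Qed.

Lemma sf_integralB_le2 (f : T -> E) s s' :
  measurable_fun D (fun x => `|f x - sf_eval s x|) ->
  measurable_fun D (fun x => `|f x - sf_eval s' x|) ->
  ((`|sf_integral s - sf_integral s'|)%:E <=
  \int[mu]_(x in D) (`|f x - sf_eval s x|)%:E +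
  \int[mu]_(x in D) (`|f x - sf_eval s' x|)%:E)%E.
Proof.
move=> m1 m2; apply: le_trans (sf_integralB_le s s') _.
rewrite -ge0_integralD//; [|exact/measurable_EFinP..].
apply: ge0_le_integral => //; first exact/measurable_EFinP/measurable_norm_sfB.
  by apply: emeasurable_funD; exact/measurable_EFinP.
move=> x _; rewrite -EFinD lee_fin.
have -> : sf_eval s x - sf_eval s' x = (sf_eval s x - f x) + (f x - sf_eval s' x).
  by rewrite addrA subrK.
by rewrite (le_trans (ler_normD _ _))// (distrC (sf_eval s x)).
Qed.

(** The integrals of two approximating sequences differ by at most the sum of
    their distances to f in the mean. *)
Lemma is_bochner_unique (f : T -> E) I J : is_bochner mu D f I -> is_bochner mu D f J -> I = J.
Proof.
move=> [s [ms s0 sI]] [s' [ms' s'0 sJ]]; apply/eqP; rewrite -subr_eq0 -normr_le0.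
have H1 : (`|sf_integral (s n) - sf_integral (s' n)|)%:E @[n --> \oo] --> (`|I - J|)%:E.
  apply: cvg_EFin; first exact: nearW.
  by apply: cvg_norm; exact: cvgB.
have H2 : (\int[mu]_(x in D) (`|f x - sf_eval (s n) x|)%:E +
    \int[mu]_(x in D) (`|f x - sf_eval (s' n) x|)%:E)%E @[n --> \oo] --> 0%E.
  by rewrite -[X in _ --> X]adde0; apply: cvgeD => //; rewrite fin_num_adde_defl.
rewrite -lee_fin; apply: (lee_cvg_to H1 H2).
by apply: nearW => n; exact: sf_integralB_le2.
Qed.

Lemma bochnerE (f : T -> E) I : is_bochner mu D f I -> bochner mu D f = I.
Proof. by move=> H; apply: xget_unique => // J HJ; exact: is_bochner_unique HJ H. Qed.

End SimpleFunctions.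

Section ChangeDomain.
Context {R : realType} {d : measure_display} {T : measurableType d}
  {E : normedModType R} (mu : {measure set T -> \bar R}).

Definition sf_widen (D D' : set T) (DD' : D `<=` D') (s : @simpleFun R d T E mu D) :
  @simpleFun R d T E mu D' :=
  @SimpleFun R d T E mu D' (sf_size s) (@sf_set _ _ _ _ _ _ s) (@sf_vec _ _ _ _ _ _ s)
    (fun i => @sf_measurable _ _ _ _ _ _ s i)
    (fun i => subset_trans (@sf_sub _ _ _ _ _ _ s i) DD')
    (fun i => @sf_finite _ _ _ _ _ _ s i).

Lemma sf_eval_out (D : set T) (s : @simpleFun R d T E mu D) x : ~ D x -> sf_eval s x = 0.
Proof.
move=> Dx; rewrite /sf_eval big1// => i _; rewrite indicE memNset ?scale0r//.
by move=> /sf_sub.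
Qed.

Lemma sf_widen_eval (D D' : set T) (DD' : D `<=` D') (s : @simpleFun R d T E mu D) :
  sf_eval (sf_widen DD' s) = sf_eval s.
Proof. by []. Qed.

Lemma sf_widen_integral (D D' : set T) (DD' : D `<=` D') (s : @simpleFun R d T E mu D) :
  sf_integral (sf_widen DD' s) = sf_integral s.
Proof. by []. Qed.

(** Choosing approximations up to 1/(n+1) reduces the sequential definition to
    one approximation for each e. *)
Lemma is_bochner_approx (D : set T) (f : T -> E) I : measurable D ->
  (forall e : R, 0 < e -> exists s : @simpleFun R d T E mu D,
    [/\ measurable_fun D (fun x => `|f x - sf_eval s x|),
        (\int[mu]_(x in D) (`|f x - sf_eval s x|)%:E <= e%:E)%E &
        `|sf_integral s - I| <= e]) -> is_bochner mu D f I.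
Proof.
move=> mD H.
have n0 n : 0 < n.+1%:R^-1 :> R by rewrite invr_gt0.
have /choice[s Hs] n := H n.+1%:R^-1 (n0 n).
have near_inv (e : R) : 0 < e -> \forall n \near \oo, n.+1%:R^-1 <= e :> R.
  move=> e0; have := near_infty_natSinv_lt (PosNum e0).
  by apply: filterS => n /= /ltW.
exists s; split=> [n||]; first by have [] := Hs n.
- apply: cvge0P => [n|e e0]; first exact: integral_ge0.
  apply: filterS (near_inv e e0) => n ne.
  by have [_ H1 _] := Hs n; apply: le_trans H1 _; rewrite lee_fin.
- apply/cvgrPdist_le => e e0; apply: filterS (near_inv e e0) => n ne.
  by have [_ _ H1] := Hs n; rewrite distrC (le_trans H1).
Qed.

Lemma bochner_approx (D : set T) (f : T -> E) I : measurable D ->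
  is_bochner mu D f I -> forall e : R, 0 < e -> exists s : @simpleFun R d T E mu D,
    [/\ measurable_fun D (fun x => `|f x - sf_eval s x|),
        (\int[mu]_(x in D) (`|f x - sf_eval s x|)%:E <= e%:E)%E &
        `|sf_integral s - I| <= e].
Proof.
move=> mD [s [ms s0 sI]] e e0.
have H1 := cvge0_le e0 s0.
have H2 : \forall n \near \oo, `|I - sf_integral (s n)| <= e by move/cvgrPdist_le : sI; exact.
have [n /= [Hn1 Hn2]] : exists n, (\int[mu]_(x in D) (`|f x - sf_eval (s n) x|)%:E <= e%:E)%E /\
  `|I - sf_integral (s n)| <= e.
  by apply: (@filter_ex _ \oo); apply: filterI.
by exists (s n); split=> //; rewrite distrC.
Qed.

(** Integrability on D from integrability on subsets D_n, when the norm of f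
    has small integral on their complements: an approximation on D_n extends by
    zero. *)
Lemma is_bochner_exhaust (D : set T) (Dn : nat -> set T) (In : nat -> E) f I :
  measurable D -> (forall n, measurable (Dn n)) -> (forall n, Dn n `<=` D) ->
  (forall n, is_bochner mu (Dn n) f (In n)) ->
  (forall n, measurable_fun (D `\` Dn n) (fun x => `|f x|)) ->
  In @ \oo --> I ->
  (\int[mu]_(x in D `\` Dn n) (`|f x|)%:E)%E @[n --> \oo] --> 0%E ->
  is_bochner mu D f I.
Proof.
move=> mD mDn DnD bn mf InI f0; apply: is_bochner_approx => // e e0.
have e20 : 0 < e / 2 by rewrite divr_gt0.
have H1 := cvge0_le e20 f0.
have H2 : \forall n \near \oo, `|I - In n| <= e / 2 by move/cvgrPdist_le : InI; exact.
have [n [Hn1 Hn2]] : exists n, (\int[mu]_(x in D `\` Dn n) (`|f x|)%:E <= (e / 2)%:E)%E /\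
  `|I - In n| <= e / 2.
  by apply: (@filter_ex _ \oo); apply: filterI.
have [s [ms s1 s2]] := bochner_approx (mDn n) (bn n) e20.
exists (sf_widen (DnD n) s); rewrite sf_widen_eval sf_widen_integral.
have mDD : measurable (D `\` Dn n) by exact: measurableD.
have DE : Dn n `|` (D `\` Dn n) = D by exact: setDUK.
have outE x : (D `\` Dn n) x -> `|f x - sf_eval s x| = `|f x|.
  by move=> [_ ?]; rewrite sf_eval_out// subr0.
have mD' : measurable_fun D (fun x => `|f x - sf_eval s x|).
  rewrite -DE; apply/measurable_funU => //; split=> //.
  by apply: eq_measurable_fun (mf n) => x; rewrite inE => Dx; rewrite outE.
split=> //.
- rewrite -{1}DE ge0_integral_setU//; last 2 first.
  + by rewrite DE; exact/measurable_EFinP.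
  + by rewrite disj_set2E setDIK.
  rewrite [e]splitr EFinD; apply: leeD => //.
  apply: le_trans Hn1; rewrite le_eqVlt; apply/orP; left; apply/eqP.
  by apply: eq_integral => x; rewrite inE => Dx; rewrite outE.
- rewrite -[sf_integral s - I](subrKA (In n)) [e]splitr.
  apply: le_trans (ler_normD _ _) _; apply: lerD => //.
  by rewrite distrC.
Qed.

End ChangeDomain.

(** * Integrals of continuous functions over compact intervals *)

Section Completeness.
Context {R : realType} {E : completeNormedModType R}.

(** Cauchy's criterion for a function along a filter. *)
Lemma cvg_oscillation {T : Type} (F : set_system T) (FF : ProperFilter F) (f : T -> E) :
  (forall e : R, 0 < e -> exists2 A, F A & forall x y, A x -> A y -> `|f x - f y| <= e) ->
  cvg (f @ F).
Proof.
move=> H; apply/cauchy_cvgP/cauchy_exP => e e0.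
have [A FA HA] := H (e / 2) (divr_gt0 e0 (ltr0Sn _ 1)).
have [x Ax] := filter_ex FA; exists (f x).
suff : F [set y | ball (f x) e (f y)] by [].
apply: filterS FA => y Ay /=; rewrite -ball_normE /ball_ /=.
apply: le_lt_trans (HA _ _ Ax Ay) _.
by rewrite ltr_pdivrMr// mulr_natr mulr2n ltrDl.
Qed.

End Completeness.

Section IntervalIntegral.
Context {R : realType} {E : completeNormedModType R}.
Local Notation mu := (@lebesgue_measure R).
Local Notation mfun := (@measurable_fun _ _ (measurableTypeR R) R).
Implicit Types (f : R -> E) (a b c x y : R).

Definition continuous_on a b f := forall x, a < x -> x < b -> {for x, continuous f}.

Lemma continuous_onS a b a' b' f : a <= a' -> b' <= b ->
  continuous_on a b f -> continuous_on a' b' f.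
Proof. by move=> aa bb H x ax xb; exact: (H x (le_lt_trans aa ax) (lt_le_trans xb bb)). Qed.

Lemma continuous_norm_sub f x w : {for x, continuous f} -> {for x, continuous (fun y => `|f y - w|)}.
Proof. by move=> cf; apply: cvg_norm; apply: cvgB => //; exact: cvg_cst. Qed.

Lemma measurable_norm_oc a b f : continuous_on a b f -> {for b, continuous f} ->
  forall w, mfun `]a, b] (fun x => `|f x - w|).
Proof.
move=> cf cb w.
suff : measurable_fun `]a, b] (fun x => `|f x - w|) by exact.
apply/measurable_fun_itv_bndo_bndcP; apply: open_continuous_measurable_fun => //.
by move=> x; rewrite inE/= in_itv/= => /andP[ax xb]; apply: continuous_norm_sub; exact: cf.
Qed.

Lemma measurable_oc a b : @measurable _ (measurableTypeR R) `]a, b]%classic.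
Proof. exact: measurable_itv. Qed.

Lemma mu_oc a b : a <= b -> mu `]a, b] = (b - a)%:E.
Proof.
move=> ab; rewrite lebesgue_measure_itv/= lte_fin; case: ltP => //.
by move=> ba; have -> : a = b by [apply/eqP; rewrite eq_le ab]; rewrite subrr.
Qed.

Lemma integral_le_oc a b (g : R -> R) e : a <= b -> (forall x, 0 <= g x) ->
  mfun `]a, b] g -> (forall x, a < x -> x <= b -> g x <= e) ->
  (\int[mu]_(x in `]a, b]) (g x)%:E <= (e * (b - a))%:E)%E.
Proof.
move=> ab g0 mg ge.
apply: (@le_trans _ _ (\int[mu]_(x in `]a, b]) (cst e%:E) x)%E).
  apply: ge0_le_integral => //.
  - by move=> x _; rewrite lee_fin.
  - exact/measurable_EFinP.
  - by move=> x; rewrite /= in_itv/= => /andP[ax xb]; rewrite lee_fin ge.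
by rewrite integral_cst// EFinM -(mu_oc ab).
Qed.

Fact sf_const_measurable a b (i : 'I_1) : measurable (`]a, b] : set R).
Proof. by []. Qed.

Fact sf_const_finite a b (i : 'I_1) : (mu `]a, b] < +oo)%E.
Proof.
by rewrite lebesgue_measure_itv/=; case: ifP => _; rewrite ltry.
Qed.

Definition sf_const a b (v : E) : @simpleFun R _ _ E mu `]a, b] :=
  @SimpleFun R _ _ E mu `]a, b]%classic 1 (fun=> `]a, b]%classic) (fun=> v)
    (@sf_const_measurable a b) (fun=> @subset_refl _ _) (@sf_const_finite a b).

Lemma sf_const_eval a b v x : a < x -> x <= b -> sf_eval (sf_const a b v) x = v.
Proof.
move=> ax xb; rewrite /sf_eval big_ord_recl big_ord0 addr0/= indicE mem_set ?scale1r//=.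
by rewrite in_itv/= ax.
Qed.

Lemma sf_const_integral a b v : a <= b -> sf_integral (sf_const a b v) = (b - a) *: v.
Proof. by move=> ab; rewrite /sf_integral big_ord_recl big_ord0 addr0/= mu_oc. Qed.

Lemma oc_subl a b c : b <= c -> `]a, b] `<=` (`]a, c] : set R).
Proof. by move=> bc x /=; rewrite !in_itv/= => /andP[-> /le_trans]; exact. Qed.

Lemma oc_subr a b c : a <= b -> `]b, c] `<=` (`]a, c] : set R).
Proof. by move=> ab x /=; rewrite !in_itv/= => /andP[/(le_lt_trans ab) -> ->]. Qed.

Lemma notin_oc_le a b x : x <= a -> ~ (`]a, b]%classic : set R) x.
Proof. by move=> xa; rewrite /= in_itv/= ltNge xa. Qed.

Lemma notin_oc_gt a b x : b < x -> ~ (`]a, b]%classic : set R) x.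
Proof. by move=> bx; rewrite /= in_itv/= [x <= b]leNgt bx andbF. Qed.

Lemma glue_integral_le a b c (g g1 g2 : R -> R) e1 e2 : a <= b -> b <= c ->
  (forall x, 0 <= g x) ->
  (forall x, a < x -> x <= b -> g x = g1 x) ->
  (forall x, b < x -> x <= c -> g x = g2 x) ->
  mfun `]a, b] g1 -> mfun `]b, c] g2 ->
  (\int[mu]_(x in `]a, b]) (g1 x)%:E <= e1%:E)%E ->
  (\int[mu]_(x in `]b, c]) (g2 x)%:E <= e2%:E)%E ->
  mfun `]a, c] g /\
  (\int[mu]_(x in `]a, c]) (g x)%:E <= (e1 + e2)%:E)%E.
Proof.
move=> ab bc g0 gE1 gE2 m1 m2 I1 I2.
have {}gE1 x : x \in (`]a, b]%classic : set R) -> g x = g1 x.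
  by rewrite inE /= in_itv/= => /andP[]; exact: gE1.
have {}gE2 x : x \in (`]b, c]%classic : set R) -> g x = g2 x.
  by rewrite inE /= in_itv/= => /andP[]; exact: gE2.
have DE : `]a, c]%classic = `]a, b] `|` `]b, c] :> set R.
  by rewrite -itv_bndbnd_setU// bnd_simp.
have mu1 : mfun `]a, b] g.
  by apply: eq_measurable_fun m1 => x Dx; rewrite gE1.
have mu2 : mfun `]b, c] g.
  by apply: eq_measurable_fun m2 => x Dx; rewrite gE2.
have mu12 : mfun `]a, c] g by rewrite DE; apply/measurable_funU.
split=> //; rewrite DE ge0_integral_setU//; last 3 first.
- by rewrite -DE; exact/measurable_EFinP.
- by move=> x _; rewrite lee_fin.
- rewrite disj_set2E; apply/eqP/seteqP; split=> x //=.
  by rewrite !in_itv/= => -[/andP[_ xb] /andP[bx _]]; move: xb; rewrite leNgt bx.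
rewrite EFinD; apply: leeD.
  apply: le_trans I1; rewrite le_eqVlt; apply/orP; left; apply/eqP.
  by apply: eq_integral => x Dx; rewrite gE1.
apply: le_trans I2; rewrite le_eqVlt; apply/orP; left; apply/eqP.
by apply: eq_integral => x Dx; rewrite gE2.
Qed.

Definition sf_widenl a b c (bc : b <= c) (s : @simpleFun R _ _ E mu `]a, b]) :
  @simpleFun R _ _ E mu `]a, c] := @sf_widen R _ _ E mu _ _ (@oc_subl a b c bc) s.

Definition sf_widenr a b c (ab : a <= b) (s : @simpleFun R _ _ E mu `]b, c]) :
  @simpleFun R _ _ E mu `]a, c] := @sf_widen R _ _ E mu _ _ (@oc_subr a b c ab) s.

Lemma sf_glue a b c f (ab : a <= b) (bc : b <= c)
  (s : @simpleFun R _ _ E mu `]a, b]) (t : @simpleFun R _ _ E mu `]b, c]) e1 e2 :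
  mfun `]a, b] (fun x => `|f x - sf_eval s x|) ->
  mfun `]b, c] (fun x => `|f x - sf_eval t x|) ->
  (\int[mu]_(x in `]a, b]) (`|f x - sf_eval s x|)%:E <= e1%:E)%E ->
  (\int[mu]_(x in `]b, c]) (`|f x - sf_eval t x|)%:E <= e2%:E)%E ->
  let u := sf_cat (sf_widenl bc s) (sf_widenr ab t) in
  mfun `]a, c] (fun x => `|f x - sf_eval u x|) /\
  (\int[mu]_(x in `]a, c]) (`|f x - sf_eval u x|)%:E <= (e1 + e2)%:E)%E.
Proof.
move=> ms mt Is It u.
apply: (glue_integral_le ab bc _ _ _ ms mt Is It) => [//|x ax xb|x bx xc].
  rewrite sf_cat_eval -[sf_eval (sf_widenr _ _)]/(sf_eval t) [sf_eval t x]sf_eval_out ?addr0//.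
  exact: notin_oc_le.
rewrite sf_cat_eval -[sf_eval (sf_widenl _ _)]/(sf_eval s) [sf_eval s x]sf_eval_out ?add0r//.
exact: notin_oc_gt.
Qed.

(** Approximability up to e (b - a) is an additive property of intervals
    ([sf_glue]), and continuity provides constant approximations near each
    point, so no uniform continuity is needed. *)
Lemma step_approx a0 b0 a b f e : continuous_on a0 b0 f -> a0 < a -> a <= b -> b < b0 ->
  0 < e -> exists s : @simpleFun R _ _ E mu `]a, b],
    mfun `]a, b] (fun x => `|f x - sf_eval s x|) /\
    (\int[mu]_(x in `]a, b]) (`|f x - sf_eval s x|)%:E <= (e * (b - a))%:E)%E.
Proof.
move=> cf a0a ab bb0 e0.
apply: (@cousin R a b (fun x y => exists s : @simpleFun R _ _ E mu `]x, y],
    mfun `]x, y] (fun z => `|f z - sf_eval s z|) /\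
    (\int[mu]_(z in `]x, y]) (`|f z - sf_eval s z|)%:E <= (e * (y - x))%:E)%E)) => //.
- move=> x y z _ xy yz _ [s [ms Is]] [t [mt It]].
  have [mu Iu] := sf_glue xy yz ms mt Is It.
  exists (sf_cat (sf_widenl yz s) (sf_widenr xy t)); split=> //.
  by apply: le_trans Iu _; rewrite lee_fin -mulrDr addrC addrA subrK.
- move=> c ac cb.
  have /continuousP /(_ e e0) [h h0 H] := cf c (lt_le_trans a0a ac) (le_lt_trans cb bb0).
  exists h => // x y ax xc cy yb chx ych; exists (sf_const x y (f c)).
  have ms : mfun `]x, y] (fun z => `|f z - sf_eval (sf_const x y (f c)) z|).
    apply: measurable_norm_sf => //; apply: measurable_norm_oc.
      by apply: continuous_onS cf; [exact/ltW/(lt_le_trans a0a)|exact/ltW/(le_lt_trans yb)].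
    exact: (cf y (lt_le_trans a0a (le_trans ac cy)) (le_lt_trans yb bb0)).
  split=> //; apply: integral_le_oc => //; first exact: le_trans cy.
  move=> z xz zy; rewrite sf_const_eval// H// ltr_norml ltrBlDl (le_lt_trans zy)//.
  by rewrite andbT ltrBrDl (lt_trans chx xz).
Qed.

Lemma is_bochner_exists a0 b0 a b f : continuous_on a0 b0 f -> a0 < a -> a <= b -> b < b0 ->
  exists I, is_bochner mu `]a, b] f I.
Proof.
move=> cf a0a ab bb0.
pose k := 1 + (b - a); have k0 : 0 < k by rewrite ltr_wpDr// subr_ge0.
have ek0 n : 0 < n.+1%:R^-1 / k :> R by rewrite divr_gt0.
have /choice[s Hs] n := step_approx cf a0a ab bb0 (ek0 n).
have near_inv (e : R) : 0 < e -> \forall n \near \oo, n.+1%:R^-1 <= e :> R.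
  move=> e0; have := near_infty_natSinv_lt (PosNum e0).
  by apply: filterS => n /= /ltW.
have Is n : (\int[mu]_(x in `]a, b]) (`|f x - sf_eval (s n) x|)%:E <= n.+1%:R^-1%:E)%E.
  have [_ H] := Hs n; apply: le_trans H _; rewrite lee_fin mulrAC ler_pdivrMr//.
  by rewrite ler_wpM2l// /k lerDr.
have ms n := (Hs n).1.
have : cvg (sf_integral (s n) @[n --> \oo]).
  apply: cvg_oscillation => e e0.
  exists [set n | n.+1%:R^-1 <= e / 2 :> R]; first exact: near_inv (divr_gt0 e0 (ltr0Sn _ 1)).
  move=> m n /= me ne; rewrite -lee_fin [e]splitr EFinD.
  apply: le_trans (sf_integralB_le2 _ (ms m) (ms n)) _ => //.
  by apply: leeD; [apply: le_trans (Is m) _|apply: le_trans (Is n) _]; rewrite lee_fin.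
move/cvg_ex => [I HI]; exists I, s; split=> //.
apply: cvge0P => [n|e e0]; first exact: integral_ge0.
apply: filterS (near_inv e e0) => n ne; apply: le_trans (Is n) _.
by rewrite lee_fin.
Qed.

Lemma is_bochner_add a b c f I J : a <= b -> b <= c ->
  is_bochner mu `]a, b] f I -> is_bochner mu `]b, c] f J ->
  is_bochner mu `]a, c] f (I + J).
Proof.
move=> ab bc fI fJ; apply: is_bochner_approx => // e e0.
have e20 : 0 < e / 2 by rewrite divr_gt0.
have [s [ms Is Js]] := bochner_approx (measurable_oc _ _) fI e20.
have [t [mt It Jt]] := bochner_approx (measurable_oc _ _) fJ e20.
have [mu Iu] := sf_glue ab bc ms mt Is It.
exists (sf_cat (sf_widenl bc s) (sf_widenr ab t)); split=> //.
  by rewrite [e]splitr.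
rewrite sf_cat_integral !sf_widen_integral opprD addrACA [e]splitr.
by apply: le_trans (ler_normD _ _) _; exact: lerD.
Qed.

Lemma is_bochner_near_cst a b f I v e : a <= b ->
  (forall w, mfun `]a, b] (fun x => `|f x - w|)) ->
  is_bochner mu `]a, b] f I ->
  (forall x, a < x -> x <= b -> `|f x - v| <= e) -> `|I - (b - a) *: v| <= e * (b - a).
Proof.
move=> ab mf fI fv; apply/ler_addgt0Pr => e' e'0.
have e20 : 0 < e' / 2 by rewrite divr_gt0.
have [s [ms Is Js]] := bochner_approx (measurable_oc _ _) fI e20.
rewrite -(sf_const_integral v ab) -[I - _](subrKA (sf_integral s)).
have -> : e * (b - a) + e' = e' / 2 + (e' / 2 + e * (b - a)) by rewrite addrA -splitr addrC.
apply: le_trans (ler_normD _ _) _; apply: lerD; first by rewrite distrC.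
rewrite -lee_fin EFinD; have mc : mfun `]a, b] (fun x => `|f x - sf_eval (sf_const a b v) x|).
  by apply: measurable_norm_sf.
apply: le_trans (sf_integralB_le2 _ ms mc) _ => //; apply: leeD => //.
apply: integral_le_oc => // x ax xb.
by rewrite sf_const_eval// fv.
Qed.

(** Half-open intervals make integrals additive. *)
Definition vint f a b : E := bochner mu `]a, b] f.

Lemma is_bochner_vint a0 b0 a b f : continuous_on a0 b0 f -> a0 < a -> a <= b -> b < b0 ->
  is_bochner mu `]a, b] f (vint f a b).
Proof.
move=> cf a0a ab bb0; have [I HI] := is_bochner_exists cf a0a ab bb0.
by rewrite /vint (bochnerE _ HI).
Qed.

Lemma vint_add a0 b0 a b c f : continuous_on a0 b0 f -> a0 < a -> a <= b -> b <= c -> c < b0 ->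
  vint f a c = vint f a b + vint f b c.
Proof.
move=> cf a0a ab bc cb0; apply: bochnerE => //; apply: (is_bochner_add ab bc).
  by apply: is_bochner_vint cf _ _ _ => //; exact: le_lt_trans bc cb0.
by apply: is_bochner_vint cf _ _ _ => //; exact: lt_le_trans a0a ab.
Qed.

Lemma vint_near_cst a0 b0 a b f v e : continuous_on a0 b0 f -> a0 < a -> a <= b -> b < b0 ->
  (forall x, a < x -> x <= b -> `|f x - v| <= e) ->
  `|vint f a b - (b - a) *: v| <= e * (b - a).
Proof.
move=> cf a0a ab bb0; apply: is_bochner_near_cst => //; last exact: is_bochner_vint cf _ _ _.
apply: measurable_norm_oc; last exact: (cf b (lt_le_trans a0a ab) bb0).
by apply: continuous_onS cf; exact: ltW.
Qed.

(** Over a short interval ending or starting at x, f is close to f x. *)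
Lemma has_deriv_vint a0 b0 a x f : continuous_on a0 b0 f -> a0 < a -> a < x -> x < b0 ->
  has_deriv (vint f a) x (f x).
Proof.
move=> cf a0a ax xb0 e e0.
have /continuousP /(_ e e0) [h h0 H] := cf x (lt_trans a0a ax) xb0.
exists (Num.min h (Num.min (x - a) (b0 - x))); first by rewrite !lt_min h0 !subr_gt0 ax.
move=> y; rewrite !lt_min => /and3P[yh ya yb].
have ay : a < y.
  by move: ya; rewrite ltr_norml => /andP[+ _]; rewrite ltrBrDl opprB addrC subrK.
have yb0 : y < b0.
  by move: yb; rewrite ltr_norml => /andP[_]; rewrite ltrBlDr subrK.
have [xy|yx] := leP x y.
  rewrite (vint_add cf a0a (ltW ax) xy yb0) [_ + _ - vint f a x]addrAC subrr add0r ger0_norm ?subr_ge0//.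
  apply: vint_near_cst cf _ _ _ _ => //; first exact: lt_trans ax.
  move=> z xz zy; apply: H; rewrite ger0_norm ?subr_ge0 ?(ltW xz)//.
  by apply: le_lt_trans yh; rewrite ger0_norm ?subr_ge0// lerD2r.
rewrite (vint_add cf a0a (ltW ay) (ltW yx) xb0).
have -> : vint f a y - (vint f a y + vint f y x) - (y - x) *: f x =
  - (vint f y x - (x - y) *: f x) by module R.
rewrite normrN [`|y - x|]distrC ger0_norm ?subr_ge0 ?(ltW yx)//.
apply: vint_near_cst cf _ _ _ _ => //; [exact: lt_trans ay|exact: ltW|].
move=> z yz zx; apply: H; apply: le_lt_trans yh.
rewrite distrC [leRHS]distrC !ger0_norm ?subr_ge0//; last exact: ltW.
by rewrite lerD2l lerN2 ltW.
Qed.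

(** F - (vint f a1) has derivative zero, hence is constant.  The base point
    a1 < a makes a an interior point. *)
Lemma vint_FTC a0 b0 a b f F : a0 < a -> a <= b -> b < b0 -> continuous_on a0 b0 f ->
  (forall x, a0 < x -> x < b0 -> has_deriv F x (f x)) -> vint f a b = F b - F a.
Proof.
move=> a0a ab bb0 cf dF; pose a1 := (a0 + a) / 2.
have [a01 a1a] : a0 < a1 /\ a1 < a by rewrite midf_lt// midf_lt.
have H : F b - vint f a1 b = F a - vint f a1 a.
  apply: (@deriv0_const _ _ (fun x => F x - vint f a1 x) a b ab) => x ax xb.
  rewrite -(subrr (f x)); apply: has_derivB.
    by apply: dF; [exact: lt_le_trans ax|exact: le_lt_trans bb0].
  by apply: has_deriv_vint cf a01 _ _; [exact: lt_le_trans ax|exact: le_lt_trans bb0].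
have := vint_add cf a01 (ltW a1a) ab bb0 => E1.
have -> : vint f a b = vint f a1 b - vint f a1 a by rewrite E1; module R.
have -> : F b = F a - vint f a1 a + vint f a1 b by rewrite -H subrK.
by module R.
Qed.

Lemma primitive_exists a0 b0 a f : a0 < a -> continuous_on a0 b0 f ->
  exists F, forall x, a < x -> x < b0 -> has_deriv F x (f x).
Proof. by move=> a0a cf; exists (vint f a) => x ax xb; exact: has_deriv_vint cf _ _ _. Qed.

(** Passing from half-open to closed intervals adds one point, of measure 0. *)
Lemma bochner_cc a0 b0 a b f : continuous_on a0 b0 f -> a0 < a -> a <= b -> b < b0 ->
  is_bochner mu `[a, b] f (vint f a b).
Proof.
move=> cf a0a ab bb0.
have cc_oc : `[a, b] `\` `]a, b] = [set a] :> set R.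
  apply/seteqP; split=> x /=; rewrite !in_itv/=.
    by move=> [/andP[ax ->]]; rewrite andbT => /negP; rewrite -leNgt => xa; apply/eqP; rewrite eq_le xa.
  by move=> ->; rewrite lexx ab ltxx.
apply: (@is_bochner_exhaust R _ (measurableTypeR R) E mu `[a, b]%classic (fun=> `]a, b]%classic) (fun=> vint f a b)).
- exact: measurable_itv.
- by move=> _; exact: measurable_itv.
- by move=> _ x /=; rewrite !in_itv/= => /andP[/ltW -> ->].
- by move=> _; exact: is_bochner_vint cf _ _ _.
- by move=> _; rewrite cc_oc; exact: measurable_fun_set1.
- exact: cvg_cst.
- by rewrite cc_oc integral_set1; exact: cvg_cst.
Qed.

End IntervalIntegral.

(** * Calculus of integrals and improper integrals *)

Section LinearContinuity.
Context {R : realType} {E F : normedModType R}.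

Lemma continuous_lin (L : E -> F) (c : R) :
  (forall u v, L (u - v) = L u - L v) ->
  (forall u, `|L u| <= c * `|u|) ->
  forall (f : R -> E) x, {for x, continuous f} -> {for x, continuous (fun y => L (f y))}.
Proof.
move=> LB Lc f x /continuousP cf; apply/continuousP => e e0.
have c0 : 0 < `|c| + 1 by rewrite ltr_wpDl.
have [h h0 H] := cf (e / (`|c| + 1)) (divr_gt0 e0 c0).
exists h => // y yx; rewrite -LB (le_trans (Lc _))//.
apply: (@le_trans _ _ ((`|c| + 1) * `|f y - f x|)).
  by rewrite ler_wpM2r// (le_trans (ler_norm c))// lerDl.
by rewrite mulrC -ler_pdivlMr// H.
Qed.

End LinearContinuity.

Section VintRules.
Context {R : realType} {E : completeNormedModType R}.
Implicit Types (f g : R -> E) (a b c x y : R).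

(** Both sides are increments of primitives, and L maps a primitive of f to a
    primitive of its image. *)
Lemma vint_lin {F : completeNormedModType R} (L : E -> F) (k : R) :
  (forall u v, L (u + v) = L u + L v) -> (forall (r : R) u, L (r *: u) = r *: L u) ->
  (forall u, `|L u| <= k * `|u|) ->
  forall a0 b0 a b f, a0 < a -> a <= b -> b < b0 -> continuous_on a0 b0 f ->
  vint (fun x => L (f x)) a b = L (vint f a b).
Proof.
move=> LD LZ Lk a0 b0 a b f a0a ab bb0 cf.
have LB u v : L (u - v) = L u - L v by rewrite LD -[- v]scaleN1r LZ scaleN1r.
pose a1 := (a0 + a) / 2.
have [a01 a1a] : a0 < a1 /\ a1 < a by rewrite midf_lt// midf_lt.
have [G dG] := primitive_exists a01 cf.
have cf1 : continuous_on a1 b0 f by exact: (continuous_onS (ltW a01) (lexx b0) cf).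
rewrite (vint_FTC a1a ab bb0 cf1 dG) LB; apply: (vint_FTC (F := fun x => L (G x)) a1a ab bb0) => x ax xb.
  exact: (continuous_lin LB Lk (cf1 x ax xb)).
exact: (has_deriv_lin LD LZ Lk (dG x ax xb)).
Qed.

Lemma vintD a0 b0 a b f g : a0 < a -> a <= b -> b < b0 ->
  continuous_on a0 b0 f -> continuous_on a0 b0 g ->
  vint (fun x => f x + g x) a b = vint f a b + vint g a b.
Proof.
move=> a0a ab bb0 cf cg; pose a1 := (a0 + a) / 2.
have [a01 a1a] : a0 < a1 /\ a1 < a by rewrite midf_lt// midf_lt.
have [G dG] := primitive_exists a01 cf; have [H dH] := primitive_exists a01 cg.
have cf1 : continuous_on a1 b0 f by exact: (continuous_onS (ltW a01) (lexx b0) cf).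
have cg1 : continuous_on a1 b0 g by exact: (continuous_onS (ltW a01) (lexx b0) cg).
rewrite (vint_FTC a1a ab bb0 cf1 dG) (vint_FTC a1a ab bb0 cg1 dH) addrACA -opprD.
apply: (vint_FTC (F := fun x => G x + H x) a1a ab bb0) => x ax xb.
  by apply: cvgD; [exact: cf1|exact: cg1].
by apply: has_derivD; [exact: dG|exact: dH].
Qed.

Lemma vintZ a0 b0 a b f (k : R) : a0 < a -> a <= b -> b < b0 ->
  continuous_on a0 b0 f ->
  vint (fun x => k *: f x) a b = k *: vint f a b.
Proof.
apply: (@vint_lin _ (fun u => k *: u) `|k|).
- by move=> u v; rewrite scalerDr.
- by move=> r u; rewrite !scalerA mulrC.
- by move=> u; rewrite normrZ.
Qed.

Lemma continuous_onZ (k : R) a b f : continuous_on a b f -> continuous_on a b (fun x => k *: f x).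
Proof. by move=> cf x ax xb; apply: cvgZr; exact: cf. Qed.

Lemma continuous_onD a b f g : continuous_on a b f -> continuous_on a b g ->
  continuous_on a b (fun x => f x + g x).
Proof. by move=> cf cg x ax xb; apply: cvgD; [exact: cf|exact: cg]. Qed.

Lemma vintB a0 b0 a b f g : a0 < a -> a <= b -> b < b0 ->
  continuous_on a0 b0 f -> continuous_on a0 b0 g ->
  vint (fun x => f x - g x) a b = vint f a b - vint g a b.
Proof.
move=> a0a ab bb0 cf cg.
rewrite (_ : (fun x => f x - g x) = (fun x => f x + (-1) *: g x)); last first.
  by apply/funext => x; rewrite scaleN1r.
rewrite (vintD a0a ab bb0)//; last exact: continuous_onZ.
by rewrite (vintZ _ a0a ab bb0)// scaleN1r.
Qed.

Lemma continuous_reflect f x : {for - x, continuous f} -> {for x, continuous (fun y => f (- y))}.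
Proof.
move=> /continuousP H; apply/continuousP => e e0; have [h h0 Hh] := H e e0.
by exists h => // y yx; apply: Hh; rewrite -opprD normrN.
Qed.

Lemma vint_reflect a0 b0 a b f : a0 < a -> a <= b -> b < b0 -> continuous_on a0 b0 f ->
  vint (fun x => f (- x)) (- b) (- a) = vint f a b.
Proof.
move=> a0a ab bb0 cf; pose a1 := (a0 + a) / 2.
have [a01 a1a] : a0 < a1 /\ a1 < a by rewrite midf_lt// midf_lt.
have [G dG] := primitive_exists a01 cf.
have cf1 : continuous_on a1 b0 f by exact: (continuous_onS (ltW a01) (lexx b0) cf).
rewrite (vint_FTC a1a ab bb0 cf1 dG).
have := @vint_FTC _ _ (- b0) (- a1) (- b) (- a) (fun x => f (- x)) (fun x => - G (- x)).
rewrite !opprK ltrN2 ltrN2 lerN2 => -> //.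
- by rewrite addrC.
- by move=> x bx xa; apply: continuous_reflect; apply: cf1; [rewrite ltrNr|rewrite ltrNl].
- move=> x bx xa.
  have dGx : has_deriv G (- x) (f (- x)) by apply: dG; [rewrite ltrNr|rewrite ltrNl].
  have dN : has_deriv (-%R : R -> R) x (-1) by apply/has_derivP; exact: is_deriveN.
  have := has_deriv_comp dN dGx; rewrite scaleN1r => H.
  have := has_derivZc (-1) H; rewrite scaleN1r opprK.
  by apply: has_deriv_eq; exists 1 => // y _ /=; rewrite scaleN1r.
Qed.

Lemma vint_norm a0 b0 a b f (g g' : R -> R) : a0 < a -> a <= b -> b < b0 -> continuous_on a0 b0 f ->
  (forall x, a <= x -> x <= b -> has_deriv g x (g' x)) ->
  (forall x, a <= x -> x <= b -> `|f x| <= g' x) ->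
  `|vint f a b| <= g b - g a.
Proof.
move=> a0a ab bb0 cf dg fg; pose a1 := (a0 + a) / 2.
have [a01 a1a] : a0 < a1 /\ a1 < a by rewrite midf_lt// midf_lt.
have [G dG] := primitive_exists a01 cf.
have cf1 : continuous_on a1 b0 f by exact: (continuous_onS (ltW a01) (lexx b0) cf).
rewrite (vint_FTC a1a ab bb0 cf1 dG).
apply: (@mean_value _ _ G f g g' a b ab) => // x ax xb.
by apply: dG; [exact: lt_le_trans ax|exact: le_lt_trans bb0].
Qed.

Lemma has_deriv_lmul (k x : R) : has_deriv ( *%R k) x k.
Proof.
have := @has_derivZc R R^o k id x 1.
rewrite -[k *: 1]/(k * 1) mulr1; apply.
by apply/has_derivP; exact: is_derive_id.
Qed.

Lemma vint_norm_cst a0 b0 a b f (k : R) : a0 < a -> a <= b -> b < b0 -> continuous_on a0 b0 f ->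
  (forall x, a <= x -> x <= b -> `|f x| <= k) ->
  `|vint f a b| <= k * (b - a).
Proof.
move=> a0a ab bb0 cf fk; rewrite mulrBr.
apply: (@vint_norm a0 b0 a b f ( *%R k) (fun=> k)) => // x _ _; exact: has_deriv_lmul.
Qed.

Lemma vint_ext a0 b0 a b f g : a0 < a -> a <= b -> b < b0 -> continuous_on a0 b0 f ->
  (forall x, a0 < x -> x < b0 -> f x = g x) -> vint f a b = vint g a b.
Proof.
move=> a0a ab bb0 cf fg; pose a1 := (a0 + a) / 2.
have [a01 a1a] : a0 < a1 /\ a1 < a by rewrite midf_lt// midf_lt.
have [G dG] := primitive_exists a01 cf.
have cf1 : continuous_on a1 b0 f by exact: (continuous_onS (ltW a01) (lexx b0) cf).
rewrite (vint_FTC a1a ab bb0 cf1 dG); apply: esym; apply: (vint_FTC (F := G) a1a ab bb0) => x ax xb.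
  have /continuousP H := cf1 x ax xb; apply/continuousP => e e0; have [h h0 Hh] := H e e0.
  exists (Num.min h (Num.min (x - a1) (b0 - x))); first by rewrite !lt_min h0 !subr_gt0 ax.
  move=> y; rewrite !lt_min => /and3P[yh ya yb].
  rewrite -!fg ?(lt_trans a01 ax)//; first exact: Hh.
    by apply: lt_trans a01 _; move: ya; rewrite ltr_norml => /andP[+ _]; rewrite ltrBrDl opprB addrC subrK.
  by move: yb; rewrite ltr_norml => /andP[_]; rewrite ltrBlDr subrK.
rewrite -fg ?(lt_trans a01 ax)//; exact: dG.
Qed.

(** A quadratic bound on the remainder; such bounds, unlike differentiability,
    can be integrated. *)
Lemma has_deriv_quad f x d : (exists c h : R, 0 < h /\
  forall s, `|s| < h -> `|f (x + s) - f x - s *: d| <= c * s ^+ 2) -> has_deriv f x d.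
Proof.
move=> [c [h [h0 H]]] e e0.
have c0 : 0 < `|c| + 1 by rewrite ltr_wpDl.
exists (Num.min h (e / (`|c| + 1))); first by rewrite lt_min h0 divr_gt0.
move=> y; rewrite lt_min => /andP[yh ye].
have := H _ yh; rewrite [x + _]addrC subrK => /le_trans; apply.
apply: (@le_trans _ _ ((`|c| + 1) * `|y - x| * `|y - x|)).
  rewrite -[(y - x) ^+ 2]ger0_norm ?sqr_ge0// normrX expr2 mulrA.
  by rewrite !ler_wpM2r// (le_trans (ler_norm c))// lerDl.
by rewrite ler_wpM2r// mulrC -ler_pdivlMr// ltW.
Qed.

End VintRules.

Section Improper.
Context {R : realType} {E : completeNormedModType R}.
Implicit Types (f g : R -> E) (a b c k x y h : R).

Lemma has_deriv_expR k x : has_deriv (fun y => expR (k * y)) x (k * expR (k * x)).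
Proof.
have H := has_deriv_comp (has_deriv_lmul k x) (proj2 (has_derivP _ _ _) (is_derive_expR (k * x))).
exact: H.
Qed.

Lemma expR_small k e : 0 < k -> 0 < e -> forall b, (k * e)^-1 <= b -> expR (- k * b) <= e.
Proof.
move=> k0 e0 b kb; rewrite mulNr expRN -[e]invrK lef_pV2 ?posrE ?expR_gt0 ?invr_gt0//.
apply: le_trans (expR_ge1Dx _); apply: (@le_trans _ _ (k * b)); last by rewrite lerDr.
by move: kb; rewrite invfM -ler_pdivlMl ?invr_gt0// invrK.
Qed.

(** The class of integrands on a half-line for which all the improper integrals
    below exist: continuity on ]a0, +oo[ with a0 < a, exponential decay from
    a on. *)
Definition decaying a0 f a c k := [/\ a0 < a, 0 < k,
  forall x, a0 < x -> {for x, continuous f} &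
  forall x, a <= x -> `|f x| <= c * expR (- k * x)].

Definition vinf f a : E := lim (vint f a h @[h --> +oo]).

Lemma decaying_cont b a0 f a c k : decaying a0 f a c k -> continuous_on a0 b f.
Proof. by move=> [_ _ H _] x ax _; exact: H. Qed.

Lemma decaying_shift a0 f a b c k : a <= b -> decaying a0 f a c k -> decaying a0 f b c k.
Proof.
move=> ab [a0a k0 cf fc]; split=> //; first exact: lt_le_trans ab.
by move=> x bx; apply: fc; exact: le_trans bx.
Qed.

Lemma vint_decay a0 f a c k : decaying a0 f a c k -> forall h, a <= h ->
  `|vint f a h| <= c / k * expR (- k * a) - c / k * expR (- k * h).
Proof.
move=> H h ah; have [a0a k0 cf fc] := H.
have := @vint_norm _ _ a0 (h + 1) a h f (fun x => - (c / k) * expR (- k * x))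
  (fun x => c * expR (- k * x)) a0a ah _ (decaying_cont H).
rewrite !mulNr opprK [- _ + _]addrC; apply.
- by rewrite ltrDl.
- move=> x _ _.
  have := @has_derivZc R R^o (- (c / k)) _ _ _ (has_deriv_expR (- k) x).
  rewrite -[_ *: (_ * _)]/(- (c / k) * (- k * expR (- k * x))).
  rewrite (_ : - (c / k) * (- k * expR (- k * x)) = c * expR (- k * x)).
    by under eq_fun do rewrite /GRing.scale/= mulNr.
  by field; rewrite gt_eqF.
- by move=> x ax _; exact: fc.
Qed.

Lemma decaying_ge0 a0 f a c k : decaying a0 f a c k -> 0 <= c.
Proof.
move=> [_ _ _ fc]; have := le_trans (normr_ge0 _) (fc a (lexx _)).
by rewrite pmulr_lge0// expR_gt0.
Qed.

Lemma vinf_cvg a0 f a c k : decaying a0 f a c k -> cvg (vint f a h @[h --> +oo]).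
Proof.
move=> H; have [a0a k0 cf fc] := H; have c0 := decaying_ge0 H.
apply: cvg_oscillation => e e0.
have [b [ab bE]] : exists b, a <= b /\ c / k * expR (- k * b) <= e.
  pose k' := 1 + c / k; have k'0 : 0 < k' by rewrite ltr_wpDr// divr_ge0// ltW.
  have [b1 ab1 Hb] : exists2 b1, a <= b1 & (k * (e / k'))^-1 <= b1.
    by exists (Num.max a (k * (e / k'))^-1); rewrite le_max lexx ?orbT.
  exists b1; split=> //; have := expR_small k0 (divr_gt0 e0 k'0) Hb.
  rewrite ler_pdivlMr// mulrC; apply: le_trans.
  by rewrite ler_wpM2r ?expR_ge0// /k' lerDr.
exists [set h | b <= h]; first by apply: nbhs_pinfty_ge; exact: num_real.
suff W x y : b <= x -> x <= y -> `|vint f a y - vint f a x| <= e.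
  move=> x y /= bx by_; have [xy|/ltW yx] := leP x y; last exact: W.
  by rewrite distrC; exact: W.
move=> bx xy; have ax := le_trans ab bx.
have cxy : y < y + 1 by rewrite ltrDl.
rewrite (vint_add (decaying_cont H) a0a ax xy cxy) addrAC subrr add0r.
apply: le_trans (vint_decay (decaying_shift ax H) xy) _.
apply: le_trans bE; rewrite lerBlDr.
have e1 : expR (- k * x) <= expR (- k * b) by rewrite ler_expR !mulNr lerN2 ler_pM2l.
apply: (@le_trans _ _ (c / k * expR (- k * b))).
  by rewrite ler_wpM2l// divr_ge0// ltW.
by rewrite lerDl mulr_ge0 ?divr_ge0 ?expR_ge0// ltW.
Qed.

Lemma vinfE a0 f a c k : decaying a0 f a c k -> vint f a h @[h --> +oo] --> vinf f a.
Proof. by move/vinf_cvg. Qed.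

Lemma vinf_norm a0 f a c k : decaying a0 f a c k -> `|vinf f a| <= c / k * expR (- k * a).
Proof.
move=> H; have [a0a k0 cf fc] := H.
apply: (cvgr_to_le (cvg_norm (vinfE H))).
apply: filterS (nbhs_pinfty_ge (num_real a)) => h ah.
apply: le_trans (vint_decay H ah) _; rewrite gerBl.
by rewrite mulr_ge0 ?expR_ge0// divr_ge0 ?(ltW k0)// (decaying_ge0 H).
Qed.

Lemma vinf_eq a0 f a c k l : decaying a0 f a c k -> vint f a h @[h --> +oo] --> l -> vinf f a = l.
Proof. by move=> _; exact: cvg_lim. Qed.

(** The increments of F converge to l - F a. *)
Lemma vinf_FTC a0 a c k f F l : decaying a0 f a c k ->
  (forall x, a0 < x -> has_deriv F x (f x)) -> F h @[h --> +oo] --> l -> vinf f a = l - F a.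
Proof.
move=> H dF Fl; have [a0a k0 cf fc] := H; apply: (vinf_eq H).
apply: (@cvg_trans _ (F h - F a @[h --> +oo])); last by apply: cvgB => //; exact: cvg_cst.
apply: near_eq_cvg; apply: filterS (nbhs_pinfty_ge (num_real a)) => h ah /=.
apply: esym; apply: (@vint_FTC _ _ a0 (h + 1)) => //; first by rewrite ltrDl.
  exact: decaying_cont H.
by move=> x ax _; exact: dF.
Qed.

Lemma vinf_split a0 a b c k f : decaying a0 f a c k -> a <= b ->
  vinf f a = vint f a b + vinf f b.
Proof.
move=> H ab; have [a0a k0 cf fc] := H; apply: (vinf_eq H).
apply: (@cvg_trans _ (vint f a b + vint f b h @[h --> +oo])); last first.
  by apply: cvgD; [exact: cvg_cst|exact: vinfE (decaying_shift ab H)].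
apply: near_eq_cvg; apply: filterS (nbhs_pinfty_ge (num_real b)) => h bh /=.
apply: esym; apply: (@vint_add _ _ a0 (h + 1)) => //; last by rewrite ltrDl.
exact: decaying_cont H.
Qed.

Lemma decayingD a0 a c c' k f g : decaying a0 f a c k -> decaying a0 g a c' k ->
  decaying a0 (fun x => f x + g x) a (c + c') k.
Proof.
move=> [a0a k0 cf fc] [_ _ cg gc]; split=> // x ax.
  by apply: cvgD; [exact: cf|exact: cg].
by rewrite (le_trans (ler_normD _ _))// mulrDl lerD ?fc ?gc.
Qed.

Lemma decayingZ a0 a c k f (r : R) : decaying a0 f a c k ->
  decaying a0 (fun x => r *: f x) a (`|r| * c) k.
Proof.
move=> [a0a k0 cf fc]; split=> // x ax; first by apply: cvgZr; exact: cf.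
by rewrite normrZ -mulrA ler_wpM2l ?fc.
Qed.

Lemma decayingB a0 a c c' k f g : decaying a0 f a c k -> decaying a0 g a c' k ->
  decaying a0 (fun x => f x - g x) a (c + c') k.
Proof.
move=> [a0a k0 cf fc] [_ _ cg gc]; split=> // x ax.
  by apply: cvgB; [exact: cf|exact: cg].
by rewrite (le_trans (ler_normB _ _))// mulrDl lerD ?fc ?gc.
Qed.

Lemma vinfB a0 a c c' k f g : decaying a0 f a c k -> decaying a0 g a c' k ->
  vinf (fun x => f x - g x) a = vinf f a - vinf g a.
Proof.
move=> Hf Hg; apply: (vinf_eq (decayingB Hf Hg)).
apply: (@cvg_trans _ (vint f a h - vint g a h @[h --> +oo])); last first.
  by apply: cvgB; [exact: vinfE Hf|exact: vinfE Hg].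
apply: near_eq_cvg; apply: filterS (nbhs_pinfty_ge (num_real a)) => h ah /=.
have [a0a _ _ _] := Hf.
by apply: esym; apply: (@vintB _ _ a0 (h + 1)) => //;
  [rewrite ltrDl|exact: decaying_cont Hf|exact: decaying_cont Hg].
Qed.

Lemma vinfD a0 a c c' k f g : decaying a0 f a c k -> decaying a0 g a c' k ->
  vinf (fun x => f x + g x) a = vinf f a + vinf g a.
Proof.
move=> Hf Hg; apply: (vinf_eq (decayingD Hf Hg)).
apply: (@cvg_trans _ (vint f a h + vint g a h @[h --> +oo])); last first.
  by apply: cvgD; [exact: vinfE Hf|exact: vinfE Hg].
apply: near_eq_cvg; apply: filterS (nbhs_pinfty_ge (num_real a)) => h ah /=.
have [a0a _ _ _] := Hf.
by apply: esym; apply: (@vintD _ _ a0 (h + 1)) => //;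
  [rewrite ltrDl|exact: decaying_cont Hf|exact: decaying_cont Hg].
Qed.

Lemma lin_cvg {F : normedModType R} (L : E -> F) (k : R) :
  (forall u v, L (u - v) = L u - L v) -> (forall u, `|L u| <= k * `|u|) ->
  forall (T : Type) (G : set_system T) {FG : Filter G} (f : T -> E) l,
  f @ G --> l -> L (f x) @[x --> G] --> L l.
Proof.
move=> LB Lk T G FG f l /cvgrPdist_le fl; apply/cvgrPdist_le => e e0.
have k0 : 0 < `|k| + 1 by rewrite ltr_wpDl.
apply: filterS (fl (e / (`|k| + 1)) (divr_gt0 e0 k0)) => x H.
rewrite -LB (le_trans (Lk _))//.
apply: (@le_trans _ _ ((`|k| + 1) * `|l - f x|)).
  by rewrite ler_wpM2r// (le_trans (ler_norm k))// lerDl.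
by rewrite mulrC -ler_pdivlMr.
Qed.

Lemma vinf_lin {F : completeNormedModType R} (L : E -> F) (r : R) :
  (forall u v, L (u + v) = L u + L v) -> (forall (r : R) u, L (r *: u) = r *: L u) ->
  (forall u, `|L u| <= r * `|u|) ->
  forall a0 a c k f, decaying a0 f a c k ->
  lim (vint (fun x => L (f x)) a h @[h --> +oo]) = L (vinf f a).
Proof.
move=> LD LZ Lr a0 a c k f H.
have LB u v : L (u - v) = L u - L v by rewrite LD -[- v]scaleN1r LZ scaleN1r.
apply: cvg_lim => //.
apply: (@cvg_trans _ (L (vint f a h) @[h --> +oo])); last by have := lin_cvg LB Lr (vinfE H); apply.
have [a0a _ _ _] := H.
apply: near_eq_cvg; apply: filterS (nbhs_pinfty_ge (num_real a)) => h ah /=.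
by apply: esym; apply: (@vint_lin _ _ _ L r LD LZ Lr a0 (h + 1)) => //;
  [rewrite ltrDl|exact: decaying_cont H].
Qed.

Lemma vinfZ a0 a c k f (r : R) : decaying a0 f a c k ->
  vinf (fun x => r *: f x) a = r *: vinf f a.
Proof.
apply: (@vinf_lin _ (fun u => r *: u) `|r|) => [u v|s u|u].
- by rewrite scalerDr.
- by rewrite !scalerA mulrC.
- by rewrite normrZ.
Qed.

(** Differentiation under the integral sign: the quadratic remainder is uniform,
    so its integral is again quadratic. *)
Lemma vint_param (H : R -> R -> E) (H' : R -> E) t a0 b0 a b c (d : R) :
  a0 < a -> a <= b -> b < b0 -> 0 < d ->
  (forall s, `|s| < d -> continuous_on a0 b0 (H (t + s))) -> continuous_on a0 b0 H' ->
  (forall s x, `|s| < d -> a <= x -> x <= b -> `|H (t + s) x - H t x - s *: H' x| <= c * s ^+ 2) ->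
  has_deriv (fun t => vint (H t) a b) t (vint H' a b).
Proof.
move=> a0a ab bb0 d0 cH cH' Hq; apply: has_deriv_quad; exists (c * (b - a)), d; split=> // s sd.
have cHt : continuous_on a0 b0 (H t) by rewrite -[t]addr0; apply: cH; rewrite normr0.
have cHs := cH s sd.
rewrite -(vintB a0a ab bb0 cHs cHt) -(vintZ s a0a ab bb0 cH').
have cB : continuous_on a0 b0 (fun x => H (t + s) x - H t x).
  by move=> x ax xb; apply: cvgB; [exact: cHs|exact: cHt].
rewrite -(vintB a0a ab bb0 cB (continuous_onZ (k := s) cH')) mulrAC.
apply: (@vint_norm_cst _ _ a0 b0) => //.
  by move=> x ax xb; apply: cvgB; [exact: cB|apply: continuous_onZ cH' x ax xb].
by move=> x ax xb; exact: Hq.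
Qed.

(** The improper case needs a remainder that decays like the integrands. *)
Lemma vinf_param (H : R -> R -> E) (H' : R -> E) t a0 a c1 c2 c k (d : R) : 0 < d ->
  (forall s, `|s| < d -> decaying a0 (H (t + s)) a c1 k) -> decaying a0 H' a c2 k ->
  (forall s x, `|s| < d -> a <= x -> `|H (t + s) x - H t x - s *: H' x| <= c * expR (- k * x) * s ^+ 2) ->
  has_deriv (fun t => vinf (H t) a) t (vinf H' a).
Proof.
move=> d0 dH dH' Hq; apply: has_deriv_quad.
exists (c / k * expR (- k * a)), d; split=> // s sd.
have dHt : decaying a0 (H t) a c1 k by rewrite -[t]addr0; apply: dH; rewrite normr0.
have dHs := dH s sd.
have D1 := decayingB dHs dHt; have D2 := decayingZ s dH'.
rewrite -(vinfB dHs dHt) -(vinfZ s dH') -(vinfB D1 D2).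
have D : decaying a0 (fun x => H (t + s) x - H t x - s *: H' x) a (c * s ^+ 2) k.
  have [a0a k0 cf _] := decayingB D1 D2; split=> // x ax.
  by rewrite mulrAC; exact: Hq.
apply: le_trans (vinf_norm D) _; rewrite le_eqVlt; apply/orP; left; apply/eqP.
by ring.
Qed.

End Improper.

(** * Complex slices of the algebra *)

Section Slices.
Context {R : realType} {K : starAlgebra R}.
Implicit Types (a j : K) (z w : R[i]) (r x y rho theta : R).

Definition cbar z : R[i] := Complex (complex.Re z) (- complex.Im z).

(** The unit of the algebra is not 0, so R embeds. *)
Lemma algE r s : r%:A = s%:A :> K -> r = s.
Proof.
move/eqP; rewrite -subr_eq0 -scalerBl scaler_eq0 oner_eq0 orbF subr_eq0.
by move/eqP.
Qed.

Lemma alg_mul r s : r%:A * s%:A = (r * s)%:A :> K.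
Proof. by rewrite -scalerAl mul1r scalerA. Qed.

Lemma sa_conjD a b : sa_conj (a + b) = sa_conj a + sa_conj b :> K.
Proof. by rewrite -[a]scale1r sa_conj_linear !scale1r. Qed.

Lemma sa_conj0 : sa_conj (0 : K) = 0.
Proof. by rewrite -(scale0r (1 : K)) sa_conj_real. Qed.

Lemma sa_conjZ r a : sa_conj (r *: a) = r *: sa_conj a :> K.
Proof. by rewrite -[r *: a]addr0 sa_conj_linear sa_conj0 addr0. Qed.

Section Unit.
Variables (j : K) (jP : SA j).

Lemma unit_sqr : j * j = -1. Proof. by have [] := jP. Qed.

Lemma unit_sqrA : j * j = (-1)%:A. Proof. by rewrite scaleN1r unit_sqr. Qed.

Lemma unit_not_real r : j <> r%:A.
Proof.
move=> jE; have := unit_sqr; rewrite jE alg_mul -[-1]scaleN1r => /algE E.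
by have := sqr_ge0 r; rewrite expr2 E oppr_ge0 ler10.
Qed.

(** As j is not real, t(j) = j + c(j) and n(j) are real; then
    n(j) = t(j) j - j^2 = t(j) j + 1 forces t(j) = 0. *)
Lemma unit_conj : sa_conj j = - j.
Proof.
have [[[r /unit_not_real//]|[t [n [tE nE _]]]] jj] := jP.
have cE : sa_conj j = t%:A - j by rewrite -tE; module R.
(* j c(j) with c(j) = t - j *)
have E : n%:A = t *: j + 1.
  by rewrite -nE cE mulrBr jj opprK -scalerAr mulr1.
have [t0|t0] := eqVneq t 0; first by rewrite cE t0 scale0r sub0r.
case: (@unit_not_real (t^-1 * (n - 1))).
rewrite -scalerA scalerBl E scale1r addrK scalerA mulVf// scale1r.
by [].
Qed.

Lemma sliceD z w : slice j (z + w) = slice j z + slice j w.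
Proof. by case: z w => [a b] [c d]; rewrite /slice/=; module R. Qed.

Lemma sliceN z : slice j (- z) = - slice j z.
Proof. by case: z => [a b]; rewrite /slice/=; module R. Qed.

Lemma slice_real r : slice j (Complex r 0) = r%:A.
Proof. by rewrite /slice/= scale0r addr0. Qed.

Lemma sliceM z w : slice j (z * w) = slice j z * slice j w.
Proof.
case: z w => [a b] [c d]; rewrite /slice/= !(mulrDl, mulrDr).
rewrite -!(scalerAl, scalerAr) !mul1r ?mulr1 unit_sqrA !scalerA.
by moduleu R.
Qed.

Lemma slice_conj z : sa_conj (slice j z) = slice j (cbar z).
Proof. by rewrite /slice sa_conjD sa_conj_real sa_conjZ unit_conj/=; module R. Qed.

Lemma slice_invi : slice j (Complex 0 (-1)) = j^-1.
Proof.
rewrite /slice/= scale0r add0r scaleN1r.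
have jU : j \is a GRing.unit.
  by apply/unitrP; exists (- j); rewrite mulNr mulrN unit_sqr opprK.
by apply: (mulrI jU); rewrite divrr// mulrN unit_sqr opprK.
Qed.

Lemma mul_cbar z : z * cbar z = Complex (complex.Re z ^+ 2 + complex.Im z ^+ 2) 0.
Proof.
case: z => a b; rewrite /cbar/=; apply/eqP; rewrite eq_complex/=; apply/andP; split; apply/eqP; ring.
Qed.

Lemma add_cbar z : z + cbar z = Complex (2 * complex.Re z) 0.
Proof.
case: z => a b; rewrite /cbar/=; apply/eqP; rewrite eq_complex/=; apply/andP; split; apply/eqP; ring.
Qed.

(** On a slice, t(a) = 2 Re z and n(a) = |z|^2, with discriminant
    - 4 (Im z)^2. *)
Lemma slice_QA z : QA (slice j z).
Proof.
have [y0|y0] := eqVneq (complex.Im z) 0.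
  by left; exists (complex.Re z); rewrite /slice y0 scale0r addr0.
right; exists (2 * complex.Re z), (complex.Re z ^+ 2 + complex.Im z ^+ 2); split.
- by rewrite slice_conj -sliceD add_cbar slice_real.
- by rewrite slice_conj -sliceM mul_cbar slice_real.
- rewrite (_ : _ - _ = - (4 * complex.Im z ^+ 2)); last by ring.
  by rewrite oppr_lt0 mulr_gt0// exprn_even_gt0.
Qed.

Lemma slice_norm z : sa_norm (slice j z) = Normc.normc z.
Proof.
rewrite (@sa_norm_cone _ _ _ (complex.Re z ^+ 2 + complex.Im z ^+ 2) (slice_QA z)).
  by case: z.
by rewrite slice_conj -sliceM mul_cbar slice_real.
Qed.

Lemma slice_ReA z : ReA (slice j z) = (complex.Re z)%:A.
Proof. by rewrite /ReA slice_conj -sliceD add_cbar slice_real scalerA mulrA mulVf ?mul1r// pnatr_eq0. Qed.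

Lemma unitN : SA (- j).
Proof.
split; last by rewrite mulrNN unit_sqr.
by have := slice_QA (Complex 0 (-1)); rewrite /slice/= scale0r add0r scaleN1r.
Qed.

(** The slices of j and - j coincide, with conjugate coordinates; this lets one
    assume nonnegative arguments. *)
Lemma sliceNj z : slice (- j) z = slice j (cbar z).
Proof. by rewrite /slice/= scalerN scaleNr. Qed.

End Unit.

Lemma polarM rho theta rho' theta' :
  polar rho theta * polar rho' theta' = polar (rho * rho') (theta + theta') :> R[i].
Proof.
rewrite /polar; apply/eqP; rewrite eq_complex/= cosD sinD.
by apply/andP; split; apply/eqP; ring.
Qed.

Lemma polar_cbar rho theta : cbar (polar rho theta) = polar rho (- theta).
Proof. by rewrite /polar/cbar/= cosN sinN mulrN. Qed.

Lemma normc_polar rho theta : 0 <= rho -> Normc.normc (polar rho theta) = rho.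
Proof.
move=> r0; rewrite /polar/= !exprMn -mulrDr cos2Dsin2 mulr1 sqrtr_sqr ger0_norm//.
Qed.

Lemma normc_cexp z : Normc.normc (cexp z) = expR (complex.Re z).
Proof. by rewrite normc_polar// expR_ge0. Qed.

Lemma cexp_cbar z : cexp (cbar z) = cbar (cexp z).
Proof. by rewrite /cexp polar_cbar. Qed.

(** An argument of a is determined by t(a) = 2 |a| cos(arg a), since cos is
    injective on [0, pi]. *)
Lemma is_argP a theta : is_arg a theta -> [/\ 0 <= theta, theta <= pi, 0 < sa_norm a &
  a + sa_conj a = (2 * sa_norm a * cos theta)%:A].
Proof.
have [j jP] := @sa_units_neq0 _ K.
have nrm x : sa_norm (x%:A : K) = `|x|.
  rewrite -(slice_real j) (slice_norm jP)/= expr0n/= addr0.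
  by rewrite sqrtr_sqr.
case=> [[-> [x x0 ->]]|[-> [x x0 ->]]|[t0 tpi [k [rho [kP rho0 ->]]]]].
- rewrite nrm gtr0_norm// cos0 mulr1 sa_conj_real lexx pi_ge0; split=> //.
  by rewrite -scalerDl mulr_natl mulr2n.
- rewrite nrm ltr0_norm// cospi sa_conj_real lexx pi_ge0 oppr_gt0; split=> //.
  by rewrite -scalerDl mulrN1 mulrN opprK mulr_natl mulr2n.
- rewrite (slice_norm kP) normc_polar ?(ltW rho0)//; split=> //; try exact: ltW.
  by rewrite slice_conj// -sliceD add_cbar slice_real/= mulrA.
Qed.

Lemma argAE a theta : is_arg a theta -> argA a = theta.
Proof.
move=> at1; apply: xget_unique => //= t' at2.
have [t0 tp n0 E1] := is_argP at1; have [t0' tp' _ E2] := is_argP at2.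
have n20 : 2 * sa_norm a != 0 by rewrite mulf_neq0// ?pnatr_eq0// gt_eqF.
apply: cos_inj; rewrite ?in_itv/= ?t0 ?t0'//.
by apply: (mulfI n20); apply: algE; rewrite -E1 -E2.
Qed.

(** Points with negative argument are points with positive argument in the
    slice of - j. *)
Lemma Sigma_slice (delta : R) j rho theta : delta < pi / 2 -> SA j -> 0 < rho ->
  `|theta| < pi / 2 + delta -> Sigma delta (slice j (polar rho theta)).
Proof.
move=> dpi jP rho0; wlog t0 : j jP theta / 0 <= theta => [H|].
  have [t0|t0] := leP 0 theta; first exact: H.
  move=> tb; have := H (- j) (unitN jP) (- theta).
  rewrite sliceNj polar_cbar opprK normrN oppr_ge0 (ltW t0); exact.
rewrite ger0_norm// => td.
have tpi : theta < pi by apply: lt_trans td _; rewrite [ltRHS]splitr ltrD2l.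
have arg : is_arg (slice j (polar rho theta)) theta.
  have [t00|tn0] := eqVneq theta 0; last first.
    by apply: Or33; split=> //; [rewrite lt_neqAle eq_sym tn0|exists j, rho].
  apply: Or31; split=> //; exists rho => //.
  by rewrite t00 /polar cos0 sin0 mulr1 mulr0 slice_real.
split.
- exact: slice_QA.
- apply/eqP => E; have [_ _] := is_argP arg; rewrite E.
  have -> : sa_norm (0 : K) = 0 by rewrite -(scale0r (0 : K)) sa_normZ normr0 mul0r.
  by rewrite ltxx.
- by rewrite (argAE arg).
Qed.

End Slices.

(** * The Banach algebra of bounded right linear operators *)

Section BoundedOperatorSpace.
Context {R : realType} {K : starAlgebra R} {X : banachBimodule K}.
Implicit Types (B C : Lr X) (u v : X) (a b : K) (r : R).

Lemma ract0l a : ract (0 : X) a = 0.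
Proof. by apply: (addIr (ract 0 a)); rewrite -ractDl !add0r. Qed.

Lemma lact_scale r a u : lact (r *: a) u = r *: lact a u :> X.
Proof. by rewrite -lact_real lactA -scalerAl mul1r. Qed.

Lemma LrD B u v : B (u + v) = B u + B v. Proof. by have [] := Lr_brl B. Qed.

Lemma Lr_ractE B u a : B (ract u a) = ract (B u) a. Proof. by have [] := Lr_brl B. Qed.

Lemma LrZ B r u : B (r *: u) = r *: B u.
Proof. by rewrite -!ract_real Lr_ractE. Qed.

Lemma Lr0 B : B 0 = 0. Proof. exact: brl0 (Lr_brl B). Qed.

Lemma LrN B u : B (- u) = - B u.
Proof. by rewrite -scaleN1r LrZ scaleN1r. Qed.

Lemma LrB B u v : B (u - v) = B u - B v.
Proof. by rewrite LrD LrN. Qed.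

Lemma Lr_le B u : `|B u| <= `|B| * `|u|.
Proof. exact: brl_bound (Lr_brl B) u. Qed.

Lemma Lr_norm_le B r : 0 <= r -> (forall u, `|B u| <= r * `|u|) -> `|B| <= r.
Proof. by move=> r0 H; have [D ra _] := Lr_brl B; have [] := brlP D ra r0 H. Qed.

Lemma Lr_eq B C : (forall u, B u = C u) -> B = C.
Proof. by move=> H; apply/val_inj/funext. Qed.

Lemma LraddE B C u : (B + C) u = B u + C u. Proof. by []. Qed.
Lemma LroppE B u : (- B) u = - B u. Proof. by []. Qed.
Lemma LrscaleE r B u : (r *: B) u = r *: B u. Proof. by []. Qed.
Lemma to_LrE (f : X -> X) : bounded_right_linear f -> to_Lr f = f :> (X -> X).
Proof. by move=> fb; rewrite /to_Lr; apply: (@insubdK _ _ (Lr X)); apply/asboolP. Qed.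

Fact Lr_comp_subproof B C : (B \o C) \in @brl_pred R K X.
Proof.
apply/asboolP.
apply: (proj1 (@brlP R K X (B \o C) _ _ (`|B| * `|C|) _ _)) => [u v|u a||u] /=.
- by rewrite !LrD.
- by rewrite !Lr_ractE.
- exact: mulr_ge0.
- by rewrite (le_trans (Lr_le _ _))// -mulrA ler_wpM2l// Lr_le.
Qed.

Definition Lr_comp B C : Lr X := MkLr (Lr_comp_subproof B C).

Lemma Lr_compE B C u : Lr_comp B C u = B (C u). Proof. by []. Qed.

Lemma Lr_comp_norm B C : `|Lr_comp B C| <= `|B| * `|C|.
Proof.
apply: Lr_norm_le => [|u]; first exact: mulr_ge0.
by rewrite /= (le_trans (Lr_le _ _))// -mulrA ler_wpM2l// Lr_le.
Qed.

Lemma Lr_compDl B B' C : Lr_comp (B + B') C = Lr_comp B C + Lr_comp B' C.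
Proof. exact: Lr_eq. Qed.

Lemma Lr_compDr B C C' : Lr_comp B (C + C') = Lr_comp B C + Lr_comp B C'.
Proof. by apply: Lr_eq => u; rewrite Lr_compE !LraddE LrD. Qed.

Lemma Lr_compZl r B C : Lr_comp (r *: B) C = r *: Lr_comp B C.
Proof. exact: Lr_eq. Qed.

Lemma Lr_compZr r B C : Lr_comp B (r *: C) = r *: Lr_comp B C.
Proof. by apply: Lr_eq => u; rewrite Lr_compE !LrscaleE LrZ. Qed.

Lemma Lr_actE B a u : Lr_ract B a u = B (lact a u). Proof. by []. Qed.

Lemma Lr_actD B C a : Lr_ract (B + C) a = Lr_ract B a + Lr_ract C a.
Proof. exact: Lr_eq. Qed.

Lemma Lr_actN B a : Lr_ract (- B) a = - Lr_ract B a.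
Proof. exact: Lr_eq. Qed.

Lemma Lr_actZ r B a : Lr_ract (r *: B) a = r *: Lr_ract B a.
Proof. exact: Lr_eq. Qed.

Lemma Lr_actDr B a b : Lr_ract B (a + b) = Lr_ract B a + Lr_ract B b.
Proof. by apply: Lr_eq => u; rewrite LraddE !Lr_actE lactDl LrD. Qed.

Lemma Lr_actZr r B a : Lr_ract B (r *: a) = r *: Lr_ract B a.
Proof. by apply: Lr_eq => u; rewrite LrscaleE !Lr_actE lact_scale LrZ. Qed.

Lemma Lr_actA B a b : Lr_ract (Lr_ract B a) b = Lr_ract B (a * b).
Proof. by apply: Lr_eq => u; rewrite !Lr_actE lactA. Qed.

Lemma Lr_act_real r B : Lr_ract B r%:A = r *: B.
Proof. by apply: Lr_eq => u; rewrite LrscaleE Lr_actE lact_real LrZ. Qed.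

Lemma Lr_act_norm B a : `|Lr_ract B a| <= sa_norm a * `|B|.
Proof.
apply: Lr_norm_le => [|u]; first by rewrite mulr_ge0// sa_norm_ge0.
rewrite Lr_actE (le_trans (Lr_le _ _))// [sa_norm a * _]mulrC -mulrA ler_wpM2l//.
exact: lact_norm_le.
Qed.

(** Pointwise limits of bounded right linear operators along a Cauchy filter
    are additive, right linear and bounded, and the convergence is in norm,
    because the Cauchy estimates are uniform on vectors of bounded norm. *)
Lemma Lr_complete (F : set_system (Lr X)) : ProperFilter F -> cauchy F -> cvg F.
Proof.
move=> FF FC.
have near_point (e : R) : 0 < e -> exists B0 : Lr X, F [set B | forall u, `|B u - B0 u| <= e * `|u|].
  move=> e0; have [B0 FB0] := (cauchyP F).1 FC e e0; exists B0.
  apply: filterS FB0 => B; rewrite -ball_normE /ball_ /= distrC => /ltW BB u.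
  by apply: le_trans (Lr_le (B - B0) u) _; rewrite ler_wpM2r.
have cv u : cvg ((fun B : Lr X => B u) @ F).
  apply: cvg_oscillation => e e0.
  have k0 : 0 < `|u| + 1 by rewrite ltr_wpDl.
  have e'0 : 0 < e / 2 / (`|u| + 1) by rewrite !divr_gt0.
  have [B0 FB0] := near_point _ e'0.
  exists [set B : Lr X | forall v, `|B v - B0 v| <= e / 2 / (`|u| + 1) * `|v|] => //.
  have le2 : e / 2 / (`|u| + 1) * `|u| <= e / 2.
    by rewrite mulrAC ler_pdivrMr// ler_pM2l ?divr_gt0// lerDl.
  move=> B C /= /(_ u) HB /(_ u) HC; rewrite [e]splitr -[B u - C u](subrKA (B0 u)).
  apply: le_trans (ler_normD _ _) _; apply: lerD; first exact: le_trans HB le2.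
  by rewrite distrC; exact: le_trans HC le2.
pose L u := lim ((fun B : Lr X => B u) @ F).
have LE u : (fun B : Lr X => B u) @ F --> L u by exact: cv.
have LD u v : L (u + v) = L u + L v.
  apply: cvg_lim => //; under eq_fun do rewrite LrD; exact: (cvgD (LE u) (LE v)).
have Lra u a : L (ract u a) = ract (L u) a.
  apply: cvg_lim => //; under eq_fun do rewrite Lr_ractE.
  apply: (@lin_cvg R X X (fun u => ract u a) (sa_norm a)) => // [v w|v].
    rewrite ractDl; congr (_ + _); apply: (addIr (ract w a)).
    by rewrite -ractDl !addNr ract0l.
  exact: ract_norm_le.
have Lnear (e : R) : 0 < e -> exists B0 : Lr X,
    F [set B | forall u, `|B u - B0 u| <= e * `|u|] /\ forall u, `|L u - B0 u| <= e * `|u|.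
  move=> e0; have [B0 FB0] := near_point e e0; exists B0; split=> // u.
  have : `|B u - B0 u| @[B --> F] --> `|L u - B0 u|.
    by apply: cvg_norm; apply: (cvgB (LE u) (cvg_cst _)).
  move/cvgr_to_le; apply.
  by apply: filterS FB0 => B; exact.
have Lb : bounded_right_linear L.
  have [B0 [_ H]] := Lnear 1 ltr01.
  apply: (proj1 (@brlP R K X L LD Lra (1 + `|B0|) _ _)) => [|u]; first by rewrite addr_ge0.
  rewrite -[L u](subrK (B0 u)) (le_trans (ler_normD _ _))// mulrDl lerD//.
  exact: Lr_le.
apply/cvg_ex; exists (to_Lr L); apply/cvgrPdist_le => e e0.
have e20 : 0 < e / 2 by rewrite divr_gt0.
have [B0 [FB0 H]] := Lnear _ e20; apply: filterS FB0 => B HB.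
apply: Lr_norm_le => [|u]; first exact: ltW.
rewrite LraddE LroppE to_LrE// -[L u - B u](subrKA (B0 u)) [e]splitr mulrDl.
apply: le_trans (ler_normD _ _) _; apply: lerD => //.
by rewrite distrC.
Qed.

HB.instance Definition _ := Uniform_isComplete.Build (Lr X) Lr_complete.

End BoundedOperatorSpace.

(** * Spherical resolvents on a slice *)

Section OperatorAlgebra.
Context {R : realType} {K : starAlgebra R} {X : banachBimodule K}
  (A : rightOperator X).
Implicit Types (u v : X) (r : R).

Lemma ro_domN u : ro_dom A u -> ro_dom A (- u).
Proof. by move=> du; rewrite -sub0r; apply: ro_domB => //; exact: ro_dom0. Qed.

Lemma ro_domD u v : ro_dom A u -> ro_dom A v -> ro_dom A (u + v).
Proof. by move=> du dv; rewrite -[v]opprK; apply: ro_domB => //; exact: ro_domN. Qed.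

Lemma ro_domZ r u : ro_dom A u -> ro_dom A (r *: u).
Proof. by move=> du; rewrite -ract_real; exact: ro_dom_ract. Qed.

Lemma roZ r u : ro_dom A u -> A (r *: u) = r *: A u.
Proof. by move=> du; rewrite -!ract_real ro_ract. Qed.

Lemma roD u v : ro_dom A u -> ro_dom A v -> A (u + v) = A u + A v.
Proof. exact: ro_additive. Qed.

Lemma roN u : ro_dom A u -> A (- u) = - A u.
Proof. by move=> du; rewrite -scaleN1r roZ// scaleN1r. Qed.

Lemma roB u v : ro_dom A u -> ro_dom A v -> A (u - v) = A u - A v.
Proof. by move=> du dv; rewrite roD ?roN//; exact: ro_domN. Qed.

End OperatorAlgebra.

Lemma normc_sqr {R : rcfType} (z : R[i]) : Normc.normc z ^+ 2 = complex.Re z ^+ 2 + complex.Im z ^+ 2.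
Proof. by case: z => a b /=; rewrite sqr_sqrtr// addr_ge0// sqr_ge0. Qed.

Lemma normc_ge0 {R : rcfType} (z : R[i]) : 0 <= Normc.normc z.
Proof. by case: z => a b /=; rewrite sqrtr_ge0. Qed.

Lemma normc_cbar {R : realType} (z : R[i]) : Normc.normc (cbar z) = Normc.normc z.
Proof. by case: z => a b /=; rewrite sqrrN. Qed.

Lemma normc_Re {R : rcfType} (z : R[i]) : `|complex.Re z| <= Normc.normc z.
Proof.
by case: z => a b /=; rewrite -sqrtr_sqr ler_wsqrtr// lerDl sqr_ge0.
Qed.

Lemma normc_Im {R : rcfType} (z : R[i]) : `|complex.Im z| <= Normc.normc z.
Proof.
by case: z => a b /=; rewrite -sqrtr_sqr ler_wsqrtr// lerDr sqr_ge0.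
Qed.

Section Resolvent.
Context {R : realType} {K : starAlgebra R} {X : banachBimodule K}.
Variables (A : rightOperator X) (delta M : R).
Hypothesis delta_lt : delta < pi / 2.
Hypothesis A_sectorial : spherical_sectorial delta A.
Hypothesis M_gt0 : 0 < M.
Hypothesis C_bound : forall a : K, Sigma delta a ->
  (opnorm (Cres A a) <= (M / sa_norm a)%:E)%E.

Definition sector (z : R[i]) := exists rho theta : R,
  [/\ 0 < rho, `|theta| < pi / 2 + delta & z = polar rho theta].

Lemma sector_cbar z : sector z -> sector (cbar z).
Proof. by move=> [r [t [r0 td ->]]]; exists r, (- t); rewrite normrN polar_cbar. Qed.

Lemma sector_normc z : sector z -> 0 < Normc.normc z.
Proof. by move=> [r [t [r0 td ->]]]; rewrite normc_polar// ltW. Qed.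

Section Point.
Variables (j : K) (jP : SA j).
Implicit Types (z w : R[i]).

(** With z the coordinate of a in the slice of j, these are Q_a, C_a and A Q_a.
    [Pz - i Yz] is formally (z - A)^-1, of which [Kz z w] is the imaginary part
    after multiplication by w. *)
Definition Qz z : Lr X := to_Lr (Qres A (slice j z)).
Definition Cz z : Lr X := to_Lr (Cres A (slice j z)).
Definition Sz z : Lr X := Lr_ract (Qz z) (slice j (cbar z)) - Cz z.
Definition Pz z : Lr X := complex.Re z *: Qz z - Sz z.
Definition Yz z : Lr X := complex.Im z *: Qz z.
Definition Kz z w : Lr X := complex.Im w *: Pz z - complex.Re w *: Yz z.

Lemma sector_Sigma z : sector z -> Sigma delta (slice j z).
Proof. by move=> [r [t [r0 td ->]]]; exact: Sigma_slice. Qed.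

Lemma sector_res z : sector z -> spherical_resolvent_set A (slice j z).
Proof. by have [_ _ H] := A_sectorial => /sector_Sigma/H. Qed.

Lemma DeltaE z u : Delta A (slice j z) u =
  A (A u) - (2 * complex.Re z) *: A u + (complex.Re z ^+ 2 + complex.Im z ^+ 2) *: u.
Proof. by rewrite /Delta slice_ReA// scalerA lact_real slice_norm// normc_sqr. Qed.

Variable z : R[i].
Hypothesis zS : sector z.
Local Notation x := (complex.Re z).
Local Notation y := (complex.Im z).

Lemma QzE : Qz z = Qres A (slice j z) :> (X -> X).
Proof. by apply: to_LrE; have [] := sector_res zS. Qed.

Lemma Qz_dom2 u : ro_dom2 A (Qz z u).
Proof.
rewrite QzE; have [_ bij _] := sector_res zS.
by have [+ _ _] := bijpinv_bij (fun=> 0) bij; exact.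
Qed.

Lemma Qz_dom u : ro_dom A (Qz z u). Proof. by have [] := Qz_dom2 u. Qed.
Lemma AQz_dom u : ro_dom A (A (Qz z u)). Proof. by have [] := Qz_dom2 u. Qed.

(** Delta_a Q_a = 1, solved for A^2 Q_a; as Delta_a has real coefficients, this is
    the quadratic equation of z for A. *)
Lemma AAQz u : A (A (Qz z u)) = u + (2 * x) *: A (Qz z u) - (x ^+ 2 + y ^+ 2) *: Qz z u.
Proof.
have [_ [_ _ surj] _] := sector_res zS.
have := surjpK (fun=> 0) surj (x := u); rewrite inE => /(_ I).
rewrite -/(Qres A (slice j z) u) -QzE DeltaE => E; rewrite -[X in _ = X + _ - _]E.
by module R.
Qed.

Lemma Qz_left v : ro_dom2 A v ->
  Qz z (A (A v) - (2 * x) *: A v + (x ^+ 2 + y ^+ 2) *: v) = v.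
Proof.
move=> dv; rewrite -DeltaE QzE; have [_ [_ inj _] _] := sector_res zS.
by apply: pinvKV => //; rewrite inE.
Qed.

(** A v = Delta (A Q v), and Q is a left inverse of Delta on the domain of A^2. *)
Lemma Qz_A v : ro_dom A v -> Qz z (A v) = A (Qz z v).
Proof.
move=> dv; have Aq := AQz_dom v; have q := Qz_dom v.
have dAA : ro_dom A (A (A (Qz z v))).
  rewrite AAQz; apply: ro_domB; last exact: ro_domZ.
  by apply: ro_domD => //; exact: ro_domZ.
have E : A v = A (A (A (Qz z v))) - (2 * x) *: A (A (Qz z v)) + (x ^+ 2 + y ^+ 2) *: A (Qz z v).
  rewrite (congr1 A (AAQz v)) roB ?roD ?roZ//; do ?[exact: ro_domZ | apply: ro_domD => //; exact: ro_domZ].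
  by module R.
by rewrite {1}E Qz_left.
Qed.

Lemma CresE u : Cres A (slice j z) u = Qz z (lact (slice j (cbar z)) u) - A (Qz z u).
Proof. by rewrite /Cres QzE slice_conj. Qed.

Lemma Cres_brl : bounded_right_linear (Cres A (slice j z)).
Proof.
have CE u : Cres A (slice j z) u = Qz z (lact (slice j (cbar z)) u) - A (Qz z u) := CresE u.
have CD u v : Cres A (slice j z) (u + v) = Cres A (slice j z) u + Cres A (slice j z) v.
  by rewrite !CE lactDr !LrD roD; [module R|exact: Qz_dom..].
split=> // [u a|].
  rewrite !CE lractA !Lr_ractE ro_ract; last exact: Qz_dom.
  by apply: (addIr (ract (A (Qz z u)) a)); rewrite subrK -ractDl subrK.
by apply: le_lt_trans (C_bound (sector_Sigma zS)) _; exact: ltry.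
Qed.

Lemma CzE u : Cz z u = Qz z (lact (slice j (cbar z)) u) - A (Qz z u).
Proof. by rewrite -CresE /Cz to_LrE//; exact: Cres_brl. Qed.

Lemma Cz_res : Cz z = Cres A (slice j z) :> (X -> X).
Proof. by rewrite /Cz to_LrE//; exact: Cres_brl. Qed.

Lemma SzE u : Sz z u = A (Qz z u).
Proof. by rewrite LraddE LroppE CzE Lr_actE; module R. Qed.

Lemma PzE u : Pz z u = x *: Qz z u - A (Qz z u).
Proof. by rewrite LraddE LroppE SzE. Qed.

Lemma YzE u : Yz z u = y *: Qz z u. Proof. by []. Qed.

Lemma Pz_dom u : ro_dom A (Pz z u).
Proof. by rewrite PzE; apply: ro_domB; [apply: ro_domZ; exact: Qz_dom|exact: AQz_dom]. Qed.

Lemma Yz_dom u : ro_dom A (Yz z u).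
Proof. by rewrite YzE; apply: ro_domZ; exact: Qz_dom. Qed.

(** Together with [AYz]: A (P - i Y) = z (P - i Y) - 1 in real and imaginary
    parts. *)
Lemma APz u : A (Pz z u) = x *: Pz z u + y *: Yz z u - u.
Proof.
rewrite PzE roB; [|apply: ro_domZ; exact: Qz_dom|exact: AQz_dom].
by rewrite roZ ?AAQz ?YzE; [module R|exact: Qz_dom].
Qed.

Lemma AYz u : A (Yz z u) = x *: Yz z u - y *: Pz z u.
Proof. by rewrite YzE roZ ?PzE; [module R|exact: Qz_dom]. Qed.

Lemma CzPY : Cz z = Pz z - Lr_ract (Yz z) j.
Proof.
apply: Lr_eq => u; rewrite CzE LraddE LroppE PzE Lr_actE YzE /slice/=.
by rewrite lactDl lact_real lact_scale LrD !LrZ; module R.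
Qed.

Lemma KzE w u : Kz z w u = complex.Im w *: Pz z u - complex.Re w *: Yz z u.
Proof. by []. Qed.

Lemma Kz_dom w u : ro_dom A (Kz z w u).
Proof.
rewrite KzE.
by apply: ro_domB; apply: ro_domZ; [exact: Pz_dom|exact: Yz_dom].
Qed.

(** The imaginary part of A (z - A)^-1 w = (z - A)^-1 (z w) - w. *)
Lemma AKz w u : A (Kz z w u) = Kz z (z * w) u - complex.Im w *: u.
Proof.
rewrite !KzE roB; [|apply: ro_domZ; exact: Pz_dom|apply: ro_domZ; exact: Yz_dom].
rewrite (roZ _ (Pz_dom u)) (roZ _ (Yz_dom u)) APz AYz.
move: (Pz z u) (Yz z u) => p q.
by case: (z) w => [a b] [c d] /=; module R.
Qed.

Lemma Cz_norm : `|Cz z| <= M / Normc.normc z.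
Proof.
have M0 : 0 <= M / Normc.normc z by rewrite divr_ge0 ?normc_ge0// ltW.
have := C_bound (sector_Sigma zS); rewrite slice_norm// -Cz_res => H.
by apply: Lr_norm_le => //; apply/opnorm_leP => //; exact: Lr0.
Qed.

Section Commuting.
Variable L : Lr X.
Hypothesis L_dom : forall u, ro_dom A u -> ro_dom A (L u).
Hypothesis L_comm : forall u, ro_dom A u -> A (L u) = L (A u).

Lemma Qz_comm u : Qz z (L u) = L (Qz z u).
Proof.
have dq := Qz_dom u; have dAq := AQz_dom u.
have E : A (A (L (Qz z u))) - (2 * x) *: A (L (Qz z u)) + (x ^+ 2 + y ^+ 2) *: L (Qz z u) = L u.
  rewrite !L_comm// ?AAQz//; rewrite !LrB !LrD !LrZ; module R.
rewrite -[in LHS]E Qz_left//; split; first exact: L_dom.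
by rewrite L_comm//; exact: L_dom.
Qed.

Lemma Pz_comm u : Pz z (L u) = L (Pz z u).
Proof. by rewrite !PzE Qz_comm (L_comm (Qz_dom u)) LrB LrZ. Qed.

Lemma Yz_comm u : Yz z (L u) = L (Yz z u).
Proof. by rewrite !YzE Qz_comm LrZ. Qed.

Lemma Kz_comm w u : Kz z w (L u) = L (Kz z w u).
Proof. by rewrite !KzE Pz_comm Yz_comm [RHS]LrB (LrZ L (complex.Im w)) (LrZ L (complex.Re w)). Qed.

End Commuting.

(** The square of the absolute value of (z - A)^-1, that is Q.  It bounds Q in terms
    of P and Y. *)
Lemma PP_YY u : Pz z (Pz z u) + Yz z (Yz z u) = Qz z u.
Proof.
have dQ v := Qz_dom v; have dAQ v := AQz_dom v.
rewrite !PzE !YzE !LrB !LrZ (Qz_A (dQ u)) roB ?roZ//; last exact: ro_domZ.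
by rewrite AAQz; module R.
Qed.

End Point.

(** Delta_a depends only on Re z and (Im z)^2, so neither on j nor on the sign
    of Im z. *)
Lemma Qz_eq j k z w : SA j -> SA k -> complex.Re z = complex.Re w ->
  complex.Im z ^+ 2 = complex.Im w ^+ 2 -> Qz j z = Qz k w.
Proof.
move=> jP kP E1 E2; rewrite /Qz /Qres; congr (to_Lr ('pinv_(_) _ _)).
by apply/funext => u; rewrite !DeltaE// E1 E2.
Qed.

Lemma Sz_indep j k z : SA j -> SA k -> sector z -> Sz j z = Sz k z.
Proof.
move=> jP kP zS; apply: Lr_eq => u; rewrite (SzE jP)// (SzE kP)//.
by rewrite (@Qz_eq j k z z).
Qed.

Lemma Kz_indep j k z w : SA j -> SA k -> sector z -> Kz j z w = Kz k z w.
Proof.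
by move=> jP kP zS; rewrite /Kz /Pz /Yz (Sz_indep jP kP zS) (@Qz_eq j k z z).
Qed.

Section PointNorms.
Variables (j : K) (jP : SA j).

Lemma unit_norm : sa_norm j = 1.
Proof.
have := slice_norm jP (Complex 0 1); rewrite /slice/= scale0r add0r scale1r => ->.
by rewrite expr0n/= add0r expr1n sqrtr1.
Qed.

Lemma act_unit_norm (B : Lr X) : `|Lr_ract B j| <= `|B|.
Proof. by apply: le_trans (Lr_act_norm _ _) _; rewrite unit_norm mul1r. Qed.

Lemma act_slice_norm (B : Lr X) w : `|Lr_ract B (slice j w)| <= Normc.normc w * `|B|.
Proof. by apply: le_trans (Lr_act_norm _ _) _; rewrite slice_norm. Qed.

Variable z : R[i].
Hypothesis zS : sector z.
Let nz := sector_normc zS.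

(** Conjugation changes the sign of Y only, so C_z at conjugate points
    determines P and Y. *)
Lemma Cz_cbar : Cz j (cbar z) = Pz j z + Lr_ract (Yz j z) j.
Proof.
have E : Qz j (cbar z) = Qz j z by apply: Qz_eq => //=; rewrite sqrrN.
rewrite CzPY//; last exact: sector_cbar.
rewrite -Lr_actN; congr (_ + Lr_ract _ j); apply: Lr_eq => u.
  by rewrite !PzE// ?E//; exact: sector_cbar.
by rewrite LroppE !YzE E /= scaleNr opprK.
Qed.

Lemma Pz_norm : `|Pz j z| <= M / Normc.normc z.
Proof.
have -> : Pz j z = (2^-1 : R) *: (Cz j z + Cz j (cbar z)).
  by rewrite Cz_cbar CzPY//; module R.
rewrite normrZ ger0_norm// ler_pdivrMl//.
apply: le_trans (ler_normD _ _) _; rewrite mulr_natl mulr2n.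
by apply: lerD; rewrite ?Cz_norm// -(normc_cbar z) Cz_norm//; exact: sector_cbar.
Qed.

Lemma Yz_norm : `|Yz j z| <= M / Normc.normc z.
Proof.
have -> : Yz j z = (2^-1 : R) *: Lr_ract (Cz j z - Cz j (cbar z)) j.
  rewrite Cz_cbar CzPY// !(Lr_actD, Lr_actN) !Lr_actA unit_sqrA// Lr_act_real.
  by module R.
rewrite normrZ ger0_norm// ler_pdivrMl//; apply: le_trans (act_unit_norm _) _.
apply: le_trans (ler_normB _ _) _; rewrite mulr_natl mulr2n.
by apply: lerD; rewrite ?Cz_norm// -(normc_cbar z) Cz_norm//; exact: sector_cbar.
Qed.

Lemma Qz_norm : `|Qz j z| <= 2 * (M / Normc.normc z) ^+ 2.
Proof.
have -> : Qz j z = Lr_comp (Pz j z) (Pz j z) + Lr_comp (Yz j z) (Yz j z).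
  by apply: Lr_eq => u; rewrite LraddE !Lr_compE PP_YY.
apply: le_trans (ler_normD _ _) _; rewrite mulr_natl mulr2n expr2.
apply: lerD; apply: le_trans (Lr_comp_norm _ _) _.
  by apply: ler_pM => //; exact: Pz_norm.
by apply: ler_pM => //; exact: Yz_norm.
Qed.

(** The resolvent (z - A)^-1 acting on operators by left composition, with z acting
    from the right: an operator space is a complex space for the right action of
    the slice, which commutes with left composition by A. *)
Definition Rz (B : Lr X) : Lr X :=
  Lr_comp (Qz j z) (Lr_ract B (slice j (cbar z))) - Lr_comp (Sz j z) B.

(** From |A Q| <= (2 M^2 + M) / |z| and |Q| <= 2 (M / |z|)^2. *)
Definition Rz_const := 4 * M ^+ 2 + M.

Lemma Rz_norm B : `|Rz B| <= Rz_const / Normc.normc z * `|B|.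
Proof.
apply: le_trans (ler_normB _ _) _.
have nS : `|Sz j z| <= (2 * M ^+ 2 + M) / Normc.normc z.
  have -> : Sz j z = complex.Re z *: Qz j z - Pz j z by rewrite /Pz; module R.
  apply: le_trans (ler_normB _ _) _; rewrite normrZ mulrDl; apply: lerD; last exact: Pz_norm.
  apply: (@le_trans _ _ (Normc.normc z * (2 * (M / Normc.normc z) ^+ 2))).
    by apply: ler_pM => //; [exact: normc_Re|exact: Qz_norm].
  by rewrite le_eqVlt; apply/orP; left; apply/eqP; field; rewrite gt_eqF.
have -> : Rz_const / Normc.normc z * `|B| =
  2 * (M / Normc.normc z) ^+ 2 * (Normc.normc z * `|B|) + (2 * M ^+ 2 + M) / Normc.normc z * `|B|.
  by rewrite /Rz_const; field; rewrite gt_eqF.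
apply: lerD; apply: le_trans (Lr_comp_norm _ _) _; apply: ler_pM => //.
  exact: Qz_norm.
by apply: le_trans (act_slice_norm _ _) _; rewrite normc_cbar.
Qed.

Lemma RzD B C : Rz (B + C) = Rz B + Rz C.
Proof. by rewrite /Rz Lr_actD !Lr_compDr; module R. Qed.

Lemma Rz_act B w : Rz (Lr_ract B (slice j w)) = Lr_ract (Rz B) (slice j w).
Proof.
apply: Lr_eq => u; rewrite !(LraddE, LroppE, Lr_compE, Lr_actE).
by rewrite !lactA -!sliceM// [w * _]mulrC.
Qed.

Lemma Cz_dom u : ro_dom A (Cz j z u).
Proof. by rewrite CzE//; apply: ro_domB; [exact: Qz_dom|exact: AQz_dom]. Qed.

Lemma lact_slice_cbar (v : X) : lact (slice j z) v =
  (2 * complex.Re z) *: v - lact (slice j (cbar z)) v.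
Proof.
rewrite -[(2 * complex.Re z) *: v]lact_real -(slice_real j) -add_cbar sliceD//.
by rewrite lactDl; module R.
Qed.

(** C_z z - A C_z = 1 follows from Delta Q = 1 and z + conj(z) = 2 Re z. *)
Lemma Cz_eq u : Cz j z (lact (slice j z) u) - A (Cz j z u) = u.
Proof.
have dQ v := Qz_dom jP zS v; have dAQ v := AQz_dom jP zS v.
rewrite !CzE// roB// AAQz// lactA -sliceM// [cbar z * z]mulrC mul_cbar slice_real.
rewrite lact_real LrZ lact_slice_cbar LrB LrZ roB ?roZ//; last exact: ro_domZ.
by module R.
Qed.

End PointNorms.

(** The first resolvent identity, for (z - A)^-1 realized by [Rz] on the left
    and by [Cz] on the right. *)
Lemma Cz_sub j z z' : SA j -> sector z -> sector z' ->
  Cz j z' - Cz j z = - Lr_ract (Rz j z (Cz j z')) (slice j (z' - z)).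
Proof.
move=> jP zS zS'; apply: Lr_eq => u.
rewrite LraddE LroppE [RHS]LroppE Lr_actE /Rz LraddE LroppE !Lr_compE Lr_actE.
have dQ v := Qz_dom jP zS v; have dAQ v := AQz_dom jP zS v.
have dC v := Cz_dom jP zS' v.
(* from C_z' z' - A C_z' = 1 *)
have E v : Cz j z' (lact (slice j (z' - z)) v) =
    v + A (Cz j z' v) - Cz j z' (lact (slice j z) v).
  rewrite -[X in X + _ - _](Cz_eq jP zS') sliceD sliceN lactDl LrD.
  have -> : lact (- slice j z) v = - lact (slice j z) v.
    by rewrite -scaleN1r lact_scale scaleN1r.
  by rewrite LrN; module R.
set c := Cz j z'; set v := lact (slice j (cbar z)) u.
set N := complex.Re z ^+ 2 + complex.Im z ^+ 2.
have H0 : lact (slice j z) v = N *: u.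
  by rewrite /v lactA -sliceM// mul_cbar slice_real lact_real.
have H1 : Qz j z (c (lact (slice j (z' - z)) v)) =
    Qz j z v + A (Qz j z (c v)) - N *: Qz j z (c u).
  by rewrite E H0 !LrB LrD !LrZ (Qz_A jP zS (dC _)).
have H2 : Sz j z (c (lact (slice j (z' - z)) u)) = A (Qz j z u) +
    (c u - N *: Qz j z (c u)) + A (Qz j z (c v)).
  rewrite SzE// E lact_slice_cbar// !LrB LrD LrZ LrZ (Qz_A jP zS (dC _)).
  rewrite roB; [|exact: ro_domD|by apply: ro_domB => //; exact: ro_domZ].
  rewrite roD// roB//; last exact: ro_domZ.
  by rewrite roZ// AAQz// -/v -/c -/N; module R.
have -> : lact (slice j (cbar z)) (lact (slice j (z' - z)) u) = lact (slice j (z' - z)) v.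
  by rewrite /v !lactA -!sliceM// [cbar z * _]mulrC.
rewrite -/v -/c H1 H2 CzE// -/v; module R.
Qed.

(** The derivative of C_z, formally - (z - A)^-2. *)
Definition Cz' j z : Lr X := - Rz j z (Cz j z).

(** Iterating the resolvent identity twice shows that the remainder is
    Rz (Rz (C_z')) (z' - z)^2. *)
Lemma Cz_quad j z z' : SA j -> sector z -> sector z' ->
  `|Cz j z' - Cz j z - Lr_ract (Cz' j z) (slice j (z' - z))| <=
  Normc.normc (z' - z) ^+ 2 * ((Rz_const / Normc.normc z) ^+ 2 * (M / Normc.normc z')).
Proof.
move=> jP zS zS'.
have -> : Cz j z' - Cz j z - Lr_ract (Cz' j z) (slice j (z' - z)) =
   Lr_ract (Lr_ract (Rz j z (Rz j z (Cz j z'))) (slice j (z' - z))) (slice j (z' - z)).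
  have E : Cz j z' = Cz j z - Lr_ract (Rz j z (Cz j z')) (slice j (z' - z)).
    by rewrite -Cz_sub// addrC subrK.
  have RN B : Rz j z (- B) = - Rz j z B.
    by rewrite -[- B]scaleN1r /Rz Lr_actZ !Lr_compZr; module R.
  rewrite Cz_sub// {1}E RzD RN Lr_actD Lr_actN Rz_act//.
  by rewrite /Cz' Lr_actN; module R.
have nz := sector_normc zS; have nz' := sector_normc zS'.
have c0 : 0 <= Rz_const / Normc.normc z.
  by rewrite /Rz_const divr_ge0 ?normc_ge0// addr_ge0 ?mulr_ge0 ?sqr_ge0// ltW.
set n := Normc.normc (z' - z); set c := Rz_const / _; set m := M / _.
have -> : n ^+ 2 * (c ^+ 2 * m) = n * (n * (c * (c * m))) by ring.
apply: le_trans (act_slice_norm jP _ _) _; apply: ler_wpM2l; first exact: normc_ge0.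
apply: le_trans (act_slice_norm jP _ _) _; apply: ler_wpM2l; first exact: normc_ge0.
apply: le_trans (Rz_norm jP zS _) _; apply: ler_wpM2l => //.
apply: le_trans (Rz_norm jP zS _) _; apply: ler_wpM2l => //.
exact: Cz_norm.
Qed.

Lemma Cz'_norm j z : SA j -> sector z -> `|Cz' j z| <= Rz_const / Normc.normc z * (M / Normc.normc z).
Proof.
move=> jP zS; rewrite normrN; apply: le_trans (Rz_norm jP zS _) _.
apply: ler_wpM2l; last exact: Cz_norm.
by rewrite /Rz_const divr_ge0 ?normc_ge0// addr_ge0 ?mulr_ge0 ?sqr_ge0// ltW.
Qed.

Section RealPoint.
Variables (j : K) (jP : SA j) (l : R).
Hypothesis l0 : 0 < l.
Let z : R[i] := Complex l 0.

Lemma sector_real : 0 < pi / 2 + delta -> sector z.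
Proof.
by move=> d0; exists l, 0; rewrite normr0 /polar cos0 sin0 mulr1 mulr0.
Qed.

Hypothesis zS : sector z.

Lemma real_Cz_eq u : l *: Cz j z u - A (Cz j z u) = u.
Proof. by have := Cz_eq jP zS u; rewrite slice_real lact_real LrZ. Qed.

(** At a positive real l, d = C (l v - A v) - v satisfies A d = l d, so
    Delta_l d = 0 and d = 0. *)
Lemma real_Cz_left v : ro_dom A v -> Cz j z (l *: v - A v) = v.
Proof.
move=> dv; pose d := Cz j z (l *: v - A v) - v.
have dd : ro_dom A d by apply: ro_domB => //; exact: Cz_dom.
have Ad : A d = l *: d.
  rewrite roB//; last exact: Cz_dom.
  have := real_Cz_eq (l *: v - A v) => /eqP; rewrite subr_eq => /eqP E.
  by rewrite /d scalerBr E; module R.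
have dd2 : ro_dom2 A d by split=> //; rewrite Ad; exact: ro_domZ.
have := Qz_left jP zS dd2; rewrite Ad roZ// Ad /=.
have -> : l *: (l *: d) - (2 * l) *: (l *: d) + (l ^+ 2 + 0 ^+ 2) *: d = 0 by module R.
by rewrite Lr0 => /esym/eqP; rewrite subr_eq0 => /eqP.
Qed.

Lemma real_Cz_comm v : ro_dom A v -> A (Cz j z v) = Cz j z (A v).
Proof.
move=> dv; have H := real_Cz_left dv; have H2 := real_Cz_eq v.
have -> : Cz j z (A v) = l *: Cz j z v - v by rewrite -[X in _ - X]H LrB LrZ; module R.
by rewrite -[X in _ - X]H2; module R.
Qed.

Lemma real_bij : set_bij (ro_dom A) [set: X] (fun v => l *: v - A v).
Proof.
split=> //.
- move=> u v; rewrite !inE => du dv E.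
  by rewrite -(real_Cz_left du) E real_Cz_left.
- by move=> u _; exists (Cz j z u); [exact: Cz_dom|exact: real_Cz_eq].
Qed.

Lemma real_Rres : Rres A l = Cz j z :> (X -> X).
Proof.
apply/funext => u; rewrite -[in LHS](real_Cz_eq u) /Rres.
have [_ inj _] := real_bij.
by apply: (pinvKV (fun=> 0) inj); rewrite inE; exact: Cz_dom.
Qed.

Lemma real_Cres : Cres A l%:A = Cz j z :> (X -> X).
Proof. by rewrite -(slice_real j) Cz_res. Qed.

Lemma real_Kz_comm k w v : SA k -> sector w -> forall t, Kz k w t (Cz j z v) = Cz j z (Kz k w t v).
Proof.
move=> kP wS t; apply: Kz_comm => // u du; first exact: Cz_dom.
exact: real_Cz_comm.
Qed.

End RealPoint.

End Resolvent.

(** * Taylor's formula and complex paths *)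

Section Taylor.
Context {R : realType} {E : normedModType R}.
Implicit Types (s t c d : R).

Lemma has_deriv_sum n (f : nat -> R -> E) (f' : nat -> E) x :
  (forall k, (k < n)%N -> has_deriv (f k) x (f' k)) ->
  has_deriv (fun y => \sum_(k < n) f k y) x (\sum_(k < n) f' k).
Proof.
elim: n => [|n IH] H.
  rewrite big_ord0; under eq_fun do rewrite big_ord0; exact: has_deriv_cst.
rewrite big_ord_recr/=; under eq_fun do rewrite big_ord_recr/=.
apply: has_derivD; last exact: H.
by apply: IH => k kn; apply: H; exact: ltnW.
Qed.

Lemma has_deriv_monomial k x : has_deriv (fun y : R => y ^+ k.+1 / k.+1`!%:R) x (x ^+ k / k`!%:R).
Proof.
have H : has_deriv (fun y : R => y ^+ k.+1) x (k.+1%:R * x ^+ k).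
  have did : has_deriv (id : R -> R) x 1 by apply/has_derivP; exact: is_derive_id.
  elim: k => [|k IH].
    by rewrite expr0 mulr1; apply: has_deriv_eq did; exists 1 => // y _; rewrite expr1.
  have := @has_derivZ R R^o _ _ _ _ _ did IH.
  rewrite -[_ *: _ + _]/(x * (k.+1%:R * x ^+ k) + 1 * x ^+ k.+1).
  rewrite mulrCA -exprS -mulrDl natr1.
  by apply: has_deriv_eq; exists 1 => // y _; rewrite [RHS]exprS.
have := @has_derivZc R R^o (k.+1`!%:R^-1) _ _ _ H.
rewrite -[_ *: _]/(k.+1`!%:R^-1 * (k.+1%:R * x ^+ k)).
have -> : k.+1`!%:R^-1 * (k.+1%:R * x ^+ k) = x ^+ k / k`!%:R.
  have a0 : (k.+1%:R : R) != 0 by rewrite pnatr_eq0.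
  have b0 : (k`!%:R : R) != 0 by rewrite pnatr_eq0 -lt0n fact_gt0.
  rewrite factS natrM invfM; move: (k.+1%:R : R) (k`!%:R : R) (x ^+ k) a0 b0 => a b y a0 b0.
  by field; rewrite a0 b0.
apply: has_deriv_eq; exists 1 => // y _.
by rewrite mulrC.
Qed.

(** By induction on the order: the remainder of order n + 1 has the remainder
    of f' as its derivative, to which [mean_value] applies. *)
Lemma taylor_right n (f : nat -> R -> E) c d :
  (forall k s, (k < n)%N -> 0 <= s -> s < d -> has_deriv (f k) s (f k.+1 s)) ->
  (forall s, 0 <= s -> s < d -> `|f n s| <= c) ->
  forall s, 0 <= s -> s < d ->
  `|f 0%N s - \sum_(k < n) (s ^+ k / k`!%:R) *: f k 0| <= c * (s ^+ n / n`!%:R).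
Proof.
elim: n f => [|n IH] f df fc s s0 sd.
  by rewrite big_ord0 subr0 expr0 fact0 divr1 mulr1 fc.
pose g y := f 0%N y - \sum_(k < n.+1) (y ^+ k / k`!%:R) *: f k 0.
pose g' y := f 1%N y - \sum_(k < n) (y ^+ k / k`!%:R) *: f k.+1 0.
have g0 : g 0 = 0.
  rewrite /g big_ord_recl/= big1 => [|i _]; last by rewrite /bump/= add1n expr0n/= mul0r scale0r.
  by rewrite expr0 fact0 divr1 scale1r addr0 subrr.
have dg y : 0 <= y -> y <= s -> has_deriv g y (g' y).
  move=> y0 ys; apply: has_derivB; first by apply: df => //; exact: le_lt_trans sd.
  have : has_deriv (fun y => f 0%N 0 + \sum_(k < n) (y ^+ k.+1 / k.+1`!%:R) *: f k.+1 0) y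
      (0 + \sum_(k < n) (y ^+ k / k`!%:R) *: f k.+1 0).
    apply: has_derivD; first exact: has_deriv_cst.
    apply: (@has_deriv_sum n (fun k y => (y ^+ k.+1 / k.+1`!%:R) *: f k.+1 0)
       (fun k => (y ^+ k / k`!%:R) *: f k.+1 0)) => k _.
    have := has_derivZ (has_deriv_monomial k y) (@has_deriv_cst _ _ (f k.+1 0) y).
    by rewrite scaler0 add0r.
  rewrite add0r; apply: has_deriv_eq; exists 1 => // z _.
  rewrite [RHS]big_ord_recl/= expr0 fact0 divr1 scale1r; congr (_ + _).
have := @mean_value _ _ g g' (fun y => c * (y ^+ n.+1 / n.+1`!%:R))
  (fun y => c * (y ^+ n / n`!%:R)) 0 s s0 dg.
rewrite g0 subr0 expr0n/= mul0r mulr0 subr0; apply.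
- by move=> x _ _; apply: (@has_derivZc R R^o); exact: has_deriv_monomial.
- move=> x x0 xs; apply: (IH (fun k => f k.+1)) => //.
  + by move=> k r kn r0 rd; exact: df.
  + exact: le_lt_trans sd.
Qed.

Lemma taylor_bound n (F : nat -> R -> E) t c d :
  (forall k s, (k < n)%N -> `|s| < d -> has_deriv (F k) (t + s) (F k.+1 (t + s))) ->
  (forall s, `|s| < d -> `|F n (t + s)| <= c) ->
  forall s, `|s| < d ->
  `|F 0%N (t + s) - \sum_(k < n) (s ^+ k / k`!%:R) *: F k t| <= c * (`|s| ^+ n / n`!%:R).
Proof.
move=> dF Fc s sd; have [s0|s0] := leP 0 s.
  have := @taylor_right n (fun k y => F k (t + y)) c d _ _ s s0.
  rewrite ger0_norm// in sd *; rewrite !addr0; apply => //.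
  - move=> k y kn y0 yd; have Hy : `|y| < d by rewrite ger0_norm.
    have dt : has_deriv (fun y => t + y) y 1.
      by rewrite -[1]add0r; apply: has_derivD; [exact: has_deriv_cst|apply/has_derivP; exact: is_derive_id].
    by have := has_deriv_comp dt (dF k y kn Hy); rewrite scale1r.
  - by move=> y y0 yd; apply: Fc; rewrite ger0_norm.
have ms0 : 0 <= - s by rewrite oppr_ge0 ltW.
have := @taylor_right n (fun k y => (-1) ^+ k *: F k (t - y)) c d _ _ (- s) ms0.
rewrite ltr0_norm// in sd *; rewrite expr0 scale1r opprK subr0 => H.
rewrite (eq_bigr (fun k : 'I_n => ((- s) ^+ k / k`!%:R) *: ((-1) ^+ k *: F k t))); last first.
  move=> k _; rewrite scalerA mulrAC -exprMn mulrN1 opprK.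
  by [].
apply: H => //.
- move=> k y kn y0 yd; have Hy : `|- y| < d by rewrite normrN ger0_norm.
  have dt : has_deriv (fun y => t - y) y (-1).
    by rewrite -[-1]add0r; apply: has_derivB; [exact: has_deriv_cst|apply/has_derivP; exact: is_derive_id].
  have := has_derivZc ((-1) ^+ k) (has_deriv_comp dt (dF k (- y) kn Hy)).
  by rewrite scalerA exprSr.
- move=> y y0 yd; rewrite normrZ normrX normrN1 expr1n mul1r.
  by apply: Fc; rewrite normrN ger0_norm.
Qed.

End Taylor.

Section ComplexPaths.
Context {R : realType}.
Implicit Types (g w : R -> R[i]) (z v : R[i]) (x : R).

Definition has_cderiv g x z := has_deriv (fun s => complex.Re (g s)) x (complex.Re z) /\
  has_deriv (fun s => complex.Im (g s)) x (complex.Im z).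

Lemma has_cderivM g w x z v : has_cderiv g x z -> has_cderiv w x v ->
  has_cderiv (fun s => g s * w s) x (z * w x + g x * v).
Proof.
move=> [g1 g2] [w1 w2]; split.
  have H := has_derivB (has_derivZ g1 w1) (has_derivZ g2 w2).
  have -> : complex.Re (z * w x + g x * v) =
     complex.Re (g x) *: complex.Re v + complex.Re z *: (complex.Re (w x) : R^o) -
     (complex.Im (g x) *: complex.Im v + complex.Im z *: (complex.Im (w x) : R^o)).
    by case: (g x) (w x) (z) (v) => [a b] [c d] [e f] [h k] /=; rewrite /GRing.scale/=; ring.
  by apply: has_deriv_eq H; exists 1 => // y _; case: (g y) (w y) => [a b] [c d].
have H := has_derivD (has_derivZ g1 w2) (has_derivZ g2 w1).
have -> : complex.Im (z * w x + g x * v) =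
     complex.Re (g x) *: complex.Im v + complex.Re z *: (complex.Im (w x) : R^o) +
     (complex.Im (g x) *: complex.Re v + complex.Im z *: (complex.Re (w x) : R^o)).
  by case: (g x) (w x) (z) (v) => [a b] [c d] [e f] [h k] /=; rewrite /GRing.scale/=; ring.
by apply: has_deriv_eq H; exists 1 => // y _; case: (g y) (w y) => [a b] [c d].
Qed.

Lemma has_cderivD g w x z v : has_cderiv g x z -> has_cderiv w x v ->
  has_cderiv (fun s => g s + w s) x (z + v).
Proof.
have ReD (a b : R[i]) : complex.Re (a + b) = complex.Re a + complex.Re b by case: a b => [? ?] [].
have ImD (a b : R[i]) : complex.Im (a + b) = complex.Im a + complex.Im b by case: a b => [? ?] [].
move=> [g1 g2] [w1 w2]; split; rewrite ?ReD ?ImD.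
  by apply: has_deriv_eq (has_derivD g1 w1); exists 1 => // y _; rewrite ReD.
by apply: has_deriv_eq (has_derivD g2 w2); exists 1 => // y _; rewrite ImD.
Qed.

Lemma has_cderiv_cst z x : has_cderiv (fun=> z) x 0.
Proof. by split; exact: has_deriv_cst. Qed.

Lemma has_cderiv_cmul z g x v : has_cderiv g x v -> has_cderiv (fun s => z * g s) x (z * v).
Proof. by move=> H; have := has_cderivM (has_cderiv_cst z x) H; rewrite mul0r add0r. Qed.

Lemma has_deriv_cos (a x : R) : has_deriv (fun y => cos (a * y)) x (- (a * sin (a * x))).
Proof.
have := has_deriv_comp (has_deriv_lmul a x) ((has_derivP _ _ _).2 (is_derive_cos (a * x))).
by rewrite -[_ *: _]/(_ * _) mulrN.
Qed.

Lemma has_deriv_sin (a x : R) : has_deriv (fun y => sin (a * y)) x (a * cos (a * x)).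
Proof.
exact: (has_deriv_comp (has_deriv_lmul a x) ((has_derivP _ _ _).2 (is_derive_sin (a * x)))).
Qed.

Lemma has_cderiv_cexp z x : has_cderiv (fun s => cexp (Complex s 0 * z)) x (z * cexp (Complex x 0 * z)).
Proof.
case: z => a b; rewrite /cexp /polar; split.
  have := has_derivZ (has_deriv_expR a x) (has_deriv_cos b x).
  rewrite (_ : _ + _ = complex.Re ((a +i* b)%C * (expR (complex.Re ((x +i* 0)%C * (a +i* b)%C)) *
    cos (complex.Im ((x +i* 0)%C * (a +i* b)%C)) +i* (expR (complex.Re ((x +i* 0)%C * (a +i* b)%C)) *
    sin (complex.Im ((x +i* 0)%C * (a +i* b)%C))))%C)); last first.
    rewrite /= /GRing.scale/= !mul0r subr0 addr0 ![x * _]mulrC; ring.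
  apply: has_deriv_eq; exists 1 => // y _ /=.
  by rewrite !mul0r subr0 addr0 ![y * _]mulrC.
have := has_derivZ (has_deriv_expR a x) (has_deriv_sin b x).
rewrite (_ : _ + _ = complex.Im ((a +i* b)%C * (expR (complex.Re ((x +i* 0)%C * (a +i* b)%C)) *
    cos (complex.Im ((x +i* 0)%C * (a +i* b)%C)) +i* (expR (complex.Re ((x +i* 0)%C * (a +i* b)%C)) *
    sin (complex.Im ((x +i* 0)%C * (a +i* b)%C))))%C)); last first.
  rewrite /= /GRing.scale/= !mul0r subr0 addr0 ![x * _]mulrC; ring.
apply: has_deriv_eq; exists 1 => // y _ /=.
by rewrite !mul0r subr0 addr0 ![y * _]mulrC.
Qed.

Lemma has_cderiv_polar_arg (r x : R) : has_cderiv (polar r) x (Complex 0 1 * polar r x).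
Proof.
rewrite /polar; split => /=.
  have := @has_derivZc R R^o r _ _ _ (has_deriv_cos 1 x).
  rewrite (_ : r *: _ = 0 * (r * cos x) - 1 * (r * sin x)); last first.
    by rewrite /GRing.scale/= !mul1r; ring.
  by apply: has_deriv_eq; exists 1 => // y _; rewrite mul1r.
have := @has_derivZc R R^o r _ _ _ (has_deriv_sin 1 x).
rewrite (_ : r *: _ = 0 * (r * sin x) + 1 * (r * cos x)); last first.
  by rewrite /GRing.scale/= !mul1r; ring.
by apply: has_deriv_eq; exists 1 => // y _; rewrite mul1r.
Qed.

Lemma has_cderiv_polar_radius (x th : R) : has_cderiv (polar^~ th) x (polar 1 th).
Proof.
rewrite /polar; split => /=; rewrite mul1r.
  have := has_deriv_lmul (cos th) x; apply: has_deriv_eq; exists 1 => // y _; exact: mulrC.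
have := has_deriv_lmul (sin th) x; apply: has_deriv_eq; exists 1 => // y _; exact: mulrC.
Qed.

End ComplexPaths.

(** * Contour integrals of a kernel *)

Section ComplexNorm.
Context {R : realType}.
Implicit Types (z w : R[i]) (r x : R).
Local Notation normc := (@Normc.normc R).

Lemma normc_le z : normc z <= `|complex.Re z| + `|complex.Im z|.
Proof.
case: z => a b /=; rewrite -[leRHS]ger0_norm ?addr_ge0// -sqrtr_sqr ler_wsqrtr//.
rewrite -(real_normK (num_real a)) -(real_normK (num_real b)) sqrrD.
by have := mulr_ge0 (normr_ge0 a) (normr_ge0 b); lra.
Qed.

Lemma normc_real r : normc (Complex r 0) = `|r|.
Proof. by rewrite /= expr0n/= addr0 sqrtr_sqr. Qed.

Lemma normcB z w : normc (z - w) <= normc z + normc w.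
Proof. by rewrite (le_trans (le_normcD _ _))// normcN. Qed.

Lemma polar_scale r th : polar r th = Complex r 0 * polar 1 th.
Proof.
by rewrite /polar; apply/eqP; rewrite eq_complex/= !mul1r !mul0r subr0 addr0 !eqxx.
Qed.

Lemma polar1_0 : polar 1 0 = 1 :> R[i].
Proof. by rewrite /polar cos0 sin0 mulr1 mulr0. Qed.

Lemma complexE z : z = Complex (complex.Re z) 0 * 1 + Complex (complex.Im z) 0 * Complex 0 1.
Proof.
by case: z => a b; apply/eqP; rewrite eq_complex/=; apply/andP; split; apply/eqP; ring.
Qed.

Lemma has_cderiv_cexp_comp (g : R -> R[i]) x z : has_cderiv g x z ->
  has_cderiv (fun s => cexp (g s)) x (z * cexp (g x)).
Proof.
move=> [g1 g2]; rewrite /cexp /polar.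
have He := has_deriv_comp g1 ((has_derivP _ _ _).2 (is_derive_expR (complex.Re (g x)))).
have Hc := has_deriv_comp g2 ((has_derivP _ _ _).2 (is_derive_cos (complex.Im (g x)))).
have Hs := has_deriv_comp g2 ((has_derivP _ _ _).2 (is_derive_sin (complex.Im (g x)))).
split => /=.
  have := has_derivZ He Hc.
  rewrite (_ : _ + _ = complex.Re (z * (expR (complex.Re (g x)) * cos (complex.Im (g x)) +i*
     (expR (complex.Re (g x)) * sin (complex.Im (g x))))%C)); first by [].
  by case: (z) => a b /=; rewrite /GRing.scale/=; ring.
have := has_derivZ He Hs.
rewrite (_ : _ + _ = complex.Im (z * (expR (complex.Re (g x)) * cos (complex.Im (g x)) +i*
     (expR (complex.Re (g x)) * sin (complex.Im (g x))))%C)); first by [].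
by case: (z) => a b /=; rewrite /GRing.scale/=; ring.
Qed.

Definition ccontinuous (g : R -> R[i]) x := {for x, continuous (fun s => complex.Re (g s))} /\
  {for x, continuous (fun s => complex.Im (g s))}.

Lemma has_cderiv_ccontinuous g x z : has_cderiv g x z -> ccontinuous g x.
Proof. by move=> [g1 g2]; split; [exact: has_deriv_continuous g1|exact: has_deriv_continuous g2]. Qed.

Lemma ccontinuousM g h x : ccontinuous g x -> ccontinuous h x -> ccontinuous (fun s => g s * h s) x.
Proof.
move=> [g1 g2] [h1 h2]; split.
  rewrite (_ : (fun s => _) = (fun s => complex.Re (g s) * complex.Re (h s) -
    complex.Im (g s) * complex.Im (h s))); first by apply: cvgB; exact: cvgM.
  by apply/funext => s; case: (g s) (h s) => [a b] [c d].
rewrite (_ : (fun s => _) = (fun s => complex.Re (g s) * complex.Im (h s) +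
    complex.Im (g s) * complex.Re (h s))); first by apply: cvgD; exact: cvgM.
by apply/funext => s; case: (g s) (h s) => [a b] [c d].
Qed.

(** Powers are absorbed by a small exponential, with the constant n! / b^n that
    yields the Cauchy estimates. *)
Lemma expn_le_expR (b x : R) n : 0 < b -> 0 <= x -> x ^+ n <= n`!%:R / b ^+ n * expR (b * x).
Proof.
move=> b0 x0; have bn : 0 < b ^+ n by rewrite exprn_gt0.
have fn : 0 < n`!%:R :> R by rewrite ltr0n fact_gt0.
have bx : 0 <= b * x by rewrite mulr_ge0// ltW.
have H : (b * x) ^+ n / n`!%:R <= expR (b * x).
  case: n {bn fn} => [|n]; first by rewrite expr0 fact0 divr1 -expR0 ler_expR.
  by apply: le_trans (expR_ge1Dxn n bx); rewrite lerDr.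
apply: le_trans (ler_wpM2l _ H); last by rewrite divr_ge0// ltW.
rewrite exprMn; move: (b ^+ n) (n`!%:R : R) (x ^+ n) bn fn => p q s p0 q0.
by rewrite le_eqVlt; apply/orP; left; apply/eqP; field; rewrite !gt_eqF.
Qed.

End ComplexNorm.

Section KernelDefinition.
Context {R : realType} {E : completeNormedModType R}.
Local Notation normc := (@Normc.normc R).
Implicit Types (z w : R[i]) (r s : R).

Definition in_sector (Th : R) z := exists rho theta : R,
  [/\ 0 < rho, `|theta| < Th & z = polar rho theta].

(** [K z w] stands for the value at z of a holomorphic density of size 1/|z|,
    multiplied by the complex number w, or its imaginary part; [K1] for its
    derivative in z.  The last condition expresses differentiability in z with
    a uniform quadratic remainder. *)
Record is_kernel (K K1 : R[i] -> R[i] -> E) (Th kap : R) : Prop := IsKernel {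
  kernelD : forall z w w', K z (w + w') = K z w + K z w' ;
  kernelZ : forall z r w, K z (Complex r 0 * w) = r *: K z w ;
  kernel'D : forall z w w', K1 z (w + w') = K1 z w + K1 z w' ;
  kernel'Z : forall z r w, K1 z (Complex r 0 * w) = r *: K1 z w ;
  kernel_ge0 : 0 <= kap ;
  kernel_norm : forall z w, in_sector Th z -> `|K z w| <= kap * normc w / normc z ;
  kernel'_norm : forall z w, in_sector Th z -> `|K1 z w| <= kap * normc w / normc z ^+ 2 ;
  kernel_quad : forall z z' w, in_sector Th z -> in_sector Th z' ->
    `|K z' w - K z w - K1 z ((z' - z) * w)| <=
      kap * normc (z' - z) ^+ 2 * normc w / (normc z ^+ 2 * normc z')
}.

End KernelDefinition.

Section Kernel.
Context {R : realType} {E : completeNormedModType R}.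
Local Notation C := R[i].
Local Notation normc := (@Normc.normc R).
Local Notation ii := (Complex 0 1 : C).
Variables (K K1 : C -> C -> E) (Th kap : R).
Implicit Types (m : R -> R) (a b t r s eta rho x th : R) (z w : C).
Hypothesis HK : is_kernel K K1 Th kap.
Local Notation in_sector := (in_sector Th).

Let KD := kernelD HK.
Let KZ := kernelZ HK.
Let K1D := kernel'D HK.
Let K1Z := kernel'Z HK.
Let kap0 := kernel_ge0 HK.
Let K_norm := kernel_norm HK.
Let K1_norm := kernel'_norm HK.
Let K_quad := kernel_quad HK.
Hypothesis K_real : forall r s, 0 < r -> K (polar r 0) (Complex s 0) = 0.

Lemma in_sector_normc z : in_sector z -> 0 < normc z.
Proof. by move=> [r [t [r0 td ->]]]; rewrite normc_polar// ltW. Qed.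

Lemma kernel0 z : K z 0 = 0.
Proof. by apply: (addIr (K z 0)); rewrite -KD !add0r. Qed.

Lemma kernelN z w : K z (- w) = - K z w.
Proof. by apply: (addIr (K z w)); rewrite -KD !addNr kernel0. Qed.

Lemma kernel'N z w : K1 z (- w) = - K1 z w.
Proof.
have K10 : K1 z 0 = 0 by apply: (addIr (K1 z 0)); rewrite -K1D !add0r.
by apply: (addIr (K1 z w)); rewrite -K1D !addNr K10.
Qed.

Lemma kernel_ReIm z w : K z w = complex.Re w *: K z 1 + complex.Im w *: K z ii.
Proof. by rewrite {1}[w]complexE KD !KZ. Qed.

Lemma kernel'_ReIm z w : K1 z w = complex.Re w *: K1 z 1 + complex.Im w *: K1 z ii.
Proof. by rewrite {1}[w]complexE K1D !K1Z. Qed.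

Lemma K_weight_deriv z (w : R -> C) x v : has_cderiv w x v -> has_deriv (fun s => K z (w s)) x (K z v).
Proof.
move=> [w1 w2].
have H := has_derivD (has_derivZ w1 (has_deriv_cst (K z 1) x)) (has_derivZ w2 (has_deriv_cst (K z ii) x)).
rewrite !scaler0 !add0r -kernel_ReIm in H.
by apply: has_deriv_eq H; exists 1 => // y _; rewrite -kernel_ReIm.
Qed.

Lemma K1_weight_deriv z (w : R -> C) x v : has_cderiv w x v -> has_deriv (fun s => K1 z (w s)) x (K1 z v).
Proof.
move=> [w1 w2].
have H := has_derivD (has_derivZ w1 (has_deriv_cst (K1 z 1) x)) (has_derivZ w2 (has_deriv_cst (K1 z ii) x)).
rewrite !scaler0 !add0r -kernel'_ReIm in H.
by apply: has_deriv_eq H; exists 1 => // y _; rewrite -kernel'_ReIm.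
Qed.

(** The quadratic remainder of K along g is small with respect to the increment,
    and K1 is continuous in the increment of g. *)
Lemma K_point_deriv (g : R -> C) x v w : (exists2 h : R, 0 < h & forall y, `|y - x| < h -> in_sector (g y)) ->
  has_cderiv g x v -> has_deriv (fun s => K (g s) w) x (K1 (g x) (v * w)).
Proof.
move=> [h0 h00 gS] [g1 g2].
have gx : in_sector (g x) by apply: gS; rewrite subrr normr0.
have nx := in_sector_normc gx; set n := normc (g x) in nx.
pose V := normc v + 2; have V0 : 0 < V by rewrite ltr_wpDl ?normc_ge0.
move=> e e0.
pose B := kap * normc w / n ^+ 2; have B0 : 0 <= B by rewrite divr_ge0 ?mulr_ge0 ?normc_ge0// exprn_ge0// ltW.
pose e1 := Num.min 1 (e / (4 * (B + 1))).
have B1 : 0 < 4 * (B + 1) by rewrite mulr_gt0// ltr_wpDl.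
have e10 : 0 < e1 by rewrite lt_min ltr01 divr_gt0.
have e11 : e1 <= 1 by rewrite ge_min lexx.
have e1B : B * (2 * e1) <= e / 2.
  have : e1 * (4 * (B + 1)) <= e by rewrite -ler_pdivlMr// ge_min lexx orbT.
  have := mulr_ge0 B0 (ltW e10); set be := B * e1.
  move: (e10); nra.
have [h1 h10 H1] := g1 e1 e10; have [h2 h20 H2] := g2 e1 e10.
pose q := 2 * (B + 1) * V ^+ 2 / n.
(* the first bound keeps g y away from 0, the second makes the quadratic remainder small *)
pose h3 := Num.min (n / (2 * V)) (e / (2 * (q + 1))).
have q0 : 0 <= q by rewrite divr_ge0 ?mulr_ge0 ?exprn_ge0 ?(ltW V0) ?(ltW nx)// addr_ge0.
have q10 : 0 < 2 * (q + 1) by rewrite mulr_gt0// ltr_wpDl.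
have h30 : 0 < h3.
  by rewrite lt_min; apply/andP; split; apply: divr_gt0 => //; exact: mulr_gt0.
exists (Num.min (Num.min h0 h1) (Num.min h2 h3)); first by rewrite lt_min lt_min h00 h10 lt_min h20.
move=> y; rewrite !lt_min -!andbA => /and5P[yh0 yh1 yh2 yn yq].
have gy := gS y yh0; have ny := in_sector_normc gy.
pose zeta := g y - g x; pose s := y - x.
have dz : normc (zeta - Complex s 0 * v) <= 2 * e1 * `|s|.
  apply: le_trans (normc_le _) _; rewrite mulr2n mulrDl mul1r mulrDl; apply: lerD.
    have := H1 y yh1; rewrite /zeta /s; case: (g y) (g x) (v) => [a b] [c d] [k l] /=.
    by rewrite mul0r subr0 /GRing.scale.
  have := H2 y yh2; rewrite /zeta /s; case: (g y) (g x) (v) => [a b] [c d] [k l] /=.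
  by rewrite mul0r addr0 /GRing.scale.
have nz : normc zeta <= V * `|s|.
  rewrite -[zeta](subrK (Complex s 0 * v)) (le_trans (le_normcD _ _))//.
  rewrite Normc.normcM normc_real /V mulrDl addrC [_ * normc v]mulrC lerD2l (le_trans dz)//.
  by rewrite ler_wpM2r// ler_piMr.
(* as |g y - g x| <= n / 2 *)
have ny2 : n / 2 <= normc (g y).
  have : n <= normc (g y) + normc zeta.
    rewrite /n (_ : g x = g y - zeta); last by rewrite /zeta opprB addrC subrK.
    exact: normcB.
  have : normc zeta <= n / 2.
    apply: le_trans nz _; rewrite mulrC -ler_pdivlMr// -mulrA -invfM [2 * V]mulrC.
    by rewrite [V * 2]mulrC ltW.
  lra.
have -> : K (g y) w - K (g x) w - (y - x) *: K1 (g x) (v * w) =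
   (K (g y) w - K (g x) w - K1 (g x) (zeta * w)) + K1 (g x) ((zeta - Complex s 0 * v) * w).
  have -> : (zeta - Complex s 0 * v) * w = zeta * w - Complex s 0 * (v * w).
    by rewrite [LHS]mulrBl mulrA.
  by rewrite K1D kernel'N K1Z /s; module R.
apply: le_trans (ler_normD _ _) _.
have b2 : `|K1 (g x) ((zeta - Complex s 0 * v) * w)| <= e / 2 * `|s|.
  apply: le_trans (K1_norm _ gx) _; rewrite Normc.normcM -/n.
  apply: (@le_trans _ _ (B * (2 * e1) * `|s|)); last by rewrite ler_wpM2r.
  rewrite (_ : kap * _ / _ = B * normc (zeta - Complex s 0 * v)); last by rewrite /B; ring.
  by rewrite -mulrA ler_wpM2l.
have b1 : `|K (g y) w - K (g x) w - K1 (g x) (zeta * w)| <= e / 2 * `|s|.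
  apply: le_trans (K_quad _ gx gy) _; rewrite -/zeta -/n.
  apply: (@le_trans _ _ (q * `|s| * `|s|)); last first.
    rewrite ler_wpM2r//.
    have : `|s| * (2 * (q + 1)) <= e by rewrite -ler_pdivlMr// ltW.
    have := normr_ge0 s; nra.
  apply: (@le_trans _ _ (B * (V * `|s|) ^+ 2 * (2 / n))); last first.
    rewrite /q (_ : 2 * (B + 1) * V ^+ 2 / n * `|s| * `|s| = (B + 1) * (V * `|s|) ^+ 2 * (2 / n)); last by ring.
    by rewrite ler_wpM2r ?divr_ge0 ?(ltW nx)// ler_wpM2r ?sqr_ge0// lerDl.
  rewrite (_ : kap * normc zeta ^+ 2 * normc w / (n ^+ 2 * normc (g y)) = B * normc zeta ^+ 2 * (normc (g y))^-1); last first.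
    by rewrite /B invfM; ring.
  apply: ler_pM.
  - by rewrite mulr_ge0// sqr_ge0.
  - by rewrite invr_ge0 normc_ge0.
  - rewrite ler_wpM2l// -[leLHS]ger0_norm ?sqr_ge0//.
    rewrite normrX ler_sqr ?nnegrE ?normr_ge0// ?mulr_ge0 ?(ltW V0)//.
    by rewrite ger0_norm ?normc_ge0.
  - by rewrite -[leRHS]invrK lef_pV2 ?posrE ?invr_gt0 ?divr_gt0// invfM invrK mulrC.
have -> : e * `|y - x| = e / 2 * `|s| + e / 2 * `|s| by rewrite -mulrDl -splitr.
exact: lerD.
Qed.

Lemma K_deriv (g w : R -> C) x v u :
  (exists2 h : R, 0 < h & forall y, `|y - x| < h -> in_sector (g y)) ->
  has_cderiv g x v -> has_cderiv w x u ->
  has_deriv (fun s => K (g s) (w s)) x (K1 (g x) (v * w x) + K (g x) u).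
Proof.
move=> gS dg [w1 w2].
have H := has_derivD (has_derivZ w1 (K_point_deriv 1 gS dg)) (has_derivZ w2 (K_point_deriv ii gS dg)).
have -> : K1 (g x) (v * w x) + K (g x) u =
  complex.Re (w x) *: K1 (g x) (v * 1) + complex.Re u *: K (g x) 1 +
  (complex.Im (w x) *: K1 (g x) (v * ii) + complex.Im u *: K (g x) ii).
  rewrite [K (g x) u]kernel_ReIm [in LHS](complexE (w x)) mulrDr !(mulrCA v) K1D !K1Z.
  by moduleu R.
by apply: has_deriv_eq H; exists 1 => // y _; rewrite -kernel_ReIm.
Qed.

Lemma K_continuous (g w : R -> C) x v :
  (exists2 h : R, 0 < h & forall y, `|y - x| < h -> in_sector (g y)) ->
  has_cderiv g x v -> ccontinuous w x -> {for x, continuous (fun s => K (g s) (w s))}.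
Proof.
move=> gS dg [w1 w2].
rewrite (_ : (fun s => _) = (fun s => complex.Re (w s) *: K (g s) 1 + complex.Im (w s) *: K (g s) ii)).
  by apply: cvgD; apply: cvgZ => //; apply: has_deriv_continuous; apply: K_point_deriv gS dg.
by apply/funext => s; exact: kernel_ReIm.
Qed.

(** The factor p(z) e^(t z) at z = r e^(i th), where
    p(rho e^(i th)) = m(rho) e^(i a th).  Only p(z) = z^k with k = a occurs,
    including k = -1, for which m(rho) = 1 / rho. *)
Definition weight (m : R -> R) (a t r th : R) : C :=
  polar (m r) (a * th) * cexp (Complex t 0 * polar r th).

(** The density K(z, p(z) e^(tz) dz) along the arc, where dz = i z dth, and along
    the ray, where dz = e^(i eta) drho. *)
Definition arcf m a t r th : E := K (polar r th) (weight m a t r th * (ii * polar r th)).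
Definition rayf m a t eta rho : E := K (polar rho eta) (weight m a t rho eta * polar 1 eta).

Lemma normc_weight m a t r th : 0 <= m r -> normc (weight m a t r th) = m r * expR (t * (r * cos th)).
Proof.
move=> m0; rewrite /weight Normc.normcM normc_polar// normc_cexp /= mul0r subr0.
by [].
Qed.

Lemma normc_ii : normc ii = 1.
Proof. by rewrite /= expr0n/= add0r expr1n sqrtr1. Qed.

Lemma in_sector_polar r th : 0 < r -> `|th| < Th -> in_sector (polar r th).
Proof. by exists r, th. Qed.

Lemma sector_near_arg r th : 0 < r -> `|th| < Th ->
  exists2 h : R, 0 < h & forall y, `|y - th| < h -> in_sector (polar r y).
Proof.
move=> r0 thT; exists (Th - `|th|); first by rewrite subr_gt0.
move=> y yh; apply: in_sector_polar => //.
rewrite -[y](subrK th) (le_lt_trans (ler_normD _ _))//.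
by rewrite -ltrBrDr.
Qed.

Lemma sector_near_radius r th : 0 < r -> `|th| < Th ->
  exists2 h : R, 0 < h & forall y, `|y - r| < h -> in_sector (polar y th).
Proof.
move=> r0 thT; exists r => // y; rewrite ltr_norml => /andP[+ _].
rewrite ltrBrDl subrr => y0.
by apply: in_sector_polar.
Qed.

Lemma ccontinuous_polar (mu psi : R -> R) x : {for x, continuous mu} -> {for x, continuous psi} ->
  ccontinuous (fun s => polar (mu s) (psi s)) x.
Proof.
move=> cm cp; split => /=; apply: cvgM => //.
  by apply: (continuous_comp cp); exact: continuous_cos.
by apply: (continuous_comp cp); exact: continuous_sin.
Qed.

Lemma continuous_mulr_cst (a x : R) : {for x, continuous ( *%R a)}.
Proof. exact: has_deriv_continuous (has_deriv_lmul a x). Qed.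

Lemma arcf_continuous m a t r th : 0 < r -> `|th| < Th -> {for th, continuous (arcf m a t r)}.
Proof.
move=> r0 thT; have dp := has_cderiv_polar_arg r th.
apply: (K_continuous (sector_near_arg r0 thT) dp).
have cp := has_cderiv_ccontinuous dp.
apply: ccontinuousM; last exact: has_cderiv_ccontinuous (has_cderiv_cmul ii dp).
apply: ccontinuousM; last exact: has_cderiv_ccontinuous (has_cderiv_cexp_comp (has_cderiv_cmul (Complex t 0) dp)).
by apply: ccontinuous_polar; [exact: cvg_cst|exact: continuous_mulr_cst].
Qed.

Lemma rayf_continuous m a t eta rho : 0 < rho -> `|eta| < Th -> {for rho, continuous m} ->
  {for rho, continuous (rayf m a t eta)}.
Proof.
move=> r0 thT cm; have dp := has_cderiv_polar_radius rho eta.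
apply: (K_continuous (sector_near_radius r0 thT) dp).
apply: ccontinuousM; last by apply: has_cderiv_ccontinuous (has_cderiv_cst _ _).
apply: ccontinuousM; last exact: has_cderiv_ccontinuous (has_cderiv_cexp_comp (has_cderiv_cmul (Complex t 0) dp)).
by apply: ccontinuous_polar => //; exact: cvg_cst.
Qed.

Lemma arcf_norm m a t r th : 0 < r -> `|th| < Th -> 0 <= m r ->
  `|arcf m a t r th| <= kap * m r * expR (t * (r * cos th)).
Proof.
move=> r0 thT m0; apply: le_trans (K_norm _ (in_sector_polar r0 thT)) _.
rewrite Normc.normcM normc_weight// Normc.normcM normc_ii !normc_polar ?(ltW r0)//.
by rewrite mul1r !mulrA mulfK// gt_eqF.
Qed.

Lemma rayf_norm m a t eta rho : 0 < rho -> `|eta| < Th -> 0 <= m rho ->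
  `|rayf m a t eta rho| <= kap * (m rho / rho) * expR (t * (rho * cos eta)).
Proof.
move=> r0 thT m0; apply: le_trans (K_norm _ (in_sector_polar r0 thT)) _.
rewrite Normc.normcM normc_weight// !normc_polar ?(ltW r0)//.
by rewrite le_eqVlt; apply/orP; left; apply/eqP; ring.
Qed.

(** Half of the decay e^(t rho cos eta) absorbs the growth of m. *)
Lemma rayf_decaying m a t eta r b (B : R) : 0 < r -> `|eta| < Th -> 0 < b -> 0 <= B ->
  (forall x, 0 < x -> {for x, continuous m}) ->
  (forall x, r <= x -> 0 <= m x /\ m x <= B * x * expR (b * x)) ->
  t * cos eta <= - (2 * b) -> decaying 0 (rayf m a t eta) r (kap * B) b.
Proof.
move=> r0 eT b0 B0 cm mB tb; split=> // x x0.
  by apply: rayf_continuous => //; exact: cm.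
have xp := lt_le_trans r0 x0; have [m0 mx] := mB x x0.
apply: le_trans (rayf_norm _ _ xp eT m0) _; rewrite -!mulrA ler_wpM2l//.
apply: (@le_trans _ _ (B * expR (b * x) * expR (- (2 * b) * x))); last first.
  by rewrite -mulrA -expRD (_ : b * x + - (2 * b) * x = - b * x)//; ring.
rewrite mulrA; apply: ler_pM; rewrite ?divr_ge0 ?expR_ge0 ?(ltW xp)//.
  by rewrite ler_pdivrMr// mulrAC.
by rewrite ler_expR mulrCA mulrC ler_wpM2r// ltW.
Qed.

Definition arc_part m a t r eta : E := vint (arcf m a t r) 0 eta.
Definition ray_part m a t r eta : E := vinf (rayf m a t eta) r.
(** Integral over the upper half of the contour: the arc from the positive real
    axis to the argument eta, then the ray. *)
Definition contour m a t r eta := arc_part m a t r eta + ray_part m a t r eta.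

Lemma arcf_continuous_on m a t r : 0 < r -> continuous_on (- Th) Th (arcf m a t r).
Proof. by move=> r0 x x1 x2; apply: arcf_continuous => //; rewrite ltr_norml x1. Qed.

Lemma contour_norm m a t r eta b (B : R) : 0 <= t -> 0 < r -> 0 <= eta -> eta < Th -> 0 < b -> 0 <= B ->
  (forall x, 0 < x -> {for x, continuous m}) ->
  (forall x, r <= x -> 0 <= m x /\ m x <= B * x * expR (b * x)) ->
  t * cos eta <= - (2 * b) ->
  `|contour m a t r eta| <= kap * m r * expR (t * r) * eta + kap * B / b.
Proof.
move=> t0 r0 e0 eT b0 B0 cm mB tb; have Th0 : 0 < Th := le_lt_trans e0 eT.
have [m0 _] := mB r (lexx _).
apply: le_trans (ler_normD _ _) _; apply: lerD.
  have nT : - Th < 0 by rewrite oppr_lt0.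
  have := @vint_norm_cst _ _ _ _ _ _ _ (kap * m r * expR (t * r)) nT e0 eT (@arcf_continuous_on m a t r r0).
  rewrite subr0; apply.
  move=> x x0 xe; have xT : `|x| < Th by rewrite ger0_norm// (le_lt_trans xe).
  apply: le_trans (arcf_norm _ _ r0 xT m0) _.
  apply: ler_wpM2l; first exact: mulr_ge0.
  rewrite ler_expR; apply: ler_wpM2l => //; apply: ler_piMr; [exact: ltW|exact: cos_le1].
have eTn : `|eta| < Th by rewrite ger0_norm.
apply: le_trans (vinf_norm (rayf_decaying a r0 eTn b0 B0 cm mB tb)) _.
rewrite -[leRHS]mulr1 ler_wpM2l ?divr_ge0 ?mulr_ge0 ?(ltW b0)//.
by rewrite -[leRHS]expR0 ler_expR mulNr oppr_le0 mulr_ge0// ltW.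
Qed.

Local Notation mono k := (fun x : R => x ^+ k).

Lemma mono_continuous k x : {for x, continuous (mono k : R -> R)}.
Proof. exact: exprn_continuous. Qed.

(** d/dt e^(tz) = z e^(tz). *)
Lemma weightS k t r th : polar r th * weight (mono k) k%:R t r th = weight (mono k.+1) k.+1%:R t r th.
Proof. by rewrite /weight mulrA polarM -exprS -natr1 mulrDl mul1r [th + _]addrC. Qed.

Lemma has_cderiv_weight k t r th :
  has_cderiv (fun t => weight (mono k) k%:R t r th) t (weight (mono k.+1) k.+1%:R t r th).
Proof.
have := has_cderiv_cmul (polar (r ^+ k) (k%:R * th)) (has_cderiv_cexp (polar r th) t).
by rewrite mulrCA weightS.
Qed.

Lemma arcf_deriv k t r th :
  has_deriv (fun t => arcf (mono k) k%:R t r th) t (arcf (mono k.+1) k.+1%:R t r th).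
Proof.
apply: K_weight_deriv.
have := has_cderivM (has_cderiv_weight k t r th) (has_cderiv_cst (ii * polar r th) t).
by rewrite mulr0 addr0.
Qed.

Lemma rayf_deriv k t eta rho :
  has_deriv (fun t => rayf (mono k) k%:R t eta rho) t (rayf (mono k.+1) k.+1%:R t eta rho).
Proof.
apply: K_weight_deriv.
have := has_cderivM (has_cderiv_weight k t rho eta) (has_cderiv_cst (polar 1 eta) t).
by rewrite mulr0 addr0.
Qed.

Lemma taylor2 (F0 F1 F2 : R -> E) t c d :
  (forall s, `|s| < d -> has_deriv F0 (t + s) (F1 (t + s))) ->
  (forall s, `|s| < d -> has_deriv F1 (t + s) (F2 (t + s))) ->
  (forall s, `|s| < d -> `|F2 (t + s)| <= c) ->
  forall s, `|s| < d -> `|F0 (t + s) - F0 t - s *: F1 t| <= c * s ^+ 2.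
Proof.
move=> d0 d1 H2 s sd.
pose F k := match k with 0 => F0 | 1 => F1 | _ => F2 end%N.
have := @taylor_bound _ _ 2 F t c d _ H2 s sd.
rewrite !big_ord_recl big_ord0 addr0 /bump/= expr0 fact0 divr1 scale1r expr1 divr1.
rewrite opprD addrA => H; apply: le_trans (H _) _.
  by move=> [|[|//]] y _ yd; [exact: d0|exact: d1].
have c0 : 0 <= c.
  by apply: le_trans (H2 0 _); rewrite ?normr0 ?(le_lt_trans _ sd).
rewrite -normrX ger0_norm ?sqr_ge0// ler_wpM2l// ler_piMr ?sqr_ge0//.
by rewrite invf_le1 ?ler1n.
Qed.

Section TimeDerivative.
Variables (t r eta : R).
Hypotheses (t0 : 0 < t) (r0 : 0 < r) (eta0 : 0 <= eta) (etaT : eta < Th) (cos_eta : cos eta < 0).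

Let b := t * (- cos eta) / 4.
Let b0 : 0 < b. Proof. by rewrite divr_gt0// mulr_gt0// oppr_gt0. Qed.
Let B n := n`!%:R / b ^+ n / r.
Let B0 n : 0 <= B n. Proof. by rewrite !divr_ge0 ?exprn_ge0 ?ler0n// ltW. Qed.
Let etaTn : `|eta| < Th. Proof. by rewrite ger0_norm. Qed.
Let Th0 : 0 < Th. Proof. exact: le_lt_trans eta0 etaT. Qed.

Lemma mono_le n x : r <= x -> 0 <= x ^+ n /\ x ^+ n <= B n * x * expR (b * x).
Proof.
move=> rx; have x0 := lt_le_trans r0 rx; split; first by rewrite exprn_ge0// ltW.
apply: le_trans (expn_le_expR n b0 (ltW x0)) _; rewrite ler_wpM2r ?expR_ge0//.
rewrite /B -mulrA ler_peMr ?divr_ge0 ?exprn_ge0 ?ler0n ?(ltW b0)//.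
by rewrite mulrC ler_pdivlMr// mul1r.
Qed.

Lemma near_time s : `|s| < t / 2 -> 0 <= t + s /\ (t + s) * cos eta <= - (2 * b) /\ t + s <= 2 * t.
Proof.
rewrite ltr_norml => /andP[s1 s2]; split; first by move: t0 s1; lra.
split; last by move: t0 s2; lra.
have -> : - (2 * b) = (t / 2) * cos eta by rewrite /b; field.
by rewrite ler_wnM2r ?(ltW cos_eta)//; move: t0 s1; lra.
Qed.

Lemma rayf_mono_decaying n s : `|s| < t / 2 ->
  decaying 0 (rayf (mono n) n%:R (t + s) eta) r (kap * B n) b.
Proof.
move=> st; have [_ [tb _]] := near_time st.
by apply: rayf_decaying => // x xr; [exact: mono_continuous|exact: mono_le].
Qed.

Lemma contour_deriv k :
  has_deriv (fun t => contour (mono k) k%:R t r eta) t (contour (mono k.+1) k.+1%:R t r eta).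
Proof.
have d0 : 0 < t / 2 by rewrite divr_gt0.
apply: has_derivD.
  apply: (@vint_param _ _ (fun t => arcf (mono k) k%:R t r) _ t (- Th) Th 0 eta
    (kap * r ^+ k.+2 * expR (2 * t * r)) (t / 2)) => //.
  - by rewrite oppr_lt0.
  - by move=> s _; exact: arcf_continuous_on.
  - exact: arcf_continuous_on.
  - move=> s x sd x0 xe; have xT : `|x| < Th by rewrite ger0_norm// (le_lt_trans xe).
    apply: (@taylor2 (fun t => arcf (mono k) k%:R t r x) (fun t => arcf (mono k.+1) k.+1%:R t r x)
      (fun t => arcf (mono k.+2) k.+2%:R t r x) t _ (t / 2)) sd => y yd.
    + exact: arcf_deriv.
    + exact: arcf_deriv.
    + have [y0 [_ y2]] := near_time yd.
      have rk : 0 <= r ^+ k.+2 by rewrite exprn_ge0// ltW.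
      apply: le_trans (arcf_norm _ _ r0 xT rk) _.
      apply: ler_wpM2l; first exact: mulr_ge0.
      rewrite ler_expR; apply: (@le_trans _ _ ((t + y) * r)).
        by apply: ler_wpM2l => //; apply: ler_piMr; [exact: ltW|exact: cos_le1].
      by apply: ler_wpM2r => //; exact: ltW.
have D0 : decaying 0 (rayf (mono k.+1) k.+1%:R t eta) r (kap * B k.+1) b.
  by rewrite -[t]addr0; apply: rayf_mono_decaying; rewrite normr0.
apply: (@vinf_param _ _ (fun t => rayf (mono k) k%:R t eta) _ t 0 r (kap * B k) _
    (kap * B k.+2) b (t / 2) d0 _ D0) => [s sd|s x sd rx]; first exact: rayf_mono_decaying.
apply: (@taylor2 (fun t => rayf (mono k) k%:R t eta x) (fun t => rayf (mono k.+1) k.+1%:R t eta x)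
  (fun t => rayf (mono k.+2) k.+2%:R t eta x) t _ (t / 2)) sd => y yd.
- exact: rayf_deriv.
- exact: rayf_deriv.
- by have [_ _ _ H] := rayf_mono_decaying k.+2 yd; exact: H.
Qed.

(** Cauchy estimates: the factor z^n is bounded by n! / b^n times a small
    exponential, both on the arc and on the ray. *)
Lemma contour_mono_norm : exists c, forall n s, `|s| < t / 2 ->
  `|contour (mono n) n%:R (t + s) r eta| <= c * (n`!%:R / b ^+ n).
Proof.
exists (kap * expR (b * r) * expR (2 * t * r) * eta + kap / r / b) => n s st.
have [ts0 [tb ts2]] := near_time st.
have nb0 : 0 <= n`!%:R / b ^+ n by rewrite divr_ge0 ?exprn_ge0 ?ler0n// ltW.
have H := @contour_norm (mono n) n%:R _ r eta b (B n) ts0 r0 eta0 etaT b0 (B0 n)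
  (fun x _ => @mono_continuous n x) (@mono_le n) tb.
apply: le_trans H _; rewrite [leRHS]mulrDl; apply: lerD; last first.
  by rewrite le_eqVlt; apply/orP; left; apply/eqP; rewrite /B; ring.
have -> : kap * expR (b * r) * expR (2 * t * r) * eta * (n`!%:R / b ^+ n) =
  kap * (n`!%:R / b ^+ n * expR (b * r)) * expR (2 * t * r) * eta by ring.
rewrite ler_wpM2r//; apply: ler_pM; rewrite ?mulr_ge0 ?expR_ge0 ?exprn_ge0 ?(ltW r0)//.
  by rewrite ler_wpM2l// expn_le_expR// ltW.
by rewrite ler_expR ler_wpM2r// ltW.
Qed.

End TimeDerivative.

Section Radius.
Variable t : R.
Hypothesis t0 : 0 <= t.
Local Notation arc := (arcf (mono 0%N) 0%:R t).
Local Notation ray := (rayf (mono 0%N) 0%:R t).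

Lemma weight0 r th : weight (mono 0%N) 0%:R t r th = cexp (Complex t 0 * polar r th).
Proof. by rewrite /weight mul0r expr0 polar1_0 mul1r. Qed.

(** The closed form K(z, e^(tz) dz) has equal mixed derivatives: the derivative
    in the argument of its radial component is the derivative in the radius of
    its angular component. *)
Definition ray' r x : E :=
  K1 (polar r x) (ii * polar r x * (cexp (Complex t 0 * polar r x) * polar 1 x)) +
  K (polar r x) (Complex t 0 * (ii * polar r x) * cexp (Complex t 0 * polar r x) * polar 1 x +
                 cexp (Complex t 0 * polar r x) * (ii * polar 1 x)).

Lemma ray_arg_deriv r x : 0 < r -> `|x| < Th -> has_deriv (fun y => ray y r) x (ray' r x).
Proof.
move=> r0 xT; have dp := has_cderiv_polar_arg r x.
have de := has_cderiv_cexp_comp (has_cderiv_cmul (Complex t 0) dp).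
have dw := has_cderivM de (has_cderiv_polar_arg 1 x).
have := K_deriv (sector_near_arg r0 xT) dp dw.
by apply: has_deriv_eq; exists 1 => // y _; rewrite /rayf weight0.
Qed.

(** The increment of the angular component in the radius splits into the increment
    of K in z, that of its derivative term and that of the weight; each is
    quadratic up to its linear part, uniformly in the argument. *)
Lemma arc_quad r : 0 < r -> exists c : R, forall s x, `|s| < r / 2 -> `|x| < Th ->
  `|arc (r + s) x - arc r x - s *: ray' r x| <= c * s ^+ 2.
Proof.
move=> r0.
pose ex := expR (2 * t * r).
pose W0 := ex * (2 * r); pose W1 := ex * (2 * t * r + 1); pose W2 := ex * (2 * t ^+ 2 * r + 2 * t).
exists (kap * W0 / (r ^+ 2 * (r / 2)) + kap * W1 / r ^+ 2 + kap * W2 / r) => s x sr xT.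
pose u : C := polar 1 x.
pose e y : C := cexp (Complex t 0 * polar y x).
pose w y : C := e y * (ii * polar y x).
pose w1 y : C := Complex t 0 * u * w y + e y * (ii * u).
pose w2 y : C := Complex t 0 * u * w1 y + Complex t 0 * u * e y * (ii * u).
have nu : normc u = 1 by rewrite normc_polar.
have dpr y : has_cderiv (fun y => polar y x) y u := has_cderiv_polar_radius y x.
have de y : has_cderiv e y (Complex t 0 * u * e y).
  exact: has_cderiv_cexp_comp (has_cderiv_cmul (Complex t 0) (dpr y)).
have dw y : has_cderiv w y (w1 y).
  have := has_cderivM (de y) (has_cderiv_cmul ii (dpr y)).
  by rewrite -[Complex t 0 * u * e y * _]mulrA.
have dw1 y : has_cderiv w1 y (w2 y).
  have H := has_cderivM (de y) (has_cderiv_cst (ii * u) y); rewrite mulr0 addr0 in H.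
  exact: has_cderivD (has_cderiv_cmul (Complex t 0 * u) (dw y)) H.
have yb y : `|y| < r / 2 -> r / 2 < r + y /\ r + y <= 2 * r.
  by rewrite ltr_norml => /andP[y1 y2]; split; lra.
have ne y : `|y| < r / 2 -> normc (e (r + y)) <= ex.
  move=> /yb[y1 y2]; rewrite normc_cexp /= mul0r subr0 /ex ler_expR.
  rewrite [2 * t]mulrC -mulrA; apply: ler_wpM2l => //.
  by apply: le_trans y2; apply: ler_piMr; [lra|exact: cos_le1].
have ex0 : 0 <= ex := expR_ge0 _.
have nt : normc (Complex t 0) = t by rewrite normc_real ger0_norm.
have ntu v : normc (Complex t 0 * u * v) = t * normc v.
  by rewrite Normc.normcM Normc.normcM nt nu mulr1.
have niu v : normc (v * (ii * u)) = normc v.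
  by rewrite Normc.normcM Normc.normcM normc_ii nu !mulr1.
have nw y : `|y| < r / 2 -> normc (w (r + y)) <= W0.
  move=> yr; have [y1 y2] := yb y yr.
  rewrite Normc.normcM Normc.normcM normc_ii mul1r normc_polar; last by lra.
  by apply: ler_pM; rewrite ?normc_ge0 ?ne//; lra.
have nw1 y : `|y| < r / 2 -> normc (w1 (r + y)) <= W1.
  move=> yr; apply: le_trans (le_normcD _ _) _.
  rewrite ntu niu.
  rewrite (_ : W1 = t * W0 + ex); last by rewrite /W1 /W0; ring.
  by apply: lerD; [apply: ler_wpM2l => //; exact: nw|exact: ne].
have nw2 y : `|y| < r / 2 -> normc (w2 (r + y)) <= W2.
  move=> yr; apply: le_trans (le_normcD _ _) _.
  rewrite ntu niu ntu.
  rewrite (_ : W2 = t * W1 + t * ex); last by rewrite /W2 /W1; ring.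
  by apply: lerD; apply: ler_wpM2l => //; [exact: nw1|exact: ne].
have arcE y : arc y x = K (polar y x) (w y) by rewrite /arcf weight0.
pose z := polar r x; pose z' := polar (r + s) x.
have [s1 s2] := yb s sr.
have zS : in_sector z by apply: in_sector_polar.
have zS' : in_sector z' by apply: in_sector_polar => //; lra.
have zE : z' - z = Complex s 0 * u.
  by rewrite /z' /z polar_scale (polar_scale r) -mulrBl; congr (_ * _); apply/eqP; rewrite eq_complex/= subrr addrC addKr !eqxx.
have nz : normc z = r by rewrite normc_polar// ltW.
have nz' : normc z' = r + s by rewrite normc_polar//; lra.
have rayE : ray' r x = K1 z (u * w r) + K z (w1 r).
  congr (K1 _ _ + K _ _).
    by rewrite /w /e /u /z [polar r x]polar_scale; ring.
  rewrite /w1 /w /e /u /z [polar r x]polar_scale; ring.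
have -> : arc (r + s) x - arc r x - s *: ray' r x =
   (K z' (w (r + s)) - K z (w (r + s)) - K1 z ((z' - z) * w (r + s))) +
   s *: (K1 z (u * w (r + s)) - K1 z (u * w r)) +
   (K z (w (r + s)) - K z (w r) - s *: K z (w1 r)).
  rewrite !arcE rayE zE -mulrA K1Z -/z -/z'; module R.
rewrite [leRHS]mulrDl [X in _ <= X + _]mulrDl; apply: le_trans (ler_normD _ _) _; apply: lerD.
  apply: le_trans (ler_normD _ _) _; apply: lerD.
    apply: le_trans (K_quad _ zS zS') _; rewrite zE Normc.normcM nu normc_real mulr1 nz nz'.
    rewrite -normrX ger0_norm ?sqr_ge0//.
    rewrite (_ : kap * W0 / _ * _ = kap * s ^+ 2 * W0 / (r ^+ 2 * (r / 2))); last by ring.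
    apply: ler_pM.
    - by rewrite mulr_ge0 ?normc_ge0// mulr_ge0// sqr_ge0.
    - by rewrite invr_ge0 mulr_ge0 ?exprn_ge0 ?(ltW r0)//; lra.
    - by apply: ler_wpM2l; [rewrite mulr_ge0// sqr_ge0|exact: nw].
    - rewrite lef_pV2 ?posrE ?mulr_gt0 ?exprn_gt0//; last by lra.
      by apply: ler_wpM2l; [rewrite exprn_ge0// ltW|lra].
  rewrite normrZ -[s ^+ 2]ger0_norm ?sqr_ge0// normrX expr2 [leRHS]mulrCA; apply: ler_wpM2l => //.
  have d2 : 0 < r / 2 by rewrite divr_gt0.
  have := @taylor_bound _ _ 1 (fun k => if k is 0%N then (fun y => K1 z (u * w y)) else (fun y => K1 z (u * w1 y)))
    r (kap * W1 / r ^+ 2) (r / 2) _ _ s sr.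
  rewrite big_ord_recl big_ord0 addr0/= expr0 fact0 divr1 scale1r expr1 divr1; apply.
    by move=> [|//] y _ yr; apply: K1_weight_deriv; exact: has_cderiv_cmul.
  move=> y yr /=; apply: le_trans (K1_norm _ zS) _; rewrite nz Normc.normcM nu mul1r.
  by rewrite ler_wpM2r ?invr_ge0 ?exprn_ge0 ?(ltW r0)// ler_wpM2l// nw1.
apply: (@taylor2 (fun y => K z (w y)) (fun y => K z (w1 y)) (fun y => K z (w2 y)) r _ (r / 2)) sr.
- by move=> y _; exact: K_weight_deriv.
- by move=> y _; exact: K_weight_deriv.
- move=> y yr; apply: le_trans (K_norm _ zS) _; rewrite nz.
  by rewrite ler_wpM2r ?invr_ge0 ?(ltW r0)// ler_wpM2l// nw2.
Qed.

(** By [arc_quad], the integral over the arc is differentiable in r with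
    derivative the integral of [ray'], a boundary term. *)
Lemma vint_arc_deriv r th1 th2 : 0 < r -> - Th < th1 -> th1 <= th2 -> th2 < Th ->
  has_deriv (fun r => vint (arc r) th1 th2) r (ray th2 r - ray th1 r).
Proof.
move=> r0 T1 th12 T2; have [c Hc] := arc_quad r0.
have [c0 c1] : - Th < (- Th + th1) / 2 /\ (- Th + th1) / 2 < th1 by rewrite !midf_lt.
move: (_ / 2) c0 c1 => th0 c0 c1.
apply: has_deriv_quad; exists (c * (th2 - th1)), (r / 2); split=> [|s sr]; first by rewrite divr_gt0.
have rs0 : 0 < r + s by move: sr; rewrite ltr_norml => /andP[+ _]; lra.
pose G x := vint (arc (r + s)) th0 x - vint (arc r) th0 x - s *: ray x r.
have cs := @arcf_continuous_on (mono 0%N) 0%:R t _ rs0.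
have cr := @arcf_continuous_on (mono 0%N) 0%:R t _ r0.
have -> : vint (arc (r + s)) th1 th2 - vint (arc r) th1 th2 - s *: (ray th2 r - ray th1 r) = G th2 - G th1.
  rewrite /G (vint_add cs c0 (ltW c1) th12 T2) (vint_add cr c0 (ltW c1) th12 T2).
  by module R.
rewrite mulrAC; apply: (mean_value_cst (f' := fun x => arc (r + s) x - arc r x - s *: ray' r x) th12) => x x1 x2; last first.
  by apply: (Hc s x sr); rewrite ltr_norml (lt_le_trans T1 x1) (le_lt_trans x2 T2).
have xT : `|x| < Th by rewrite ltr_norml (lt_le_trans T1 x1) (le_lt_trans x2 T2).
have x0 : th0 < x := lt_le_trans c1 x1.
apply: has_derivB; last by apply: has_derivZc; exact: ray_arg_deriv.
have xT2 := le_lt_trans x2 T2.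
by apply: has_derivB; [exact: (has_deriv_vint cs c0 x0 xT2)|exact: (has_deriv_vint cr c0 x0 xT2)].
Qed.

Lemma vinf_deriv (f : R -> E) a0 a c k x : decaying a0 f a c k -> a < x ->
  has_deriv (vinf f) x (- f x).
Proof.
move=> H ax; have [a0a k0 cf fc] := H.
have H1 : has_deriv (fun y => vinf f a - vint f a y) x (0 - f x).
  apply: has_derivB; first exact: has_deriv_cst.
  apply: (has_deriv_vint (decaying_cont (b := x + 1) H)) => //.
  by rewrite ltrDl.
rewrite sub0r in H1; apply: has_deriv_eq H1; exists (x - a); first by rewrite subr_gt0.
move=> y; rewrite ltr_norml => /andP[+ _]; rewrite opprB ltrBDr subrK => ay.
rewrite (vinf_split H (ltW ay)); module R.
Qed.

(** On the positive real axis the density is real and K takes imaginary parts,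
    so that the half contour needs no closing segment. *)
Lemma ray_real r : 0 < r -> ray 0 r = 0.
Proof.
move=> r0; rewrite /rayf weight0 polar1_0 mulr1 /cexp /polar /= sin0 cos0.
by rewrite !mulr0 !mul0r addr0 sin0 mulr0; have := K_real (expR (t * (r * 1) - 0) * cos 0) r0; rewrite /polar cos0 sin0 mulr0.
Qed.

End Radius.

(** The derivatives in r of the two parts cancel. *)
Lemma contour_radius t eta r1 r2 : 0 < t -> 0 <= eta -> eta < Th -> cos eta < 0 ->
  0 < r1 -> 0 < r2 ->
  contour (mono 0%N) 0%:R t r1 eta = contour (mono 0%N) 0%:R t r2 eta.
Proof.
move=> t0 e0 eT ce; wlog r12 : r1 r2 / r1 <= r2 => [H|r10 r20].
  move=> r10 r20; have [r12|/ltW r21] := leP r1 r2; first exact: H.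
  by apply/esym; exact: H.
apply/esym; apply: (@deriv0_const _ _ (fun r => contour (mono 0%N) 0%:R t r eta) r1 r2 r12) => r rr1 rr2.
have r0 : 0 < r := lt_le_trans r10 rr1.
have r20' : 0 < r / 2 by rewrite divr_gt0.
have H0 : `|0 : R| < t / 2 by rewrite normr0 divr_gt0.
have := rayf_mono_decaying t0 r20' e0 eT ce 0%N H0; rewrite addr0 => D.
have Hr : r / 2 < r by rewrite ltr_pdivrMr// mulr_natr mulr2n ltrDl.
have Th0 : - Th < 0 by rewrite oppr_lt0 (le_lt_trans e0).
have := has_derivD (vint_arc_deriv (ltW t0) r0 Th0 e0 eT) (vinf_deriv D Hr).
by rewrite ray_real// subr0 subrr.
Qed.

End Kernel.

(** * The scalar Cauchy kernel *)

Section ScalarKernel.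
Context {R : realType}.
Local Notation C := R[i].
Local Notation normc := (@Normc.normc R).
Local Notation mono k := (fun x : R => x ^+ k).
Implicit Types (t r s x th eta : R) (z w : C).

(** For this kernel the contour integral is the imaginary part of the integral of
    e^(tz) dz / z. *)
Definition cauchy_kernel z w : R^o := complex.Im (w / z).
Definition cauchy_kernel' z w : R^o := - complex.Im (w / z ^+ 2).

Local Notation K := cauchy_kernel.
Local Notation K1 := cauchy_kernel'.
Local Notation Th := (pi + 1 : R).

Lemma ImD z w : complex.Im (z + w) = complex.Im z + complex.Im w.
Proof. by case: z w => [? ?] []. Qed.

Lemma ImN z : complex.Im (- z) = - complex.Im z.
Proof. by case: z. Qed.

Lemma ImZ r w : complex.Im (Complex r 0 * w) = r * complex.Im w.
Proof. by case: w => a b /=; rewrite mul0r addr0. Qed.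

Lemma normcX z n : normc (z ^+ n) = normc z ^+ n.
Proof.
elim: n => [|n IH]; first by rewrite !expr0 /= expr0n/= addr0 expr1n sqrtr1.
by rewrite !exprS Normc.normcM IH.
Qed.

Lemma cauchy_KD z w w' : K z (w + w') = K z w + K z w'.
Proof. by rewrite /K mulrDl ImD. Qed.

Lemma cauchy_KZ z r w : K z (Complex r 0 * w) = r *: K z w.
Proof. by rewrite /K -mulrA ImZ. Qed.

Lemma cauchy_K1D z w w' : K1 z (w + w') = K1 z w + K1 z w'.
Proof. by rewrite /K1 mulrDl ImD opprD. Qed.

Lemma cauchy_K1Z z r w : K1 z (Complex r 0 * w) = r *: K1 z w.
Proof. by rewrite /K1 -mulrA ImZ -mulrN. Qed.

Lemma cauchy_K_norm z w : in_sector Th z -> `|K z w| <= 1 * normc w / normc z.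
Proof. by move=> _; rewrite mul1r -Normc.normcV -Normc.normcM; exact: normc_Im. Qed.

Lemma cauchy_K1_norm z w : in_sector Th z -> `|K1 z w| <= 1 * normc w / normc z ^+ 2.
Proof.
by move=> _; rewrite mul1r -normcX -Normc.normcV -Normc.normcM normrN; exact: normc_Im.
Qed.

Lemma cauchy_K_quad z z' w : in_sector Th z -> in_sector Th z' ->
  `|K z' w - K z w - K1 z ((z' - z) * w)| <= 1 * normc (z' - z) ^+ 2 * normc w / (normc z ^+ 2 * normc z').
Proof.
move=> /in_sector_normc nz /in_sector_normc nz'.
have z0 : z != 0 by apply: contraTneq nz => ->; rewrite Normc.normc0 ltxx.
have z'0 : z' != 0 by apply: contraTneq nz' => ->; rewrite Normc.normc0 ltxx.
rewrite /K /K1 opprK -ImN -!ImD.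
have -> : w / z' - w / z + (z' - z) * w / z ^+ 2 = (z' - z) ^+ 2 * w / (z ^+ 2 * z').
  by field; rewrite z0 z'0.
by rewrite mul1r -!normcX -!Normc.normcM -Normc.normcV -Normc.normcM; exact: normc_Im.
Qed.

Lemma cauchy_K_real r s : 0 < r -> K (polar r 0) (Complex s 0) = 0.
Proof.
move=> r0; have -> : polar r 0 = (Complex r 0 : C) by rewrite /polar cos0 sin0 mulr1 mulr0.
have -> : (Complex s 0 : C) = Complex s 0 * 1 by rewrite mulr1.
by rewrite cauchy_KZ /K mul1r /GRing.inv/= mul0r oppr0 scaler0.
Qed.

Lemma cauchy_is_kernel : is_kernel K K1 Th 1.
Proof.
split; [exact: cauchy_KD|exact: cauchy_KZ|exact: cauchy_K1D|exact: cauchy_K1Z|exact: ler01|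
  exact: cauchy_K_norm|exact: cauchy_K1_norm|exact: cauchy_K_quad].
Qed.

Lemma cauchy_arcf t r th : 0 < r ->
  arcf K (mono 0) 0%:R t r th = complex.Re (cexp (Complex t 0 * polar r th)).
Proof.
move=> r0; rewrite /arcf weight0 /K.
have z0 : polar r th != 0.
  by apply/eqP => E; have := r0; rewrite -(normc_polar th (ltW r0)) E Normc.normc0 ltxx.
rewrite mulrA mulfK//; case: (cexp _) => a b /=; ring.
Qed.

Lemma cauchy_rayf t eta rho : 0 < rho ->
  rayf K (mono 0) 0%:R t eta rho = rho^-1 * complex.Im (cexp (Complex t 0 * polar rho eta)).
Proof.
move=> r0; rewrite /rayf weight0 /K -ImZ; congr complex.Im.
have z0 : polar 1 eta != 0.
  by apply/eqP => E; have := @ltr01 R; rewrite -(normc_polar eta ler01) E Normc.normc0 ltxx.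
have r00 : Complex rho 0 != 0 :> C.
  by rewrite eq_complex/= eqxx andbT gt_eqF.
rewrite [in RHS]mulrC (_ : Complex rho^-1 0 = (Complex rho 0)^-1); last first.
  apply: (mulfI r00); rewrite divff//; apply/eqP; rewrite eq_complex/=.
  by rewrite !mul0r mulr0 subr0 addr0 eqxx andbT divff// gt_eqF.
rewrite [X in _ / X]polar_scale; move: (cexp _) (polar 1 eta) (Complex rho 0) z0 r00 => a b c b0 c0.
by field; rewrite b0 c0.
Qed.

Lemma cauchy_rayf_pi t rho : 0 < rho -> rayf K (mono 0) 0%:R t pi rho = 0.
Proof.
by move=> r0; rewrite cauchy_rayf//= sinpi !mulr0 mul0r addr0 sin0 !mulr0.
Qed.

Lemma cos_obtuse eta : pi / 2 < eta -> eta < pi -> cos eta < 0.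
Proof.
move=> e1 e2; rewrite -(cos_pihalf R); have p0 := pi_gt0 R.
by rewrite ltr_cos// in_itv/=; apply/andP; split; lra.
Qed.

(** The boundary terms on the real axis vanish, so the integral does not
    depend on r; as r tends to 0 the integrand Re e^(tz) tends to 1. *)
Lemma cauchy_half_circle t r : 0 < t -> 0 < r -> vint (arcf K (mono 0) 0%:R t r) 0 pi = pi.
Proof.
move=> t0 r0; have p0 := pi_gt0 R; have T0 : - Th < 0 by lra.
have T1 : pi < Th by lra.
have cst r1 r2 : 0 < r1 -> r1 <= r2 ->
    vint (arcf K (mono 0) 0%:R t r2) 0 pi = vint (arcf K (mono 0) 0%:R t r1) 0 pi.
  move=> r10 r12; apply: (@deriv0_const _ _ (fun r => vint (arcf K (mono 0) 0%:R t r) 0 pi) r1 r2 r12) => x x1 _.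
  have x0 := lt_le_trans r10 x1.
  have := vint_arc_deriv cauchy_is_kernel (ltW t0) x0 T0 (ltW p0) T1.
  rewrite cauchy_rayf_pi// (ray_real cauchy_K_real)// subrr; exact.
apply/eqP; rewrite -subr_eq0 -normr_le0; apply/ler_addgt0Pr => e e0; rewrite add0r.
pose k := t * expR t; have k0 : 0 < k by rewrite mulr_gt0 ?expR_gt0.
pose s := Num.min (Num.min 1 r) (e / (k * pi)).
have s0 : 0 < s by rewrite !lt_min ltr01 r0 divr_gt0// mulr_gt0.
have sr : s <= r by rewrite !ge_min lexx orbT.
have s1 : s <= 1 by rewrite !ge_min lexx.
rewrite (cst s r s0 sr).
have := @vint_near_cst _ _ (- Th) Th 0 pi (arcf K (mono 0) 0%:R t s) (1 : R^o) (k * s)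
  (arcf_continuous_on cauchy_is_kernel s0) T0 (ltW p0) T1.
rewrite subr0 -[pi *: 1]/(pi * 1) mulr1 => H; apply: le_trans (H _) _; last first.
  have kp0 : 0 < k * pi by exact: mulr_gt0.
  have : s * (k * pi) <= e by rewrite -ler_pdivlMr//; rewrite !ge_min lexx !orbT.
  by rewrite mulrCA mulrA.
move=> th _ _; rewrite cauchy_arcf//.
pose z : C := Complex t 0 * polar 1 th.
have zE y : Complex t 0 * polar y th = Complex y 0 * z by rewrite polar_scale mulrCA.
have nz : normc z = t by rewrite Normc.normcM normc_real normc_polar// mulr1 gtr0_norm.
have := @mean_value_cst R R^o (fun y => complex.Re (cexp (Complex y 0 * z)))
  (fun y => complex.Re (z * cexp (Complex y 0 * z))) k 0 s (ltW s0).
have -> : complex.Re (cexp (Complex 0 0 * z)) = 1 by rewrite mul0r /cexp/= expR0 cos0 mulr1.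
rewrite subr0 zE; apply => y y0 ys.
  by have [] := has_cderiv_cexp z y.
apply: le_trans (normc_Re _) _; rewrite Normc.normcM nz normc_cexp ler_wpM2l ?(ltW t0)//.
rewrite ler_expR; apply: le_trans (ler_norm _) _; apply: le_trans (normc_Re _) _.
rewrite Normc.normcM nz normc_real ger0_norm// ler_piMl ?(ltW t0)//.
exact: le_trans ys s1.
Qed.

(** The ray can be replaced by the remaining arc up to pi: by [vint_arc_deriv] that
    arc is a primitive of the ray, and it tends to 0 at infinity as cos < 0 on
    it. *)
Lemma cauchy_ray_part t r eta : 0 < t -> 0 < r -> pi / 2 < eta -> eta < pi ->
  ray_part K (mono 0) 0%:R t r eta = vint (arcf K (mono 0) 0%:R t r) eta pi.
Proof.
move=> t0 r0 e1 e2; have p0 := pi_gt0 R; have eT : eta < Th by lra.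
have e0 : 0 <= eta by lra.
have T0 : - Th < eta by lra.
have T1 : pi < Th by lra.
have ce := cos_obtuse e1 e2.
have := rayf_mono_decaying cauchy_is_kernel t0 r0 e0 eT ce 0%N (s := 0).
rewrite normr0 divr_gt0// addr0 => /(_ isT) D.
pose F r := - vint (arcf K (mono 0) 0%:R t r) eta pi : R^o.
have := @vinf_FTC R R^o _ _ _ _ _ F 0 D; rewrite /F sub0r opprK; apply.
  move=> x x0.
  have := has_derivB (has_deriv_cst 0 x) (vint_arc_deriv cauchy_is_kernel (ltW t0) x0 T0 (ltW e2) T1).
  rewrite cauchy_rayf_pi// sub0r sub0r opprK.
  by apply: has_deriv_eq; exists 1 => // y _; rewrite sub0r.
apply/cvgrPdist_le => e ep; rewrite /= .
pose k := t * - cos eta; have k0 : 0 < k by rewrite mulr_gt0// oppr_gt0.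
have e'0 : 0 < e / (pi - eta) by rewrite divr_gt0// subr_gt0.
near=> h; have h0 : 0 < h by near: h; exact: nbhs_pinfty_gt.
rewrite sub0r opprK.
apply: le_trans (vint_norm_cst (k := expR (- k * h)) T0 (ltW e2) T1 (arcf_continuous_on cauchy_is_kernel h0) _) _.
  move=> x x1 x2; apply: le_trans (arcf_norm cauchy_is_kernel 0%:R t h0 _ _) _.
  - by rewrite ger0_norm; lra.
  - by rewrite expr0.
  - rewrite expr0 !mul1r ler_expR /k !mulNr mulrN mulNr opprK -mulrA [cos eta * _]mulrC.
    rewrite ler_wpM2l ?(ltW t0)// ler_wpM2l ?(ltW h0)//.
    have [->//|xe] := eqVneq x eta; apply: ltW.
    rewrite ltr_cos ?in_itv/= ?lt_neqAle 1?eq_sym ?xe ?x1// ?x2 ?andbT; lra.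
rewrite -ler_pdivlMr ?subr_gt0//; apply: (expR_small k0 e'0).
near: h; exact: (nbhs_pinfty_ge (num_real _)).
Unshelve. all: by end_near. Qed.

Lemma cauchy_contour t r eta : 0 < t -> 0 < r -> pi / 2 < eta -> eta < pi ->
  contour K (mono 0) 0%:R t r eta = pi.
Proof.
move=> t0 r0 e1 e2; have p0 := pi_gt0 R.
rewrite /contour cauchy_ray_part// -[RHS](cauchy_half_circle t0 r0).
apply/esym; apply: (vint_add (arcf_continuous_on cauchy_is_kernel r0)); lra.
Qed.

(** The derivative in time of the constant pi. *)
Lemma cauchy_contour1 t r eta : 0 < t -> 0 < r -> pi / 2 < eta -> eta < pi ->
  contour K (mono 1) 1%:R t r eta = 0.
Proof.
move=> t0 r0 e1 e2; have p0 := pi_gt0 R; have e0 : 0 <= eta by lra.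
have eT : eta < Th by lra.
have := contour_deriv cauchy_is_kernel t0 r0 e0 eT (cos_obtuse e1 e2) 0%N.
move/has_deriv_unique; apply.
have := @has_deriv_cst R R^o pi t; apply: has_deriv_eq; exists t => // y yt.
rewrite cauchy_contour//; move: yt; rewrite ltr_norml => /andP[+ _]; lra.
Qed.

End ScalarKernel.

(** * Pairing conjugate points of the contour *)

Section SkewKernel.
Context {R : realType} {E : completeNormedModType R}.
Local Notation C := R[i].
Local Notation normc := (@Normc.normc R).
Local Notation mono k := (fun x : R => x ^+ k).
Implicit Types (t r eta th rho : R) (z w : C).
Variables (H H1 : C -> C -> E) (Th kap : R).
Hypothesis HH : is_kernel H H1 Th kap.

Lemma cbarD z w : cbar (z + w) = cbar z + cbar w.
Proof. by case: z w => [a b] [c d]; rewrite /cbar/= opprD. Qed.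

Lemma cbarN z : cbar (- z) = - cbar z.
Proof. by case: z. Qed.

Lemma cbarM z w : cbar (z * w) = cbar z * cbar w.
Proof.
by case: z w => [a b] [c d]; apply/eqP; rewrite eq_complex/=; apply/andP; split; apply/eqP; ring.
Qed.

Lemma in_sector_cbar z : in_sector Th z -> in_sector Th (cbar z).
Proof. by move=> [r [t [r0 td ->]]]; exists r, (- t); rewrite normrN polar_cbar. Qed.

(** Half the contribution of two conjugate points of a contour that is symmetric
    about the real axis; dz changes to its opposite conjugate. *)
Definition skew (K : C -> C -> E) z w : E := (2^-1 : R) *: (K z w - K (cbar z) (cbar w)).

Lemma half_norm (u v : E) (c : R) : `|u| <= c -> `|v| <= c -> `|(2^-1 : R) *: (u - v)| <= c.
Proof.
move=> uc vc; rewrite normrZ ger0_norm// ler_pdivrMl// (le_trans (ler_normB _ _))//.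
by rewrite mulr_natl mulr2n lerD.
Qed.

Lemma skew_is_kernel : is_kernel (skew H) (skew H1) Th kap.
Proof.
split; rewrite /skew.
- by move=> z w w'; rewrite cbarD !(kernelD HH); module R.
- move=> z r w; rewrite cbarM (_ : cbar (Complex r 0) = Complex r 0).
    by rewrite !(kernelZ HH); module R.
  by rewrite /cbar/= oppr0.
- by move=> z w w'; rewrite cbarD !(kernel'D HH); module R.
- move=> z r w; rewrite cbarM (_ : cbar (Complex r 0) = Complex r 0).
    by rewrite !(kernel'Z HH); module R.
  by rewrite /cbar/= oppr0.
- exact: kernel_ge0 HH.
- move=> z w zS; apply: half_norm; first exact: kernel_norm HH _ _ zS.
  rewrite -(normc_cbar w) -(normc_cbar z).
  exact: kernel_norm HH _ _ (in_sector_cbar zS).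
- move=> z w zS; apply: half_norm; first exact: kernel'_norm HH _ _ zS.
  rewrite -(normc_cbar w) -(normc_cbar z).
  exact: kernel'_norm HH _ _ (in_sector_cbar zS).
- move=> z z' w zS zS'.
  have H2 := kernel_quad HH w zS zS'.
  have := kernel_quad HH (cbar w) (in_sector_cbar zS) (in_sector_cbar zS').
  rewrite -cbarN -cbarD -cbarM !normc_cbar => H3.
  by apply: le_trans (half_norm H2 H3); rewrite le_eqVlt; apply/orP; left; apply/eqP; congr `|_|; module R.
Qed.

Lemma arcf_skew t r th : arcf (skew H) (mono 0%N) 0%:R t r th =
  (2^-1 : R) *: (arcf H (mono 0%N) 0%:R t r th + arcf H (mono 0%N) 0%:R t r (- th)).
Proof.
rewrite /arcf /skew; congr (_ *: (_ + _)); rewrite -(kernelN HH) !weight0 !cbarM -cexp_cbar cbarM polar_cbar.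
have -> : cbar (Complex t 0) = Complex t 0 by rewrite /cbar/= oppr0.
have -> : cbar (Complex 0 1) = - Complex 0 1 :> C by apply/eqP; rewrite eq_complex/= oppr0 !eqxx.
by rewrite !(mulNr, mulrN, opprK).
Qed.

Lemma rayf_skew t eta rho : rayf (skew H) (mono 0%N) 0%:R t eta rho =
  (2^-1 : R) *: (rayf H (mono 0%N) 0%:R t eta rho - rayf H (mono 0%N) 0%:R t (- eta) rho).
Proof.
rewrite /rayf /skew; congr (_ *: (_ - _)); rewrite !weight0 !cbarM -cexp_cbar cbarM !polar_cbar.
by have -> : cbar (Complex t 0) = Complex t 0 by rewrite /cbar/= oppr0.
Qed.

Variables (t r eta : R).
Hypotheses (t0 : 0 < t) (r0 : 0 < r) (eta0 : 0 <= eta) (etaT : eta < Th) (cos_eta : cos eta < 0).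

Lemma full_ray_decaying (e : R) : `|e| < Th -> cos e = cos eta ->
  decaying 0 (rayf H (mono 0%N) 0%:R t e) r (kap * r^-1) (t * (- cos eta) / 2).
Proof.
move=> eT ce; set b := _ / 2; have b0 : 0 < b by rewrite divr_gt0// mulr_gt0// oppr_gt0.
have ri : 0 <= r^-1 by rewrite invr_ge0 ltW.
have tb : t * cos e <= - (2 * b).
  by rewrite ce /b le_eqVlt; apply/orP; left; apply/eqP; field.
apply: (rayf_decaying HH 0%:R r0 eT b0 ri _ _ tb) => [x _|x rx]; first exact: mono_continuous.
rewrite expr0; split=> //; have x0 := lt_le_trans r0 rx.
rewrite [_ * x]mulrC; apply: (@le_trans _ _ (x / r * 1)).
  by rewrite mulr1 ler_pdivlMr// mul1r.
rewrite ler_wpM2l ?divr_ge0 ?(ltW x0) ?(ltW r0)//.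
by rewrite -[leLHS]expR0 ler_expR mulr_ge0 ?(ltW b0) ?(ltW x0).
Qed.

(** The lower half of the contour is the reflection of the upper half with the
    opposite orientation, so the two halves combine into the skew kernel. *)
Lemma full_contour :
  vinf (fun x => - rayf H (mono 0%N) 0%:R t (- eta) x) r +
  vint (arcf H (mono 0%N) 0%:R t r) (- eta) eta + vinf (rayf H (mono 0%N) 0%:R t eta) r =
  (2 : R) *: contour (skew H) (mono 0%N) 0%:R t r eta.
Proof.
have Th0 : - Th < 0 by rewrite oppr_lt0 (le_lt_trans eta0).
have eT : `|eta| < Th by rewrite ger0_norm.
have eTN : `|- eta| < Th by rewrite normrN.
have D1 := full_ray_decaying eT erefl.
have D2 := full_ray_decaying eTN (cosN _).
have cH := @arcf_continuous_on _ _ _ _ _ _ HH (mono 0%N) 0%:R t r r0.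
have cS := @arcf_continuous_on _ _ _ _ _ _ skew_is_kernel (mono 0%N) 0%:R t r r0.
have -> : vint (arcf H (mono 0%N) 0%:R t r) (- eta) eta = (2 : R) *: arc_part (skew H) (mono 0%N) 0%:R t r eta.
  have Te : - Th < - eta by rewrite ltrN2.
  have eN : - eta <= 0 by rewrite oppr_le0.
  rewrite (vint_add cH Te eN eta0 etaT).
  have cN : continuous_on (- Th) Th (fun x => arcf H (mono 0%N) 0%:R t r (- x)).
    by move=> x x1 x2; apply: continuous_reflect; apply: cH; [rewrite ltrN2|rewrite ltrNl].
  have := vint_reflect Th0 eta0 etaT cN; rewrite oppr0.
  under eq_fun do rewrite opprK.
  move=> ->; rewrite -(vintD Th0 eta0 etaT cN cH) -(vintZ _ Th0 eta0 etaT cS).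
  apply: (vint_ext Th0 eta0 etaT); first by move=> x x1 x2; apply: cvgD; [exact: cN|exact: cH].
  by move=> x x1 x2; rewrite arcf_skew scalerA divff// scale1r addrC.
have -> : vinf (fun x => - rayf H (mono 0%N) 0%:R t (- eta) x) r = - vinf (rayf H (mono 0%N) 0%:R t (- eta)) r.
  rewrite -[RHS]scaleN1r -(vinfZ (-1) D2); congr (vinf _ r); apply/funext => x; exact/esym/scaleN1r.
rewrite scalerDr.
have -> : ray_part (skew H) (mono 0%N) 0%:R t r eta = (2^-1 : R) *: (vinf (rayf H (mono 0%N) 0%:R t eta) r - vinf (rayf H (mono 0%N) 0%:R t (- eta)) r).
  rewrite -(vinfB D1 D2) -(vinfZ _ (decayingB D1 D2)); congr (vinf _ r).
  by apply/funext => x; exact: rayf_skew.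
by module R.
Qed.

End SkewKernel.

(** * The kernel of a sectorial operator *)

Section OperatorKernel.
Context {R : realType} {K : starAlgebra R} {X : banachBimodule K}.
Variables (A : rightOperator X) (delta M : R).
Hypothesis delta_lt : delta < pi / 2.
Hypothesis A_sectorial : spherical_sectorial delta A.
Hypothesis M_gt0 : 0 < M.
Hypothesis C_bound : forall a : K, Sigma delta a ->
  (opnorm (Cres A a) <= (M / sa_norm a)%:E)%E.
Local Notation normc := (@Normc.normc R).
Local Notation mono k := (fun x : R => x ^+ k).
Local Notation Th := (pi / 2 + delta).
Implicit Types (t r eta th rho : R) (z w : R[i]) (j k : K).

(** C_z(A) dz / j for dz = w, the integrand that defines T. *)
Definition slice_kernel j z w : Lr X := Lr_ract (Cz A j z) (slice j (Complex 0 (-1) * w)).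
Definition slice_kernel' j z w : Lr X := Lr_ract (Cz' A j z) (slice j (Complex 0 (-1) * w)).
(** The three terms bound C_z, its derivative and the quadratic remainder. *)
Definition slice_const := 2 * M + Rz_const M * M + Rz_const M ^+ 2 * M.

Lemma normc_mi w : normc (Complex 0 (-1) * w) = normc w.
Proof. by rewrite Normc.normcM /= expr0n/= add0r sqrrN expr1n sqrtr1 mul1r. Qed.

(** The estimates are those of C_z and C_z', by the resolvent identity. *)
Lemma slice_kernelP j : SA j -> is_kernel (slice_kernel j) (slice_kernel' j) Th slice_const.
Proof.
move=> jP; have c0 : 0 <= Rz_const M by rewrite /Rz_const addr_ge0 ?mulr_ge0 ?sqr_ge0 ?(ltW M_gt0).
have M0 := ltW M_gt0.
have k1 : M <= slice_const by rewrite /slice_const; have := mulr_ge0 c0 M0; have := mulr_ge0 (sqr_ge0 (Rz_const M)) M0; lra.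
have k2 : Rz_const M * M <= slice_const by rewrite /slice_const; have := mulr_ge0 (sqr_ge0 (Rz_const M)) M0; lra.
have k3 : Rz_const M ^+ 2 * M <= slice_const by rewrite /slice_const; have := mulr_ge0 c0 M0; lra.
have kZ (B : Lr X) r w : Lr_ract B (slice j (Complex 0 (-1) * (Complex r 0 * w))) = r *: Lr_ract B (slice j (Complex 0 (-1) * w)).
  by rewrite mulrCA [in LHS](sliceM jP) slice_real -scalerAl mul1r Lr_actZr.
have kD (B : Lr X) w w' : Lr_ract B (slice j (Complex 0 (-1) * (w + w'))) =
    Lr_ract B (slice j (Complex 0 (-1) * w)) + Lr_ract B (slice j (Complex 0 (-1) * w')).
  by rewrite mulrDr sliceD Lr_actDr.
split; rewrite /slice_kernel /slice_kernel' => //.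
- by apply: le_trans k1.
- move=> z w zS; have nz := in_sector_normc zS; apply: le_trans (act_slice_norm jP _ _) _; rewrite normc_mi.
  apply: (@le_trans _ _ (normc w * (M / normc z))).
    by apply: ler_wpM2l; [exact: normc_ge0|exact: (Cz_norm delta_lt A_sectorial M_gt0 C_bound jP zS)].
  rewrite mulrC mulrAC; apply: ler_wpM2r; first by rewrite invr_ge0 ltW.
  by apply: ler_wpM2r; rewrite ?normc_ge0.
- move=> z w zS; have nz := in_sector_normc zS; apply: le_trans (act_slice_norm jP _ _) _; rewrite normc_mi.
  apply: (@le_trans _ _ (normc w * (Rz_const M / normc z * (M / normc z)))).
    by apply: ler_wpM2l; [exact: normc_ge0|exact: (Cz'_norm delta_lt A_sectorial M_gt0 C_bound jP zS)].
  rewrite [leLHS](_ : _ = Rz_const M * M * normc w / normc z ^+ 2); last first.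
    by move: (Rz_const M) (normc w) (normc z) nz => c n1 n2 n0; field; rewrite gt_eqF.
  apply: ler_wpM2r; first by rewrite invr_ge0 exprn_ge0// ltW.
  by apply: ler_wpM2r; rewrite ?normc_ge0.
- move=> z z' w zS zS'; have nz := in_sector_normc zS; have nz' := in_sector_normc zS'.
  have -> : Lr_ract (Cz A j z') (slice j (Complex 0 (-1) * w)) - Lr_ract (Cz A j z) (slice j (Complex 0 (-1) * w)) -
      Lr_ract (Cz' A j z) (slice j (Complex 0 (-1) * ((z' - z) * w))) =
     Lr_ract (Cz A j z' - Cz A j z - Lr_ract (Cz' A j z) (slice j (z' - z))) (slice j (Complex 0 (-1) * w)).
    by move: (Cz' A j z) => D; rewrite !(Lr_actD, Lr_actN) Lr_actA mulrCA (sliceM jP (z' - z)).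
  apply: le_trans (act_slice_norm jP _ _) _; rewrite normc_mi.
  apply: (@le_trans _ _ (normc w * (normc (z' - z) ^+ 2 * ((Rz_const M / normc z) ^+ 2 * (M / normc z'))))).
    by apply: ler_wpM2l; [exact: normc_ge0|exact: (Cz_quad delta_lt A_sectorial M_gt0 C_bound jP zS zS')].
  rewrite [leLHS](_ : _ = Rz_const M ^+ 2 * M * (normc (z' - z) ^+ 2 * normc w / (normc z ^+ 2 * normc z'))); last first.
    by move: (Rz_const M) (normc w) (normc (z' - z)) (normc z) (normc z') nz nz' => c n1 n4 n2 n3 n20 n30; field; rewrite !gt_eqF.
  rewrite [leRHS](_ : _ = slice_const * (normc (z' - z) ^+ 2 * normc w / (normc z ^+ 2 * normc z'))); last by ring.
  apply: ler_wpM2r => //; rewrite divr_ge0 ?mulr_ge0 ?sqr_ge0 ?normc_ge0//.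
Qed.

Definition kernel j := skew (slice_kernel j).
Definition kernel' j := skew (slice_kernel' j).

Lemma kernelP j : SA j -> is_kernel (kernel j) (kernel' j) Th slice_const.
Proof. by move=> /slice_kernelP; exact: skew_is_kernel. Qed.

(** C_z = P - Y j at z and P + Y j at the conjugate point. *)
Lemma kernelE j z w : SA j -> in_sector Th z -> kernel j z w = Kz A j z w.
Proof.
move=> jP zS; rewrite /kernel /skew /slice_kernel.
rewrite (Cz_cbar delta_lt A_sectorial C_bound jP zS) (CzPY delta_lt A_sectorial C_bound jP zS) /Kz.
move: (Pz A j z) (Yz A j z) => P Y; case: w => a b.
have -> : slice j (Complex 0 (-1) * Complex a b) = b%:A + (- a) *: j.
  by rewrite /slice/=; congr (_ %:A + _ *: _); ring.
have -> : slice j (Complex 0 (-1) * cbar (Complex a b)) = (- b)%:A + (- a) *: j.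
  by rewrite /slice/=; congr (_ %:A + _ *: _); ring.
rewrite !(Lr_actD, Lr_actDr, Lr_actN, Lr_act_real, Lr_actZr) !Lr_actA (unit_sqrA jP) !Lr_act_real /=.
by module R.
Qed.

Lemma kernel_real j r s : SA j -> 0 < delta -> 0 < r -> kernel j (polar r 0) (Complex s 0) = 0.
Proof.
move=> jP d0 r0; rewrite kernelE//; last first.
  by exists r, 0; split=> //; rewrite normr0 addr_gt0// divr_gt0// pi_gt0.
by rewrite /Kz /Yz/= sin0 mulr0 !scale0r scaler0 subr0.
Qed.

Section Contours.
Variables (j : K) (t r eta : R).
Hypotheses (jP : SA j) (t0 : 0 < t) (r0 : 0 < r) (eta1 : pi / 2 < eta) (etaT : eta < Th).
Local Notation Psi := (semigroup_integrand A j t).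
Local Notation H := (slice_kernel j).

Lemma contour_integrandE (g : R -> R[i]) (s : R) z w : has_cderiv g s w -> g s = z ->
  contour_integrand j g Psi s = H z (cexp (Complex t 0 * z) * w).
Proof.
move=> [g1 g2] gs; rewrite /contour_integrand /semigroup_integrand gs.
have -> : path_deriv g s = w.
  have /has_derivP[_ E1] := g1; have /has_derivP[_ E2] := g2.
  by rewrite /path_deriv !derive1E E1 E2; case: (w).
by rewrite -(slice_invi jP) !Lr_actA -!sliceM// /slice_kernel /Cz mulrA.
Qed.

Lemma has_cderiv_opp (g : R -> R[i]) (x : R) (v : R[i]) : has_cderiv g (- x) v -> has_cderiv (fun s => g (- s)) x (- v).
Proof.
have dN : has_deriv (fun s : R => - s) x (-1).
  have := has_deriv_lmul (-1) x; apply: has_deriv_eq; exists 1 => // y _; exact: mulN1r.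
move=> [g1 g2]; have := has_deriv_comp dN g1; have := has_deriv_comp dN g2.
by rewrite !scaleN1r => h2 h1; split; case: (v) h1 h2.
Qed.

Lemma ray_out_integrand : contour_integrand j (ray_out eta) Psi = rayf H (mono 0%N) 0%:R t eta.
Proof.
apply/funext => s; rewrite (@contour_integrandE _ _ _ _ (has_cderiv_polar_radius s eta) erefl).
by rewrite /rayf weight0.
Qed.

Lemma ray_in_integrand : contour_integrand j (ray_in eta) Psi =
  (fun s => - rayf H (mono 0%N) 0%:R t (- eta) (- s)).
Proof.
apply/funext => s.
have dg : has_cderiv (ray_in eta) s (- polar 1 (- eta)).
  exact: has_cderiv_opp (has_cderiv_polar_radius (- s) (- eta)).
by rewrite (@contour_integrandE _ _ _ _ dg erefl) /rayf weight0 mulrN (kernelN (slice_kernelP jP)).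
Qed.

Lemma arc_integrand : contour_integrand j (Defs.arc r) Psi = arcf H (mono 0%N) 0%:R t r.
Proof.
apply/funext => s; rewrite (@contour_integrandE _ _ _ _ (has_cderiv_polar_arg r s) erefl).
by rewrite /arcf weight0.
Qed.

(** The integrals over the truncated rays and the arc are integrals of continuous
    functions, and the rays decay exponentially. *)
Lemma Gamma_contour : Gamma_converges j r eta Psi /\
  Gamma_integral j r eta Psi = (2 : R) *: contour (kernel j) (mono 0%N) 0%:R t r eta.
Proof.
have p0 := pi_gt0 R; have eta0 : 0 <= eta by move: eta1; lra.
have eta_pi : eta < pi by move: etaT delta_lt; lra.
have ce := cos_obtuse eta1 eta_pi; have HH := slice_kernelP jP.
have eT : `|eta| < Th by rewrite ger0_norm.
have eTN : `|- eta| < Th by rewrite normrN.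
have D1 := full_ray_decaying HH t0 r0 ce eT erefl.
have D2 := full_ray_decaying HH t0 r0 ce eTN (cosN _).
have D3 := decayingZ (-1) D2.
have cH := @arcf_continuous_on _ _ _ _ _ _ HH (mono 0%N) 0%:R t r r0.
have Te : - Th < - eta by rewrite ltrN2.
have ee : - eta <= eta by move: eta0; lra.
have EN : (fun x => (-1 : R) *: rayf H (mono 0%N) 0%:R t (- eta) x) = (fun x => - rayf H (mono 0%N) 0%:R t (- eta) x).
  by apply/funext => x; rewrite scaleN1r.
have D4 := D3; rewrite EN in D4.
have out h : r <= h -> is_bochner lebesgue_measure `[r, h] (rayf H (mono 0%N) 0%:R t eta) (vint (rayf H (mono 0%N) 0%:R t eta) r h).
  by move=> rh; apply: (bochner_cc (decaying_cont (b := h + 1) D1)) => //; rewrite ltrDl.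
have inn h : r <= h -> is_bochner lebesgue_measure `[- h, - r] (fun s => - rayf H (mono 0%N) 0%:R t (- eta) (- s)) (vint (fun x => - rayf H (mono 0%N) 0%:R t (- eta) x) r h).
  move=> rh; have hh : h < h + 1 by rewrite ltrDl.
  have c3 : continuous_on 0 (h + 1) (fun x => - rayf H (mono 0%N) 0%:R t (- eta) x).
    by rewrite -EN; exact: decaying_cont D3.
  rewrite -(vint_reflect r0 rh hh c3); apply: (@bochner_cc _ _ (- (h + 1)) 0).
  - by move=> x x1 x2; apply: (@continuous_reflect _ _ (fun x => - rayf H (mono 0%N) 0%:R t (- eta) x)); apply: c3; [rewrite oppr_gt0|rewrite ltrNl].
  - by rewrite ltrN2.
  - by rewrite lerN2.
  - by rewrite oppr_lt0.
have marc : is_bochner lebesgue_measure `[- eta, eta] (arcf H (mono 0%N) 0%:R t r) (vint (arcf H (mono 0%N) 0%:R t r) (- eta) eta).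
  exact: (bochner_cc cH).
have mcc (a b : R) : @measurable _ (measurableTypeR R) `[a, b]%classic by exact: measurable_itv.
have l1 : contour_integral j (ray_out eta) r h Psi @[h --> +oo] --> vinf (rayf H (mono 0%N) 0%:R t eta) r.
  apply: cvg_trans (vinfE D1); apply: near_eq_cvg.
  apply: filterS (nbhs_pinfty_ge (num_real r)) => h rh.
  by rewrite /contour_integral ray_out_integrand (bochnerE _ (out h rh)).
have l2 : contour_integral j (ray_in eta) (- h) (- r) Psi @[h --> +oo] --> vinf (fun x => - rayf H (mono 0%N) 0%:R t (- eta) x) r.
  apply: cvg_trans (vinfE D4); apply: near_eq_cvg.
  apply: filterS (nbhs_pinfty_ge (num_real r)) => h rh.
  by rewrite /contour_integral ray_in_integrand (bochnerE _ (inn h rh)).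
split.
  split.
  - by move=> h rh; rewrite /contour_integrable ray_in_integrand; eexists; exact: inn.
  - by apply/cvg_ex; eexists; exact: l2.
  - by rewrite /contour_integrable arc_integrand; eexists; exact: marc.
  - by move=> h rh; rewrite /contour_integrable ray_out_integrand; eexists; exact: out.
  - by apply/cvg_ex; eexists; exact: l1.
rewrite /Gamma_integral (cvg_lim _ l1)// (cvg_lim _ l2)//.
rewrite {1}/contour_integral arc_integrand (bochnerE _ marc)//.
exact: (full_contour HH).
Qed.

End Contours.

End OperatorKernel.

(** * Action of the operator on contour integrals *)

Section IntegralRelations.
Context {R : realType} {E F : completeNormedModType R}.
Implicit Types (f g : R -> E) (a b h c k : R).

Lemma vinf_ext a0 a c k f g : decaying a0 f a c k -> (forall x, a0 < x -> f x = g x) ->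
  vinf g a = vinf f a.
Proof.
move=> D fg; have [a0a _ _ _] := D; apply: cvg_lim => //.
apply: cvg_trans (vinfE D); apply: near_eq_cvg.
apply: filterS (nbhs_pinfty_ge (num_real a)) => h ah.
have hh : h < h + 1 by rewrite ltrDl.
by apply: (vint_ext a0a ah hh (decaying_cont D)) => x x0 _; exact: fg.
Qed.

(** Continuous linear maps with an explicit bound, without a bundled structure;
    they commute with all the integrals. *)
Definition bounded_linear {E' F' : normedModType R} (L : E' -> F') (k : R) :=
  [/\ forall u v, L (u + v) = L u + L v, forall (r : R) u, L (r *: u) = r *: L u &
      forall u, `|L u| <= k * `|u|].

Lemma bounded_linearB {E' F' : normedModType R} (L : E' -> F') k : bounded_linear L k ->
  forall u v, L (u - v) = L u - L v.
Proof. by move=> [LD LZ _] u v; rewrite LD -scaleN1r LZ scaleN1r. Qed.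

End IntegralRelations.

Section BoundedLinear.
Context {R : realType} {E F : completeNormedModType R}.
Variables (L : E -> F) (l : R).
Hypothesis HL : bounded_linear L l.

Lemma vint_blin a0 b0 a b (f : R -> E) : a0 < a -> a <= b -> b < b0 -> continuous_on a0 b0 f ->
  vint (fun x => L (f x)) a b = L (vint f a b).
Proof. by have [H1 H2 H3] := HL; exact: (vint_lin H1 H2 H3). Qed.

Lemma vinf_blin a0 a c k (f : R -> E) : decaying a0 f a c k ->
  vinf (fun x => L (f x)) a = L (vinf f a).
Proof. by have [H1 H2 H3] := HL; exact: (vinf_lin H1 H2 H3). Qed.

Lemma decaying_blin a0 a c k (f : R -> E) : 0 <= l -> decaying a0 f a c k ->
  decaying a0 (fun x => L (f x)) a (l * c) k.
Proof.
have [H1 H2 H3] := HL; move=> l0 [a0a k0 cf fc]; split=> // x ax.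
  exact: (continuous_lin (bounded_linearB HL) H3 (cf x ax)).
by rewrite -mulrA; apply: le_trans (H3 _) _; rewrite ler_wpM2l// fc.
Qed.

Lemma continuous_on_blin a b (f : R -> E) : continuous_on a b f -> continuous_on a b (fun x => L (f x)).
Proof.
have [H1 H2 H3] := HL => cf x ax xb.
exact: (continuous_lin (bounded_linearB HL) H3 (cf x ax xb)).
Qed.

End BoundedLinear.

Section ContourProperties.
Context {R : realType} {K : starAlgebra R} {X : banachBimodule K}.
Variables (A : rightOperator X) (delta M : R).
Hypothesis delta_gt0 : 0 < delta.
Hypothesis delta_lt : delta < pi / 2.
Hypothesis A_sectorial : spherical_sectorial delta A.
Hypothesis M_gt0 : 0 < M.
Hypothesis C_bound : forall a : K, Sigma delta a ->
  (opnorm (Cres A a) <= (M / sa_norm a)%:E)%E.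
Local Notation normc := (@Normc.normc R).
Local Notation mono k := (fun x : R => x ^+ k).
Local Notation Th := (pi / 2 + delta).
Variables (eta : R).
Hypotheses (eta1 : pi / 2 < eta) (etaT : eta < Th).
Local Notation kernel := (kernel A).
Local Notation kernelP := (kernelP delta_lt A_sectorial M_gt0 C_bound).

Lemma eta_bounds : [/\ 0 <= eta, `|eta| < Th, cos eta < 0, eta < pi & `|eta| < pi + 1].
Proof.
have p0 := pi_gt0 R; have e0 : 0 <= eta by move: eta1; lra.
have eT : `|eta| < Th by rewrite ger0_norm.
have ep : eta < pi by move: etaT delta_lt; lra.
split=> //; first exact: cos_obtuse.
by rewrite ger0_norm//; lra.
Qed.

Lemma Th_gt0 : - Th < 0.
Proof. by have := pi_gt0 R; move: delta_gt0; lra. Qed.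

(** The kernel K(z, w) is built from A Q and Q only, which are the same for all
    imaginary units. *)
Lemma contour_indep j k t r : SA j -> SA k -> 0 < t -> 0 < r ->
  contour (kernel k) (mono 0%N) 0%:R t r eta = contour (kernel j) (mono 0%N) 0%:R t r eta.
Proof.
move=> jP kP t0 r0; have [e0 eT ce ep _] := eta_bounds.
have E z w : in_sector Th z -> kernel j z w = kernel k z w.
  move=> zS; rewrite !(kernelE delta_lt A_sectorial C_bound)//.
  exact: (Kz_indep delta_lt A_sectorial C_bound).
have D : decaying 0 (rayf (kernel j) (mono 0%N) 0%:R t eta) r _ _ :=
  full_ray_decaying (kernelP jP) t0 r0 ce eT erefl.
have E1 : arc_part (kernel j) (mono 0%N) 0%:R t r eta = arc_part (kernel k) (mono 0%N) 0%:R t r eta.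
  apply: (vint_ext Th_gt0 e0 etaT).
    exact: (arcf_continuous_on (kernelP jP) r0).
  by move=> x x1 x2; apply: E; apply: in_sector_polar => //; rewrite ltr_norml x1.
have E2 : ray_part (kernel k) (mono 0%N) 0%:R t r eta = ray_part (kernel j) (mono 0%N) 0%:R t r eta.
  by apply: (vinf_ext D) => x x0; apply: E; exact: in_sector_polar.
by rewrite /contour E1 E2.
Qed.

Section Weights.
Variables (j : K) (jP : SA j).
(** Radial factors m for which the ray converges: at most linear growth from r on,
    up to an exponential that half of the decay of e^(tz) absorbs. *)
Definition admissible (m : R -> R) (r b B : R) :=
  (forall x, 0 < x -> {for x, continuous m}) /\
  (forall x, r <= x -> 0 <= m x /\ m x <= B * x * expR (b * x)).

Variables (t r b : R).
Hypotheses (t0 : 0 < t) (r0 : 0 < r) (b0 : 0 < b) (tb : t * cos eta <= - (2 * b)).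

Lemma admissible_decaying {E : completeNormedModType R} (Kr K1 : R[i] -> R[i] -> E) Th' kap m a B :
  is_kernel Kr K1 Th' kap -> `|eta| < Th' -> 0 <= B -> admissible m r b B ->
  decaying 0 (rayf Kr m a t eta) r (kap * B) b.
Proof. by move=> HK eT' B0 [m1 m2]; exact: (rayf_decaying HK a r0 eT' b0 B0 m1 m2 tb). Qed.

Lemma contour_blin {F : completeNormedModType R} (L : Lr X -> F) (l : R) m (a B : R) : 0 <= B -> admissible m r b B ->
  bounded_linear L l ->
  L (contour (kernel j) m a t r eta) =
    vint (fun x => L (arcf (kernel j) m a t r x)) 0 eta + vinf (fun x => L (rayf (kernel j) m a t eta x)) r.
Proof.
move=> B0 mB HL; have [e0 eT ce ep _] := eta_bounds; have [LD _ _] := HL.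
rewrite LD (vint_blin HL Th_gt0 e0 etaT (arcf_continuous_on (kernelP jP) r0)).
by rewrite (vinf_blin HL (admissible_decaying a (kernelP jP) eT B0 mB)).
Qed.

(** Relations between values of the kernel pass to its integrals. *)
Lemma contour_agree {F : completeNormedModType R} (L1 L2 : Lr X -> F) (l1 l2 : R) m (a B : R) : 0 <= l1 -> 0 <= B -> admissible m r b B ->
  bounded_linear L1 l1 -> bounded_linear L2 l2 ->
  (forall z w, in_sector Th z -> L1 (kernel j z w) = L2 (kernel j z w)) ->
  L1 (contour (kernel j) m a t r eta) = L2 (contour (kernel j) m a t r eta).
Proof.
move=> l10 B0 mB H1 H2 HE; have [e0 eT ce ep _] := eta_bounds.
have E1 : vint (fun x => L2 (arcf (kernel j) m a t r x)) 0 eta = vint (fun x => L1 (arcf (kernel j) m a t r x)) 0 eta.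
  apply/esym; apply: (vint_ext Th_gt0 e0 etaT).
    exact: (continuous_on_blin H1 (arcf_continuous_on (kernelP jP) r0)).
  by move=> x x1 x2; apply: HE; apply: in_sector_polar => //; rewrite ltr_norml x1.
have E2 : vinf (fun x => L2 (rayf (kernel j) m a t eta x)) r = vinf (fun x => L1 (rayf (kernel j) m a t eta x)) r.
  apply: (vinf_ext (decaying_blin H1 l10 (admissible_decaying a (kernelP jP) eT B0 mB))) => x x0.
  by apply: HE; exact: in_sector_polar.
by rewrite (contour_blin a B0 mB H1) (contour_blin a B0 mB H2) E1 E2.
Qed.

Lemma comp_bounded_linear (B : Lr X) : bounded_linear (Lr_comp B) `|B|.
Proof.
split; [exact: Lr_compDr|by move=> c C; exact: Lr_compZr|exact: Lr_comp_norm].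
Qed.

Lemma compr_bounded_linear (B : Lr X) : bounded_linear (fun C => Lr_comp C B) `|B|.
Proof.
split; [by move=> C D; exact: Lr_compDl|by move=> c C; exact: Lr_compZl|].
by move=> C; rewrite mulrC; exact: Lr_comp_norm.
Qed.

Lemma scalar_bounded_linear (B : Lr X) : bounded_linear (fun c : R^o => c *: B) `|B|.
Proof.
split; [by move=> x y; rewrite scalerDl|by move=> c x; rewrite scalerA|].
by move=> c; rewrite normrZ mulrC.
Qed.

Lemma contour_comm (l : R) m (a B : R) : 0 < l -> 0 <= B -> admissible m r b B ->
  Lr_comp (contour (kernel j) m a t r eta) (Cz A j (Complex l 0)) =
  Lr_comp (Cz A j (Complex l 0)) (contour (kernel j) m a t r eta).
Proof.
move=> l0 B0 mB.
apply: (contour_agree _ _ B0 mB (compr_bounded_linear _) (comp_bounded_linear _)) => // z w zS.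
have Th0 : 0 < Th by have := Th_gt0; rewrite oppr_lt0.
apply: Lr_eq => u; rewrite !Lr_compE (kernelE delta_lt A_sectorial C_bound)//.
apply: (real_Kz_comm delta_lt A_sectorial C_bound jP) => //.
exact: (sector_real l0 Th0).
Qed.

(** The relation A K(z, w) = K(z, z w) - Im w cannot be integrated directly, as A is
    unbounded.  Applying the resolvent R = (1 - A)^-1 turns it into
    K(z, w) = R (K(z, w) - K(z, z w) + Im w), where R is bounded; and
    Im w = Im (z w / z) is the scalar kernel. *)
Lemma contour_A m m' (a B B' : R) : 0 <= B -> 0 <= B' -> admissible m r b B -> admissible m' r b B' ->
  (forall x, 0 < x -> m' x = x * m x) -> forall u,
  let I := contour (kernel j) m a t r eta in
  ro_dom A (I u) /\
  A (I u) = contour (kernel j) m' (a + 1) t r eta u - contour cauchy_kernel m' (a + 1) t r eta *: u.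
Proof.
move=> B0 B'0 mB m'B m'E u I; have [e0 eT ce ep eT1] := eta_bounds.
have Th0 : 0 < Th by have := Th_gt0; rewrite oppr_lt0.
have S1 : sector delta (Complex 1 0) := sector_real ltr01 Th0.
pose Rl := Cz A j (Complex 1 0).
have wE x th : 0 < x -> weight m' (a + 1) t x th = polar x th * weight m a t x th.
  by move=> x0; rewrite /weight mulrA polarM m'E// mulrDl mul1r [th + _]addrC.
have pt z w : in_sector Th z -> kernel j z w =
    Lr_comp Rl (kernel j z w - kernel j z (z * w) + cauchy_kernel z (z * w) *: Lr_id).
  move=> zS; rewrite !(kernelE delta_lt A_sectorial C_bound)//.
  have z0 : z != 0 by apply/eqP => zE; have := in_sector_normc zS; rewrite zE Normc.normc0 ltxx.
  have -> : cauchy_kernel z (z * w) = complex.Im w by rewrite /cauchy_kernel [z * w]mulrC mulfK.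
  have H v := real_Cz_left delta_lt A_sectorial C_bound jP S1
    (Kz_dom delta_lt A_sectorial C_bound jP zS w v).
  have HA v := AKz delta_lt A_sectorial C_bound jP zS w v.
  move: (Kz A j z w) (Kz A j z (z * w)) H HA => k0 k1 H HA; apply: Lr_eq => v.
  by rewrite -[LHS]H scale1r HA opprB addrA addrAC.
have D1 := admissible_decaying a (kernelP jP) eT B0 mB.
have D2 := admissible_decaying (a + 1) (kernelP jP) eT B'0 m'B.
have D3 := admissible_decaying (a + 1) (@cauchy_is_kernel R) eT1 B'0 m'B.
have D4 := decaying_blin (scalar_bounded_linear Lr_id) (normr_ge0 _) D3.
have D5 := decayingD (decayingB D1 D2) D4.
(* the integrands of the three contours are continuous on the arc *)
have c1 := @arcf_continuous_on _ _ _ _ _ _ (kernelP jP) m a t r r0.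
have c2 := @arcf_continuous_on _ _ _ _ _ _ (kernelP jP) m' (a + 1) t r r0.
have c3 : continuous_on (- Th) Th (arcf cauchy_kernel m' (a + 1) t r).
  move=> x x1 x2; apply: (arcf_continuous (@cauchy_is_kernel R)) => //.
  by rewrite ltr_norml; move: (pi_gt0 R) delta_lt x1 x2; lra.
have c4 := continuous_on_blin (scalar_bounded_linear Lr_id) c3.
have c12 : continuous_on (- Th) Th (fun x => arcf (kernel j) m a t r x - arcf (kernel j) m' (a + 1) t r x).
  by move=> x x1 x2; apply: cvgB; [exact: c1|exact: c2].
have c5 := continuous_onD c12 c4.
have arcE x : - Th < x -> x < Th -> arcf (kernel j) m a t r x = Lr_comp Rl
   (arcf (kernel j) m a t r x - arcf (kernel j) m' (a + 1) t r x + arcf cauchy_kernel m' (a + 1) t r x *: Lr_id).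
  move=> x1 x2; rewrite [LHS]pt; last by apply: in_sector_polar => //; rewrite ltr_norml x1.
  by rewrite /arcf (wE _ _ r0) -[polar r x * _ * _]mulrA.
have rayE x : 0 < x -> rayf (kernel j) m a t eta x = Lr_comp Rl
   (rayf (kernel j) m a t eta x - rayf (kernel j) m' (a + 1) t eta x + rayf cauchy_kernel m' (a + 1) t eta x *: Lr_id).
  move=> x0; rewrite [LHS]pt; last exact: in_sector_polar.
  by rewrite /rayf (wE _ _ x0) -[polar x eta * _ * _]mulrA.
have IE : I = Lr_comp Rl (I - contour (kernel j) m' (a + 1) t r eta + contour cauchy_kernel m' (a + 1) t r eta *: Lr_id).
  rewrite {1}/I /contour {1}/arc_part {1}/ray_part.
  rewrite (vint_ext Th_gt0 e0 etaT c1 arcE) -(vinf_ext D1 rayE).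
  rewrite (vint_blin (comp_bounded_linear Rl) Th_gt0 e0 etaT c5).
  rewrite (vinf_blin (comp_bounded_linear Rl) D5) -Lr_compDr; congr (Lr_comp Rl _).
  rewrite (vintD Th_gt0 e0 etaT c12 c4) (vintB Th_gt0 e0 etaT c1 c2).
  rewrite (vint_blin (scalar_bounded_linear Lr_id) Th_gt0 e0 etaT c3).
  rewrite (vinfD (decayingB D1 D2) D4) (vinfB D1 D2) (vinf_blin (scalar_bounded_linear Lr_id) D3).
  have H (p q p' q' : Lr X) (c c' : R) : p - q + c *: Lr_id + (p' - q' + c' *: Lr_id) =
    p + p' - (q + q') + (c + c') *: Lr_id by module R.
  exact: H.
pose v := I u - contour (kernel j) m' (a + 1) t r eta u + contour cauchy_kernel m' (a + 1) t r eta *: u.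
have IuE : I u = Rl v := congr1 (fun B : Lr X => B u) IE.
rewrite {1}IuE; split.
  exact: (Cz_dom delta_lt A_sectorial C_bound).
have := real_Cz_eq delta_lt A_sectorial C_bound jP S1 v; rewrite scale1r -/Rl -IuE => H.
have -> : A (I u) = I u - v by rewrite -[in RHS]H; module R.
by rewrite /v /=; module R.
Qed.

End Weights.

End ContourProperties.

(** * Semigroups from bounded solutions of T' = A T *)

Section SolutionFamilies.
Context {R : realType} {K : starAlgebra R} {X : banachBimodule K}.
Implicit Types (A : rightOperator X) (T : R -> Lr X) (t s h l e : R) (x u v : X).

(** Rl = (l - A)^-1. *)
Record is_resolvent A l (Rl : Lr X) : Prop := IsResolvent {
  resolvent_dom : forall u, ro_dom A (Rl u) ;
  resolvent_eq : forall u, l *: Rl u - A (Rl u) = u ;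
  resolvent_left : forall v, ro_dom A v -> Rl (l *: v - A v) = v
}.

(** Every v in the domain is a value Rl y, and A Rl y = l Rl y - y. *)
Lemma resolvent_comm A l Rl (B : Lr X) : is_resolvent A l Rl ->
  (forall u, B (Rl u) = Rl (B u)) ->
  forall v, ro_dom A v -> A (B v) = B (A v).
Proof.
move=> H BR v dv; have vE := resolvent_left H dv.
have BvE : B v = Rl (B (l *: v - A v)) by rewrite -BR vE.
have := resolvent_eq H (B (l *: v - A v)); rewrite -BvE LrB LrZ => E.
by apply: oppr_inj; apply: (addrI (l *: B v)).
Qed.

Lemma dense_near A x e : dense (ro_dom A) -> 0 < e -> exists2 v, ro_dom A v & `|x - v| < e.
Proof.
move=> dA e0; have B0 : (ball x e : set X) !=set0 by exists x; exact: ballxx.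
have [v [xv dv]] := dA _ B0 (ball_open x e).
by exists v => //; move: xv; rewrite -ball_normE.
Qed.

Lemma dense_eq A (B C : Lr X) : dense (ro_dom A) -> (forall v, ro_dom A v -> B v = C v) -> B = C.
Proof.
move=> dA BC; apply: Lr_eq => u; apply/eqP; rewrite -subr_eq0 -normr_le0.
apply/ler_addgt0Pr => e e0; rewrite add0r.
have k0 : 0 < `|B - C| + 1 by rewrite ltr_wpDl.
have [v dv uv] := dense_near u dA (divr_gt0 e0 k0).
have -> : B u - C u = (B - C) (u - v) by rewrite LrB !LraddE !LroppE (BC v dv) subrr subr0.
apply: le_trans (Lr_le _ _) _; move: uv; rewrite ltr_pdivlMr// => /ltW uv.
apply: le_trans uv; rewrite mulrC ler_wpM2l// lerDl; exact: ler01.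
Qed.

(** What the contour integrals provide: T' = A T with T bounded and commuting with
    A, and a rate of convergence to the identity on the domain. *)
Record solution_family A T (T' : R -> Lr X) (C : R) : Prop := SolutionFamily {
  sol_dense : dense (ro_dom A) ;
  sol0 : T 0 = Lr_id ;
  sol_deriv : forall t, 0 < t -> has_deriv T t (T' t) ;
  sol_dom : forall t u, 0 < t -> ro_dom A (T t u) ;
  sol_A : forall t u, 0 < t -> A (T t u) = T' t u ;
  sol_norm : forall t, 0 < t -> `|T t| <= C ;
  sol_comm : forall t v, 0 < t -> ro_dom A v -> A (T t v) = T t (A v) ;
  sol_near : forall t v, 0 < t -> ro_dom A v -> `|T t v - v| <= C * t * `|A v|
}.

Lemma has_deriv_eval T t (D : Lr X) x : has_deriv T t D -> has_deriv (fun s => T s x) t (D x).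
Proof.
apply: (@has_deriv_lin R (Lr X) X (fun B => B x) `|x|) => // B.
by rewrite mulrC; exact: Lr_le.
Qed.

Section Consequences.
Variables (A : rightOperator X) (T T' : R -> Lr X) (C : R).
Hypothesis HT : solution_family A T T' C.

Lemma sol_ge0 : 0 <= C.
Proof. exact: le_trans (normr_ge0 _) (sol_norm HT ltr01). Qed.

(** By density, from the rate of convergence on the domain and the bound on T. *)
Lemma sol_start x e : 0 < e -> exists2 h, 0 < h & forall s, 0 <= s -> s < h -> `|T s x - x| <= e.
Proof.
move=> e0; have C0 := sol_ge0.
have k0 : 0 < 2 * (C + 1) by rewrite mulr_gt0// ltr_wpDl.
have [v dv xv] := dense_near x (sol_dense HT) (divr_gt0 e0 k0).
have k1 : 0 < 2 * (C * `|A v| + 1) by rewrite mulr_gt0// ltr_wpDl// mulr_ge0.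
exists (e / (2 * (C * `|A v| + 1))); first exact: divr_gt0.
move=> s; rewrite le_eqVlt => /orP[/eqP<- _|s0].
  by rewrite (sol0 HT) subrr normr0 ltW.
rewrite ltr_pdivlMr// => sh.
have -> : T s x - x = T s (x - v) + (T s v - v) - (x - v) by rewrite LrB; module R.
move: xv; rewrite ltr_pdivlMr// => xv.
have H1 : `|T s (x - v)| <= C * `|x - v|.
  by apply: le_trans (Lr_le _ _) _; rewrite ler_wpM2r// (sol_norm HT).
have H2 := sol_near HT s0 dv.
apply: le_trans (ler_normB _ _) _; apply: le_trans (lerD (le_trans (ler_normD _ _) (lerD H1 H2)) (lexx _)) _.
have : s * (C * `|A v|) <= s * (C * `|A v| + 1) by rewrite ler_wpM2l ?lerDl// ltW.
by move: xv sh; rewrite mulrCA [s * (2 * _)]mulrCA [s * (C * _)]mulrCA mulrA; lra.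
Qed.

Lemma sol_strongly_continuous : strongly_continuous T.
Proof.
move=> x; apply/subspace_continuousP => t; rewrite /= in_itv/= andbT => t0.
apply/cvgrPdist_le => e e0.
suff [h h0 H] : exists2 h, 0 < h & forall s, 0 <= s -> `|s - t| < h -> `|T t x - T s x| <= e.
  apply/nbhs_ballP; exists h => //= s; rewrite /ball/= distrC => st /=.
  by rewrite in_itv/= andbT => s0; exact: H.
move: t0; rewrite le_eqVlt => /orP[/eqP<-|t0].
  have [h h0 H] := sol_start x e0; exists h => // s s0; rewrite subr0 ger0_norm// => sh.
  by rewrite (sol0 HT) distrC; exact: H.
have := has_deriv_continuous (has_deriv_eval x (sol_deriv HT t0)).
move=> /continuousP /(_ e e0)[h h0 H]; exists h => // s _ st.
by rewrite distrC; exact: H.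
Qed.

Lemma sol_TT' t s : 0 < t -> 0 < s -> Lr_comp (T t) (T' s) = Lr_comp (T' t) (T s).
Proof.
move=> t0 s0; apply: Lr_eq => u; rewrite !Lr_compE -(sol_A HT _ s0) -(sol_A HT _ t0).
by rewrite (sol_comm HT t0 (sol_dom HT u s0)).
Qed.

(** The derivative in tau of T(t - tau) T(s + tau) is zero, since
    T(u) T'(v) = T(u) A T(v) = T'(u) T(v).  The point tau = t is left out, as T
    need not be norm continuous at 0. *)
Lemma sol_slide t s e : 0 < e -> e < t -> 0 < s ->
  Lr_comp (T t) (T s) = Lr_comp (T e) (T (s + t - e)).
Proof.
move=> e0 et s0.
have := @deriv0_const R (Lr X) (fun y => Lr_comp (T (t - y)) (T (s + y))) 0 (t - e).
rewrite subr0 addr0 opprB addrCA subrr addr0 addrA => -> //; first by rewrite subr_ge0 ltW.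
move=> y y0 ye; have ty : 0 < t - y by lra.
have sy : 0 < s + y by lra.
have d1 : has_deriv (fun y => T (t - y)) y (- T' (t - y)).
  have dt : has_deriv (fun y => t - y) y (-1).
    by rewrite -[-1]add0r; apply: has_derivB; [exact: has_deriv_cst|apply/has_derivP; exact: is_derive_id].
  by have := has_deriv_comp dt (sol_deriv HT ty); rewrite scaleN1r.
have d2 : has_deriv (fun y => T (s + y)) y (T' (s + y)).
  have dt : has_deriv (fun y => s + y) y 1.
    by rewrite -[1]add0r; apply: has_derivD; [exact: has_deriv_cst|apply/has_derivP; exact: is_derive_id].
  by have := has_deriv_comp dt (sol_deriv HT sy); rewrite scale1r.
have := @has_deriv_bil R (Lr X) (Lr X) (Lr X) (@Lr_comp R K X) 1 (@Lr_compDl R K X) (@Lr_compDr R K X)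
  (@Lr_compZl R K X) (@Lr_compZr R K X) _ _ _ _ _ _ d1 d2.
rewrite sol_TT'// -[- T' _]scaleN1r Lr_compZl scaleN1r subrr; apply.
by move=> u v; rewrite mul1r; exact: Lr_comp_norm.
Qed.

(** Let e tend to 0 in [sol_slide], on vectors of the domain: there
    T(e) y - y is small uniformly in y = T(s + t - e) x. *)
Lemma sol_semigroup : is_semigroup T.
Proof.
split=> [|t s t0 s0]; first exact: sol0 HT.
suff -> : T (t + s) = Lr_comp (T t) (T s) by [].
apply: (dense_eq (sol_dense HT)) => x dx; rewrite Lr_compE; have C0 := sol_ge0.
apply/eqP; rewrite -subr_eq0 -normr_le0; apply/ler_addgt0Pr => e e0; rewrite add0r.
have ts0 : 0 < s + t by rewrite addr_gt0.
have e20 : 0 < e / 2 by rewrite divr_gt0.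
have /continuousP /(_ _ e20)[h h0 H] := has_deriv_continuous (has_deriv_eval x (sol_deriv HT ts0)).
(* d bounds the shift of the time, d * k the distance of T(d) from the identity *)
pose k := 2 * (C * (C * `|A x|) + 1).
have k0 : 0 < k by rewrite mulr_gt0// ltr_wpDl// !mulr_ge0.
pose d := Num.min (Num.min (h / 2) (t / 2)) (e / k).
have d0 : 0 < d by rewrite !lt_min !divr_gt0.
have dh : d < h by apply: (@le_lt_trans _ _ (h / 2)); [rewrite !ge_min lexx|lra].
have dt : d < t by apply: (@le_lt_trans _ _ (t / 2)); [rewrite !ge_min lexx orbT|lra].
have dk : d * k <= e by rewrite -ler_pdivlMr// !ge_min lexx !orbT.
have -> : T t (T s x) = T d (T (s + t - d) x).
  exact: (congr1 (fun B : Lr X => B x) (sol_slide d0 dt s0)).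
have std : 0 < s + t - d by move: dt s0; lra.
have H1 : `|T (s + t - d) x - T (s + t) x| <= e / 2.
  by apply: H; rewrite addrAC subrr sub0r normrN gtr0_norm.
have dy := sol_dom HT x std.
have H2 := sol_near HT d0 dy; rewrite (sol_comm HT std dx) in H2.
have H3 : `|T (s + t - d) (A x)| <= C * `|A x|.
  by apply: le_trans (Lr_le _ _) _; rewrite ler_wpM2r// (sol_norm HT).
have -> : T (t + s) x - T d (T (s + t - d) x) =
  - ((T (s + t - d) x - T (s + t) x) + (T d (T (s + t - d) x) - T (s + t - d) x)).
  have E (a b c : X) : a - b = - ((c - a) + (b - c)) by module R.
  by rewrite [t + s]addrC; exact: E.
rewrite normrN; apply: le_trans (ler_normD _ _) _; apply: le_trans (lerD H1 H2) _.
have : C * d * `|T (s + t - d) (A x)| <= C * d * (C * `|A x|).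
  by rewrite ler_wpM2l// mulr_ge0// ltW.
by move: dk d0; rewrite /k; lra.
Qed.

(** T(s) x - s A x has derivative T(s) A x - A x, small near 0; the mean value
    inequality is applied on [d, h] and d tends to 0. *)
Lemma sol_generator_sub x : ro_dom A x -> h^-1 *: (T h x - x) @[h --> 0^'+] --> A x.
Proof.
move=> dx; apply/cvgrPdist_le => e e0; have [h0 h00 H] := sol_start (A x) e0.
near=> h.
have hp : 0 < h by near: h; exact: nbhs_right_gt.
have hh : h < h0 by near: h; exact: nbhs_right_lt.
suff Hh : `|T h x - x - h *: A x| <= e * h.
  rewrite distrC -(ler_pM2l hp) [h * e]mulrC; apply: le_trans Hh.
  rewrite -[X in X * _](gtr0_norm hp) -normrZ scalerBr scalerA divff ?gt_eqF//.
  by rewrite scale1r.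
have C0 := sol_ge0.
apply/ler_addgt0Pr => e1 e10.
pose k := C * `|A x| + `|A x| + 1; have k0 : 0 < k by rewrite ltr_wpDl// addr_ge0// mulr_ge0.
pose d := Num.min (h / 2) (e1 / k); have d0 : 0 < d by rewrite lt_min !divr_gt0.
have dh : d < h by apply: (@le_lt_trans _ _ (h / 2)); [rewrite ge_min lexx|lra].
have dk : d * k <= e1 by rewrite -ler_pdivlMr// ge_min lexx orbT.
have := @mean_value_cst R X (fun s => T s x - s *: A x) (fun s => T s (A x) - A x) e d h (ltW dh).
have G : T h x - x - h *: A x = T h x - h *: A x - (T d x - d *: A x) + (T d x - x) - d *: A x by module R.
rewrite G => MV; apply: le_trans (ler_normB _ _) _; apply: le_trans (lerD (ler_normD _ _) (lexx _)) _.
have H2 := sol_near HT d0 dx.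
have H3 : `|d *: A x| = d * `|A x| by rewrite normrZ gtr0_norm.
have H1 : `|T h x - h *: A x - (T d x - d *: A x)| <= e * (h - d).
  apply: MV => s s1 s2.
    have s0 : 0 < s := lt_le_trans d0 s1.
    apply: has_derivB.
      by have := has_deriv_eval x (sol_deriv HT s0); rewrite -(sol_A HT _ s0) (sol_comm HT).
    have := has_derivZ (has_deriv_lmul 1 s) (has_deriv_cst (A x) s).
    rewrite scaler0 add0r scale1r; apply: has_deriv_eq; exists 1 => // y _.
    by rewrite mul1r.
  by apply: H; [exact: ltW (lt_le_trans d0 s1)|exact: le_lt_trans hh].
rewrite H3; apply: le_trans (lerD (lerD H1 H2) (lexx _)) _.
have := mulr_ge0 (ltW e0) (ltW d0).
by move: dk d0; rewrite /k; lra.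
Unshelve. all: by end_near. Qed.

(** If T(h) x - x ~ h y then, applying Rl, the generator maps Rl x to Rl y; there
    it is A, so A Rl x = Rl y and x = Rl (l x - y) lies in the domain. *)
Lemma sol_generator l Rl : is_resolvent A l Rl ->
  (forall t u, 0 < t -> T t (Rl u) = Rl (T t u)) -> is_generator A T.
Proof.
move=> HR TR; apply/seteqP; split=> -[x y] /=; rewrite /ro_graph /generator_graph /=.
  by move=> [dx ->]; exact: sol_generator_sub.
move=> xy.
have RB : forall u v, Rl (u - v) = Rl u - Rl v by move=> u v; exact: LrB.
have H1 : h^-1 *: (T h (Rl x) - Rl x) @[h --> 0^'+] --> Rl y.
  apply: cvg_trans (lin_cvg RB (Lr_le Rl) xy); apply: near_eq_cvg.
  near=> h; have hp : 0 < h by near: h; exact: nbhs_right_gt.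
  by rewrite TR// LrZ LrB.
have E : A (Rl x) = Rl y.
  by apply: cvg_unique H1 => //; apply: sol_generator_sub; exact: resolvent_dom HR x.
have xE : x = Rl (l *: x - y).
  by rewrite LrB LrZ -E (resolvent_eq HR).
have dx : ro_dom A x by rewrite xE; exact: resolvent_dom HR _.
split=> //; have := resolvent_eq HR (l *: x - y); rewrite -xE => /addrI/oppr_inj.
by [].
Unshelve. all: by end_near. Qed.

End Consequences.

End SolutionFamilies.

(** * Laplace transform and analyticity *)

Section HalfLine.
Context {R : realType} {E : completeNormedModType R}.
Local Notation mu := (@lebesgue_measure R).
Local Notation mfun := (@measurable_fun _ _ (measurableTypeR R) R).
Implicit Types (a b c k x : R) (f : R -> E).

Lemma expR_tail k b : 0 < k ->
  (\int[mu]_(x in `[b, +oo[) (expR (- k * x))%:E = (expR (- k * b) / k)%:E)%E.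
Proof.
move=> k0.
have dF x : has_deriv (fun x => - (expR (- k * x) / k) : R^o) x (expR (- k * x)).
  have := @has_derivZc R R^o (- k^-1) _ _ _ (has_deriv_expR (- k) x).
  rewrite -[_ *: _]/(_ * _) (_ : - k^-1 * _ = expR (- k * x)); last by field; rewrite gt_eqF.
  by apply: has_deriv_eq; exists 1 => // y _; rewrite -[_ *: _]/(_ * _); ring.
have cF x : {for x, continuous (fun x => - (expR (- k * x) / k) : R^o)}.
  exact: has_deriv_continuous (dF x).
have cf x : {for x, continuous (fun x => expR (- k * x))}.
  exact: has_deriv_continuous (has_deriv_expR (- k) x).
have := @ge0_continuous_FTC2y R (fun x => expR (- k * x)) (fun x => - (expR (- k * x) / k)) b 0.
rewrite sub0e -EFinN opprK; apply.
- by move=> x _; exact: expR_ge0.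
- by apply: continuous_subspaceT => x; exact: cf.
- rewrite -oppr0 -(mul0r k^-1); apply: cvgN; apply: cvgMl.
  apply/cvgrPdist_le => e e0; near=> x.
  rewrite sub0r normrN ger0_norm ?expR_ge0//; apply: (expR_small k0 e0).
  by near: x; exact: (nbhs_pinfty_ge (num_real _)).
- by move=> x _; have /has_derivP[] := dF x.
- by apply: cvg_at_right_filter; exact: cF.
- by move=> x _; have /has_derivP[_ <-] := dF x; rewrite derive1E.
Unshelve. all: by end_near. Qed.

(** The half-line is exhausted by ]1/(n+1), n+1]; the remaining integrals of
    |f| are at most c/(n+1) near 0 and an exponential tail at infinity. *)
Lemma is_bochner_half_line f c k I : 0 < k ->
  (forall x, 0 < x -> {for x, continuous f}) ->
  (forall x, 0 < x -> `|f x| <= c * expR (- k * x)) ->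
  vint f n.+1%:R^-1 n.+1%:R @[n --> \oo] --> I ->
  is_bochner mu `[0, +oo[ f I.
Proof.
move=> k0 cf fc fI.
have c0 : 0 <= c by have := le_trans (normr_ge0 _) (fc 1 ltr01); rewrite pmulr_lge0// expR_gt0.
have an0 n : 0 < n.+1%:R^-1 :> R by rewrite invr_gt0.
have anb n : n.+1%:R^-1 <= n.+1%:R :> R.
  by apply: (@le_trans _ _ 1); [rewrite invf_le1// ler1n|rewrite ler1n].
have DE n : `[0, +oo[ `\` `]n.+1%:R^-1, n.+1%:R] = `[0, n.+1%:R^-1] `|` `]n.+1%:R, +oo[ :> set R.
  apply/seteqP; split=> x /=; rewrite !in_itv/= !andbT.
    move=> [x0 /negP]; rewrite negb_and -!leNgt -ltNge => /orP[xa|xb]; [left|right] => //.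
    by rewrite x0.
  move=> [/andP[x0 xa]|xb].
    by split=> //; apply/negP; rewrite negb_and -leNgt xa.
  split; first by rewrite ltW// (lt_trans _ xb).
  by apply/negP; rewrite negb_and -ltNge xb orbT.
have mf : mfun `[0, +oo[ (fun x => `|f x|).
  suff : measurable_fun `[(0 : R), +oo[ (fun x => `|f x|) by exact.
  apply/measurable_fun_itv_obnd_cbndP; apply: open_continuous_measurable_fun => //.
  move=> x; rewrite inE/= in_itv/= andbT => x0; apply: cvg_norm; exact: cf.
have mexp D : @measurable _ (measurableTypeR R) D -> mfun D (fun x => expR (- k * x)).
  move=> mD; apply: (measurable_funS (@measurableT _ (measurableTypeR R))) => //.
  suff : measurable_fun [set: R] (fun x : R => expR (- k * x)) by exact.
  by apply: continuous_measurable_fun => x; exact: has_deriv_continuous (has_deriv_expR (- k) x).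
have mcc a b : @measurable _ (measurableTypeR R) `[a, b]%classic by exact: measurable_itv.
have moy a : @measurable _ (measurableTypeR R) `]a, +oo[%classic by exact: measurable_itv.
have mcy a : @measurable _ (measurableTypeR R) `[a, +oo[%classic by exact: measurable_itv.
have sub1 a : `[0, a] `<=` (`[0, +oo[ : set R).
  by move=> x /=; rewrite !in_itv/= andbT => /andP[].
have sub2 a : 0 <= a -> `]a, +oo[ `<=` (`[0, +oo[ : set R).
  by move=> a0 x /=; rewrite !in_itv/= !andbT => /ltW; exact: le_trans.
have sub3 a : 0 <= a -> `]0, a] `<=` (`[0, +oo[ : set R).
  by move=> a0 x /=; rewrite !in_itv/= !andbT => /andP[/ltW].
apply: (@is_bochner_exhaust R _ (measurableTypeR R) E mu `[0, +oo[%classic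
  (fun n => `]n.+1%:R^-1, n.+1%:R]%classic) (fun n => vint f n.+1%:R^-1 n.+1%:R)) => //.
- move=> n x /=; rewrite !in_itv/= andbT => /andP[/ltW + _].
  by apply: le_trans; exact: ltW.
- move=> n; have nn : n.+1%:R < n.+1%:R + 1 :> R by rewrite ltrDl.
  apply: (is_bochner_vint _ (an0 n) (anb n) nn).
  by move=> x x0 _; exact: cf.
- by move=> n; apply: (measurable_funS (mcy 0) _ mf) => x [].
pose tail n : set R := `]n.+1%:R, +oo[%classic.
pose rest n : set R := `[0, +oo[%classic `\` `]n.+1%:R^-1, n.+1%:R]%classic.
have H n : (\int[mu]_(x in rest n) `|f x|%:E <= ((c + c / k / k) * n.+1%:R^-1)%:E)%E.
  have dj : [disjoint (`[(0 : R), n.+1%:R^-1]%classic : set R) & (`]n.+1%:R, +oo[%classic : set R)].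
    apply/disj_setPS => x [/=]; rewrite !in_itv/= andbT => /andP[_ xa] xb.
    by have := lt_le_trans xb (le_trans xa (anb n)); rewrite ltxx.
  have mfU : @measurable_fun _ _ (measurableTypeR R) _ (`[(0 : R), n.+1%:R^-1]%classic `|` `](n.+1%:R : R), +oo[%classic) (fun x : R => (`|f x|)%:E).
    by apply/measurable_EFinP; apply: (measurable_funS (mcy 0) _ mf); rewrite -DE => x [].
  rewrite /rest DE (ge0_integral_setU mu (mcc _ _) (moy _) mfU _ dj); last by move=> x _; rewrite lee_fin.
  rewrite mulrDl EFinD; apply: leeD.
    rewrite -integral_itv_obnd_cbnd; last first.
      by apply/measurable_EFinP; exact: (measurable_funS (mcy 0) (sub3 _ (ltW (an0 n))) mf).
    have := @integral_le_oc R 0 n.+1%:R^-1 (fun x => `|f x|) c (ltW (an0 n)).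
    rewrite subr0; apply => //.
      by exact: (measurable_funS (mcy 0) (sub3 _ (ltW (an0 n))) mf).
    move=> x x0 _; apply: le_trans (fc x x0) _; apply: ler_piMr => //.
    by rewrite -[leRHS]expR0 ler_expR mulNr oppr_le0 mulr_ge0// ltW.
  apply: (@le_trans _ _ (\int[mu]_(x in tail n) (c%:E * (expR (- k * x))%:E))%E).
    apply: ge0_le_integral => //.
    - by apply/measurable_EFinP; by apply: (measurable_funS (mcy 0) _ mf); exact: sub2.
    - apply/measurable_EFinP; apply: measurable_funM => //.
      exact: mexp.
    - move=> x /=; rewrite in_itv/= andbT => xn; rewrite -EFinM lee_fin.
      by apply: fc; exact: lt_trans xn.
  have me : @measurable_fun _ _ (measurableTypeR R) _ (tail n) (fun x : R => (expR (- k * x))%:E).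
    by apply/measurable_EFinP; apply: mexp; exact: moy.
  rewrite (ge0_integralZl mu (moy _) me) ?lee_fin//.
  rewrite integral_itv_obnd_cbnd; last first.
    exact: me.
  rewrite expR_tail// -EFinM lee_fin -!mulrA; apply: ler_wpM2l => //.
  rewrite mulrC; apply: ler_wpM2l; first by rewrite invr_ge0 ltW.
  have e0 : 0 < (k * n.+1%:R)^-1 :> R by rewrite invr_gt0 mulr_gt0.
  rewrite -invfM; apply: (expR_small k0 e0).
  by rewrite invfM invrK mulrA mulVf ?gt_eqF// mul1r.
apply: cvge0P => [n|e e0]; first exact: integral_ge0.
have kernel0 : 0 < c + c / k / k + 1 by rewrite ltr_wpDl// addr_ge0// !divr_ge0// ltW.
have near_inv (e1 : R) : 0 < e1 -> \forall n \near \oo, n.+1%:R^-1 <= e1 :> R.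
  by move=> e10; have := near_infty_natSinv_lt (PosNum e10); apply: filterS => n /= /ltW.
apply: filterS (near_inv _ (divr_gt0 e0 kernel0)) => n ne; apply: le_trans (H n) _.
rewrite lee_fin; move: ne; rewrite ler_pdivlMr//; apply: le_trans.
by rewrite mulrC ler_wpM2l ?(ltW (an0 n))// lerDl ler01.
Qed.

End HalfLine.

Section Laplace.
Context {R : realType} {K : starAlgebra R} {X : banachBimodule K}.
Variables (A : rightOperator X) (T T' : R -> Lr X) (C : R).
Hypothesis HT : solution_family A T T' C.
Variables (l : R) (Rl : Lr X).
Hypotheses (l0 : 0 < l) (HR : is_resolvent A l Rl)
  (TR : forall t u, 0 < t -> T t (Rl u) = Rl (T t u)).
Implicit Types (t a b : R).

(** A primitive of e^(-lt) T(t). *)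
Let G t : Lr X := - (expR (- l * t) *: Lr_comp Rl (T t)).

(** A commutes with T and Rl inverts l - A. *)
Lemma laplace_primitive t : 0 < t -> has_deriv G t (expR (- l * t) *: T t).
Proof.
move=> t0.
have d1 : has_deriv (fun t => Lr_comp Rl (T t)) t (Lr_comp Rl (T' t)).
  apply: (@has_deriv_lin R (Lr X) (Lr X) (Lr_comp Rl) `|Rl|) (sol_deriv HT t0) => [||u].
  - exact: Lr_compDr.
  - by move=> k u; exact: Lr_compZr.
  - exact: Lr_comp_norm.
have E : l *: Lr_comp Rl (T t) - Lr_comp Rl (T' t) = T t.
  apply: Lr_eq => u; rewrite LraddE LroppE LrscaleE !Lr_compE -(sol_A HT u t0) -LrZ -LrB.
  by rewrite (resolvent_left HR)//; exact: (sol_dom HT).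
have := has_derivZc (-1) (has_derivZ (has_deriv_expR (- l) t) d1).
have -> : -1 *: (expR (- l * t) *: Lr_comp Rl (T' t) + (- l * expR (- l * t)) *: Lr_comp Rl (T t)) =
  expR (- l * t) *: T t by rewrite -[in RHS]E; module R.
by apply: has_deriv_eq; exists 1 => // y _; rewrite scaleN1r.
Qed.

Lemma laplace_continuous t : 0 < t -> {for t, continuous (fun t => expR (- l * t) *: T t)}.
Proof.
move=> t0; apply: cvgZ.
  exact: has_deriv_continuous (has_deriv_expR (- l) t).
exact: has_deriv_continuous (sol_deriv HT t0).
Qed.

(** The primitive tends to 0 at infinity, and to - Rl at 0 in operator norm because
    Rl maps into the domain, where the rate of convergence of T applies. *)
Lemma laplace_bound a b : 0 < a -> a <= b ->
  `|vint (fun t => expR (- l * t) *: T t) a b - Rl| <=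
  C * `|Rl| / l * b^-1 + (C * (l * `|Rl| + 1) + l * `|Rl|) * a.
Proof.
move=> a0 ab; have b0 := lt_le_trans a0 ab.
have C0 := sol_ge0 HT.
have bb : b < b + 1 by rewrite ltrDl.
have cf : continuous_on 0 (b + 1) (fun t => expR (- l * t) *: T t).
  by move=> x x0 _; exact: laplace_continuous.
rewrite (vint_FTC (F := G) a0 ab bb cf); last by move=> x x0 _; exact: laplace_primitive.
have nT t : 0 < t -> `|Lr_comp Rl (T t)| <= C * `|Rl|.
  move=> t0; apply: le_trans (Lr_comp_norm _ _) _.
  by rewrite mulrC ler_wpM2r// (sol_norm HT).
have -> : G b - G a - Rl = G b + (expR (- l * a) *: (Lr_comp Rl (T a) - Rl) + (expR (- l * a) - 1) *: Rl).
  by rewrite /G; module R.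
apply: le_trans (ler_normD _ _) _; apply: lerD.
  rewrite normrN normrZ ger0_norm ?expR_ge0//.
  have e0 : 0 < l^-1 / b by rewrite divr_gt0// invr_gt0.
  apply: (@le_trans _ _ (l^-1 / b * (C * `|Rl|))).
    apply: ler_pM; rewrite ?expR_ge0 ?nT//.
    apply: (expR_small l0 e0); rewrite mulrA divff ?gt_eqF// mul1r invrK.
    by [].
  by rewrite le_eqVlt; apply/orP; left; apply/eqP; ring.
rewrite [leRHS]mulrDl; apply: le_trans (ler_normD _ _) _.
have e1 : expR (- l * a) <= 1.
  by rewrite -[leRHS]expR0 ler_expR mulNr oppr_le0 mulr_ge0// ltW.
have cl0 : 0 <= l * `|Rl| + 1 by rewrite addr_ge0 ?mulr_ge0// ltW.
apply: lerD.
  rewrite normrZ ger0_norm ?expR_ge0//.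
  apply: (@le_trans _ _ (1 * `|Lr_comp Rl (T a) - Rl|)); first by rewrite ler_wpM2r.
  rewrite mul1r; apply: Lr_norm_le => [|u]; first by rewrite !mulr_ge0// ltW.
  rewrite LraddE LroppE Lr_compE -TR//.
  apply: le_trans (sol_near HT a0 (resolvent_dom HR u)) _.
  rewrite [C * _ * a]mulrAC -[leRHS]mulrA ler_wpM2l ?mulr_ge0 ?(ltW a0)//.
  have -> : A (Rl u) = l *: Rl u - u by rewrite -[X in _ - X](resolvent_eq HR u); module R.
  apply: le_trans (ler_normB _ _) _; rewrite mulrDl mul1r lerD2r normrZ gtr0_norm//.
  by rewrite -mulrA ler_wpM2l ?(ltW l0)//; exact: Lr_le.
rewrite normrZ distrC ger0_norm ?subr_ge0// mulrAC ler_wpM2r//.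
have := expR_ge1Dx (- l * a); lra.
Qed.

Lemma sol_laplace :
  is_bochner lebesgue_measure `[0, +oo[ (fun t => expR (- (t * l)) *: T t) Rl.
Proof.
rewrite (_ : (fun t => _) = (fun t => expR (- l * t) *: T t)); last first.
  by apply/funext => t; rewrite mulNr [l * t]mulrC.
have C0 := sol_ge0 HT.
apply: (@is_bochner_half_line _ _ _ C l) => //.
- by move=> x x0; exact: laplace_continuous.
- move=> x x0; rewrite normrZ ger0_norm ?expR_ge0// mulrC ler_wpM2r ?expR_ge0//.
  exact: (sol_norm HT).
pose D := C * `|Rl| / l + (C * (l * `|Rl| + 1) + l * `|Rl|).
have D0 : 0 < D + 1.
  by rewrite ltr_wpDl// !addr_ge0 ?mulr_ge0 ?addr_ge0 ?mulr_ge0 ?invr_ge0// ltW.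
apply/cvgrPdist_le => e e0.
have := near_infty_natSinv_lt (PosNum (divr_gt0 e0 D0)); apply: filterS => n /= /ltW ne.
have n0 : 0 < n.+1%:R^-1 :> R by rewrite invr_gt0.
have nn : n.+1%:R^-1 <= n.+1%:R :> R.
  by apply: (@le_trans _ _ 1); [rewrite invf_le1// ler1n|rewrite ler1n].
rewrite distrC; apply: le_trans (laplace_bound n0 nn) _.
rewrite -mulrDl -/D; move: ne; rewrite ler_pdivlMr// mulrC; apply: le_trans.
by rewrite ler_wpM2r ?(ltW n0)// lerDl ler01.
Qed.

End Laplace.

Section Analytic.
Context {R : realType} {E : normedModType R}.

(** The Taylor remainder of order n is at most c (|s| / b)^n. *)
Lemma cauchy_estimates_analytic (F : nat -> R -> E) (t b c d : R) : 0 < b -> 0 < d ->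
  (forall k s, `|s| < d -> has_deriv (F k) (t + s) (F k.+1 (t + s))) ->
  (forall n s, `|s| < d -> `|F n (t + s)| <= c * (n`!%:R / b ^+ n)) ->
  exists2 e : R, 0 < e & forall s, `|s| < e ->
    (\sum_(0 <= k < n) s ^+ k *: (k`!%:R^-1 *: F k t)) @[n --> \oo] --> F 0%N (t + s).
Proof.
move=> b0 d0 dF Fc; exists (Num.min b d); first by rewrite lt_min b0.
move=> s; rewrite lt_min => /andP[sb sd].
have q0 : `| `|s| / b| < 1.
  by rewrite ger0_norm ?divr_ge0 ?(ltW b0)// ltr_pdivrMr// mul1r.
have c0 : 0 <= c.
  have := le_trans (normr_ge0 _) (Fc 0%N 0 _); rewrite normr0 => /(_ d0).
  by rewrite expr0 fact0 divr1 mulr1.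
have H n : `|F 0%N (t + s) - \sum_(0 <= k < n) s ^+ k *: (k`!%:R^-1 *: F k t)| <= c * (`|s| / b) ^+ n.
  have := @taylor_bound R E n F t (c * (n`!%:R / b ^+ n)) d (fun k s _ => dF k s) (Fc n) s sd.
  rewrite big_mkord (eq_bigr (fun k : 'I_n => s ^+ k *: (k`!%:R^-1 *: F k t))); last first.
    by move=> k _; rewrite scalerA.
  move=> H; apply: le_trans H _.
  rewrite expr_div_n le_eqVlt; apply/orP; left; apply/eqP.
  have n0 : n`!%:R != 0 :> R by rewrite pnatr_eq0 -lt0n fact_gt0.
  have bn : b ^+ n != 0 by rewrite expf_neq0// gt_eqF.
  by move: (n`!%:R : R) (b ^+ n) n0 bn => x y x0 y0; field; rewrite x0 y0.
have Hg : (fun n => c * (`|s| / b) ^+ n) @ \oo --> (0 : R).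
  by rewrite -[X in _ --> X](mulr0 c); apply: cvgM; [exact: cvg_cst|exact: cvg_expr].
apply/cvgrPdist_le => e e0.
move/cvgrPdist_le : Hg => /(_ e e0); apply: filterS => n; rewrite sub0r normrN => Hn.
by apply: le_trans (H n) _; apply: le_trans (ler_norm _) Hn.
Qed.

End Analytic.

(** * The semigroup of a sectorial operator *)

Section SectorialSemigroup.
Context {R : realType} {K : starAlgebra R} {X : banachBimodule K}.
Variables (A : rightOperator X) (delta M : R).
Hypothesis delta_gt0 : 0 < delta.
Hypothesis delta_lt : delta < pi / 2.
Hypothesis A_sectorial : spherical_sectorial delta A.
Hypothesis M_gt0 : 0 < M.
Hypothesis C_bound : forall a : K, Sigma delta a ->
  (opnorm (Cres A a) <= (M / sa_norm a)%:E)%E.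
Variables (j : K) (r eta : R).
Hypotheses (jP : SA j) (r0 : 0 < r) (eta1 : pi / 2 < eta) (etaT : eta < pi / 2 + delta).
Local Notation mono k := (fun x : R => x ^+ k).
Implicit Types (t s l b x : R) (u v : X).

Local Notation KP := (kernelP delta_lt A_sectorial M_gt0 C_bound jP).
Local Notation IK m a t r := (contour (kernel A j) m a t r eta).

Let eta0 : 0 <= eta.
Proof. by have [] := eta_bounds delta_lt eta1 etaT. Qed.
Let ce : cos eta < 0.
Proof. by have [] := eta_bounds delta_lt eta1 etaT. Qed.
Let eta_pi : eta < pi.
Proof. by have [] := eta_bounds delta_lt eta1 etaT. Qed.

(** [sg] is the semigroup, [sg'] its derivative, and [sg_int] the operator J with
    A J(t) = T(t) - 1, written with the radius 1/t. *)
Definition sg t : Lr X := pi^-1 *: IK (mono 0%N) 0%:R t r.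
Definition sg' t : Lr X := pi^-1 *: IK (mono 1%N) 1%:R t r.
Definition sg_int t : Lr X := pi^-1 *: IK (fun x => x^-1) (-1) t t^-1.
(** The sizes of the arc and of the ray at the radius 1/t. *)
Definition sg_const : R := pi^-1 * (slice_const M * (expR 1 * eta + 2 / (- cos eta))).

Let decay t := t * (- cos eta) / 2.
Let decay_gt0 t : 0 < t -> 0 < decay t.
Proof. by move=> t0; rewrite divr_gt0// mulr_gt0// oppr_gt0. Qed.
Let decay_le t : t * cos eta <= - (2 * decay t).
Proof. by rewrite le_eqVlt; apply/orP; left; apply/eqP; rewrite /decay; field. Qed.

Let expR_ge1 b x : 0 < b -> 0 < x -> 1 <= expR (b * x).
Proof. by move=> b0 x0; rewrite -[leLHS]expR0 ler_expR mulr_ge0// ltW. Qed.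

Lemma admissible0 s b : 0 < s -> 0 < b -> admissible (mono 0%N) s b s^-1.
Proof.
move=> s0 b0; split=> [x _|x sx]; first exact: mono_continuous.
have x0 := lt_le_trans s0 sx; rewrite expr0; split=> //.
have H : 1 <= s^-1 * x by rewrite mulrC ler_pdivlMr// mul1r.
by rewrite -[leLHS]mulr1; apply: ler_pM => //; exact: expR_ge1.
Qed.

Lemma admissible1 s b : 0 < s -> 0 < b -> admissible (mono 1%N) s b 1.
Proof.
move=> s0 b0; split=> [x _|x sx]; first exact: mono_continuous.
have x0 := lt_le_trans s0 sx; rewrite expr1 mul1r ltW//; split=> //.
by rewrite ler_peMr ?(ltW x0)// expR_ge1.
Qed.

Lemma admissibleV s b : 0 < s -> 0 < b -> admissible (fun x => x^-1) s b (s^-1 ^+ 2).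
Proof.
move=> s0 b0; split=> [x x0|x sx]; first by apply: cvgV => //; rewrite gt_eqF.
have x0 := lt_le_trans s0 sx; rewrite invr_ge0 ltW//; split=> //.
have H : x^-1 <= s^-1 ^+ 2 * x.
  have -> : s^-1 ^+ 2 * x = (s^-1 * x) * (s^-1 * x) * x^-1 by field; rewrite !gt_eqF.
  have H : 1 <= s^-1 * x by rewrite mulrC ler_pdivlMr// mul1r.
  by rewrite ler_peMl ?invr_ge0 ?(ltW x0)// mulr_ege1.
rewrite -[leLHS]mulr1; apply: ler_pM => //; first by rewrite invr_ge0 ltW.
exact: expR_ge1.
Qed.

Lemma sg_resolvent l : 0 < l -> is_resolvent A l (Cz A j (Complex l 0)).
Proof.
move=> l0; have Th0 : 0 < pi / 2 + delta by rewrite addr_gt0// divr_gt0// pi_gt0.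
have S1 := sector_real l0 Th0; split.
- exact: (Cz_dom delta_lt A_sectorial C_bound jP S1).
- exact: (real_Cz_eq delta_lt A_sectorial C_bound jP S1).
- exact: (real_Cz_left delta_lt A_sectorial C_bound jP S1).
Qed.

Lemma sg_radius t s : 0 < t -> 0 < s -> sg t = pi^-1 *: IK (mono 0%N) 0%:R t s.
Proof.
move=> t0 s0; rewrite /sg; congr (_ *: _).
apply: (contour_radius KP _ t0 eta0 etaT ce r0 s0) => x y x0.
exact: (kernel_real delta_lt A_sectorial C_bound y jP delta_gt0 x0).
Qed.

(** At r = 1/t the exponential on the arc is at most e and the ray decays on the
    scale 1/t. *)
Lemma contour_size m (a : R) t c : 0 < t -> 0 <= c -> admissible m t^-1 (decay t) c ->
  m t^-1 * t = c ->
  `|pi^-1 *: IK m a t t^-1| <= sg_const * (c / t).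
Proof.
move=> t0 c0 [m1 m2] mc; have t1 : 0 < t^-1 by rewrite invr_gt0.
rewrite normrZ ger0_norm ?invr_ge0 ?pi_ge0// /sg_const -mulrA.
apply: ler_wpM2l; first by rewrite invr_ge0 pi_ge0.
apply: le_trans (contour_norm KP a (ltW t0) t1 eta0 etaT (decay_gt0 t0) c0 m1 m2 (decay_le t)) _.
rewrite -mc divff ?gt_eqF// /decay le_eqVlt; apply/orP; left; apply/eqP.
have c1 : cos eta != 0 by rewrite lt_eqF.
by field; rewrite c1 gt_eqF.
Qed.

Lemma sg_norm t : 0 < t -> `|sg t| <= sg_const.
Proof.
move=> t0; have t1 : 0 < t^-1 by rewrite invr_gt0.
rewrite (sg_radius t0 t1) -[leRHS]mulr1 -(divff (lt0r_neq0 t0)).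
apply: contour_size => //; first exact: ltW.
  by have := admissible0 t1 (decay_gt0 t0); rewrite invrK.
by rewrite expr0 mul1r.
Qed.

Lemma sg_int_norm t : 0 < t -> `|sg_int t| <= sg_const * t.
Proof.
move=> t0; have t1 : 0 < t^-1 by rewrite invr_gt0.
rewrite -[X in _ * X](mulfK (lt0r_neq0 t0)) -expr2.
apply: contour_size => //; first exact: sqr_ge0.
  by have := admissibleV t1 (decay_gt0 t0); rewrite invrK.
by rewrite invrK expr2.
Qed.

(** The scalar integral for e^(tz) dz is 0. *)
Lemma sg_A t u : 0 < t -> ro_dom A (sg t u) /\ A (sg t u) = sg' t u.
Proof.
move=> t0; have b0 := decay_gt0 t0; have ri : 0 <= r^-1 by rewrite invr_ge0 ltW.
have mE x : 0 < x -> x ^+ 1 = x * x ^+ 0 by rewrite expr1 expr0 mulr1.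
have [dI AI] := contour_A delta_gt0 delta_lt A_sectorial M_gt0 C_bound eta1 etaT jP r0 b0
  (decay_le t) 0%:R ri ler01 (admissible0 r0 b0) (admissible1 r0 b0) mE u.
have := cauchy_contour1 t0 r0 eta1 eta_pi.
rewrite natr1 in AI; move=> E; rewrite E scale0r subr0 in AI.
by split; [exact: ro_domZ|rewrite roZ// AI].
Qed.

(** The scalar integral for e^(tz) dz / z is pi. *)
Lemma sg_int_A t u : 0 < t -> ro_dom A (sg_int t u) /\ A (sg_int t u) = sg t u - u.
Proof.
move=> t0; have b0 := decay_gt0 t0; have t1 : 0 < t^-1 by rewrite invr_gt0.
have mE x : 0 < x -> x ^+ 0 = x * x^-1 by move=> x0; rewrite expr0 divff// gt_eqF.
have B0 : 0 <= t^-1^-1 by rewrite invr_ge0 ltW.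
have [dI AI] := contour_A delta_gt0 delta_lt A_sectorial M_gt0 C_bound eta1 etaT jP t1 b0
  (decay_le t) (-1) (sqr_ge0 _) B0 (admissibleV t1 b0) (admissible0 t1 b0) mE u.
have E := cauchy_contour t0 t1 eta1 eta_pi.
rewrite addNr E in AI; split; first exact: ro_domZ.
rewrite roZ// AI scalerBr scalerA mulVf ?scale1r ?(sg_radius t0 t1)//.
by rewrite gt_eqF// pi_gt0.
Qed.

Lemma sg_comm l t u : 0 < l -> 0 < t -> sg t (Cz A j (Complex l 0) u) = Cz A j (Complex l 0) (sg t u).
Proof.
move=> l0 t0; have b0 := decay_gt0 t0; have ri : 0 <= r^-1 by rewrite invr_ge0 ltW.
have := contour_comm delta_gt0 delta_lt A_sectorial M_gt0 C_bound eta1 etaT jP r0 b0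
  (decay_le t) 0%:R l0 ri (admissible0 r0 b0).
move=> /(congr1 (fun B : Lr X => B u)) E; rewrite /sg LrscaleE [in RHS]LrscaleE LrZ; congr (_ *: _).
exact: E.
Qed.

Lemma sg_int_comm l t u : 0 < l -> 0 < t ->
  sg_int t (Cz A j (Complex l 0) u) = Cz A j (Complex l 0) (sg_int t u).
Proof.
move=> l0 t0; have b0 := decay_gt0 t0; have t1 : 0 < t^-1 by rewrite invr_gt0.
have := contour_comm delta_gt0 delta_lt A_sectorial M_gt0 C_bound eta1 etaT jP t1 b0
  (decay_le t) (-1) l0 (sqr_ge0 _) (admissibleV t1 b0).
move=> /(congr1 (fun B : Lr X => B u)) E; rewrite /sg_int LrscaleE [in RHS]LrscaleE LrZ; congr (_ *: _).
exact: E.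
Qed.

Lemma sg_deriv k t : 0 < t ->
  has_deriv (fun t => pi^-1 *: IK (mono k) k%:R t r : Lr X) t (pi^-1 *: IK (mono k.+1) k.+1%:R t r).
Proof.
by move=> t0; apply: has_derivZc; exact: (contour_deriv KP t0 r0 eta0 etaT ce).
Qed.

Variable T : R -> Lr X.
Hypotheses (T0 : T 0 = Lr_id) (TE : forall t, 0 < t -> T t = sg t).

Lemma sg_solution : solution_family A T sg' sg_const.
Proof.
split=> //.
- by have [] := A_sectorial.
- move=> t t0; apply: has_deriv_eq (sg_deriv 0 t0); exists t => // y.
  by rewrite ltr_norml => /andP[+ _] => yt; rewrite TE//; move: yt; lra.
- by move=> t u t0; rewrite TE//; have [] := sg_A u t0.
- by move=> t u t0; rewrite TE//; have [] := sg_A u t0.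
- by move=> t t0; rewrite TE//; exact: sg_norm.
- move=> t v t0 dv; rewrite TE//.
  by apply: (resolvent_comm (sg_resolvent ltr01)) => // u; exact: sg_comm.
- move=> t v t0 dv; rewrite TE//; have [_ <-] := sg_int_A v t0.
  rewrite (resolvent_comm (sg_resolvent ltr01) (B := sg_int t))//; last first.
    by move=> u; exact: sg_int_comm.
  apply: le_trans (Lr_le _ _) _; rewrite ler_wpM2r//; exact: sg_int_norm.
Qed.

Lemma T_comm l t u : 0 < l -> 0 < t -> T t (Cz A j (Complex l 0) u) = Cz A j (Complex l 0) (T t u).
Proof. by move=> l0 t0; rewrite TE//; exact: sg_comm. Qed.

Lemma T_analytic : real_analytic_on `]0, +oo[ T.
Proof.
move=> t; rewrite /= in_itv/= andbT => t0.
have [c Hc] := contour_mono_norm KP t0 r0 eta0 etaT ce.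
pose F n t : Lr X := pi^-1 *: IK (mono n) n%:R t r.
have b0 : 0 < t * (- cos eta) / 4 by rewrite divr_gt0// mulr_gt0// oppr_gt0.
have d0 : 0 < t / 2 by rewrite divr_gt0.
have [] := @cauchy_estimates_analytic R (Lr X) F t _ (pi^-1 * c) _ b0 d0.
- move=> k s; rewrite ltr_norml => /andP[s1 _]; apply: sg_deriv; lra.
- move=> n s sd; rewrite normrZ ger0_norm ?invr_ge0 ?pi_ge0// -[leRHS]mulrA.
  by apply: ler_wpM2l; [rewrite invr_ge0 pi_ge0|exact: Hc].
move=> e e0 H; exists (fun k => k`!%:R^-1 *: F k t), e => // s; rewrite /= in_itv/= andbT => s0 st.
by have := H (s - t) st; rewrite [t + _]addrC subrK (TE s0).
Qed.

End SectorialSemigroup.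

Theorem theorem5p6 (R : realType) (K : starAlgebra R) (X : banachBimodule K)
    (A : rightOperator X) (delta M : R)
    (delta_gt0 : 0 < delta) (delta_lt : delta < pi / 2)
    (A_sectorial : spherical_sectorial delta A)
    (M_gt0 : 0 < M)
    (C_bound : forall a : K, Sigma delta a ->
       (opnorm (Cres A a) <= (M / sa_norm a)%:E)%E)
    (j : K) (j_unit : SA j)
    (r eta : R) (r_gt0 : 0 < r)
    (eta_gt : pi / 2 < eta) (eta_lt : eta < pi / 2 + delta)
    (T : R -> Lr X) (T0 : T 0 = Lr_id)
    (T_def : forall t : R, 0 < t ->
       T t = (2 * pi)^-1 *: Gamma_integral j r eta (semigroup_integrand A j t)) :
  (forall t : R, 0 < t -> Gamma_converges j r eta (semigroup_integrand A j t)) /\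
  [/\ is_semigroup T, strongly_continuous T & is_generator A T] /\
  (forall l : R, 0 < l ->
     [/\ set_bij (ro_dom A) [set: X] (fun x => l *: x - A x),
         Cres A l%:A = Rres A l,
         bochner_integrable lebesgue_measure `[0, +oo[
           (fun t : R => expR (- (t * l)) *: T t) &
         Rres A l = bochner lebesgue_measure `[0, +oo[
           (fun t : R => expR (- (t * l)) *: T t)]) /\
  (forall (k : K) (t : R), SA k -> 0 < t ->
     Gamma_integral k r eta (semigroup_integrand A k t) =
     Gamma_integral j r eta (semigroup_integrand A j t)) /\
  real_analytic_on `]0, +oo[ T.
Proof.
have GC k t := @Gamma_contour R K X A delta M delta_lt A_sectorial M_gt0 C_bound k t r eta.
have TE t : 0 < t -> T t = sg A j r eta t.
  move=> t0; rewrite (T_def t t0); have [_ ->] := GC j t j_unit t0 r_gt0 eta_gt eta_lt.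
  by rewrite scalerA invfM mulrAC mulVf ?mul1r.
have HT := sg_solution delta_gt0 delta_lt A_sectorial M_gt0 C_bound j_unit r_gt0 eta_gt eta_lt T0 TE.
have TC := T_comm delta_gt0 delta_lt A_sectorial M_gt0 C_bound j_unit r_gt0 eta_gt eta_lt TE.
have HR l := @sg_resolvent R K X A delta M delta_gt0 delta_lt A_sectorial C_bound j j_unit l.
have Th0 : 0 < pi / 2 + delta by rewrite addr_gt0// divr_gt0// pi_gt0.
split; first by move=> t t0; have [] := GC j t j_unit t0 r_gt0 eta_gt eta_lt.
split.
  split; [exact: sol_semigroup HT|exact: sol_strongly_continuous HT|].
  exact: (sol_generator HT (HR 1 ltr01) (fun t u => TC 1 t u ltr01)).
split.
  move=> l l0; have S1 := sector_real l0 Th0.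
  have B := sol_laplace HT l0 (HR l l0) (fun t u => TC l t u l0).
  have RR := real_Rres delta_lt A_sectorial C_bound j_unit S1.
  split.
  - exact: (real_bij delta_lt A_sectorial C_bound j_unit S1).
  - by rewrite RR; exact: (real_Cres delta_lt A_sectorial C_bound j_unit S1).
  - by eexists; exact: B.
  - by rewrite RR (bochnerE _ B).
split; last exact: (T_analytic delta_lt A_sectorial M_gt0 C_bound j_unit r_gt0 eta_gt eta_lt TE).
move=> k t kP t0; have [_ ->] := GC j t j_unit t0 r_gt0 eta_gt eta_lt.
have [_ ->] := GC k t kP t0 r_gt0 eta_gt eta_lt.
by rewrite (contour_indep delta_gt0 delta_lt A_sectorial M_gt0 C_bound eta_gt eta_lt j_unit kP t0 r_gt0).
Qed.
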